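(* Let $X$ be any one of the following real Banach spaces: $c_0$; $C(K)$ with $K$ a countable compact Hausdorff space; the Tsirelson space; a (closed) subspace of $c_0$. Then every $\sigma$-porous subset of $X$ is $\Gamma$-null.
   Context: $B(z,r)$ is the closed ball with center $z$ and radius $r$. A set $A\subset X$ is porous if there is $0<c<1$ such that for every $x\in A$ there are $y_n\in X$ with $y_n\to x$ and $B(y_n,c\,\|y_n-x\|)\cap A=\emptyset$ for every $n$. A set is $\sigma$-porous if it is a union of countably many porous sets. Tsirelson space. This means the space as originally defined by Tsirelson; it is reflexive and has an unconditional basis, and it is the dual of the following space (Figiel–Johnson): the completion of the space $c_{00}$ of finitely supported real sequences under the unique norm satisfying $\|x\|=\max\{\|x\|_\infty,\ \tfrac12\sup\sum_{i=1}^k\|E_ix\|\}$, the supremum being over all $k\in\mathbb{N}$ and all finite sets $E_1<E_2<\dots<E_k$ of positive integers with $k\le\min E_1$, where $E_ix$ is the restriction of $x$ to $E_i$ and $E<F$ means $\max E<\min F$. $\Gamma$-null sets. $T=[0,1]^{\mathbb{N}}$ carries the product topology and the product Lebesgue (probability) measure $\mu$. $\Gamma(X)$ is the space of continuous maps $\gamma:T\to X$ having continuous partial derivatives $D_j\gamma:T\to X$ for all $j\in\mathbb{N}$ (one-sided where the $j$-th coordinate is $0$ or $1$), with the topology generated by the seminorms $\|\gamma\|_0=\sup_{t\in T}\|\gamma(t)\|$ and $\|\gamma\|_k=\sup_{t\in T}\|D_k\gamma(t)\|$, $k\ge1$. A Borel set $N\subset X$ is $\Gamma$-null if $\mu\{t\in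 T:\gamma(t)\in N\}=0$ for all $\gamma$ in a residual (comeager) subset of $\Gamma(X)$. An arbitrary set is $\Gamma$-null if it is contained in a Borel $\Gamma$-null set. *)

(* Defs.v *)
From HB Require Import structures.
From mathcomp Require Import all_boot all_order all_algebra finmap.
From mathcomp Require Import all_classical all_reals all_analysis.
Import Order.TTheory GRing.Theory Num.Theory.
Import numFieldNormedType.Exports.

Set Implicit Arguments.
Unset Strict Implicit.
Unset Printing Implicit Defensive.

Local Open Scope classical_set_scope.
Local Open Scope ring_scope.

Section porous.
Context {R : realType} {X : normedModType R}.
Implicit Types A : set X.

(* [closed_ball_ Num.norm z r] is [set x | `|z - x| <= r]; the library's
   [closed_ball z r] is the closure of the open ball, hence empty for r = 0. *)
Definition porous A : Prop :=
  exists c : R, 0 < c < 1 /\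
    forall x, A x ->
      exists y : nat -> X, y n @[n --> \oo] --> x /\
        forall n, closed_ball_ Num.norm (y n) (c * `|y n - x|) `&` A = set0.

Definition sigma_porous A : Prop :=
  exists F : nat -> set X, (forall n, porous (F n)) /\ A = \bigcup_n F n.

End porous.

(* The topology is the one induced by R. *)
Definition unit_interval (R : realType) : Type :=
  set_type (`[0, 1]%classic : set R).

Section unit_interval.
Context {R : realType}.

HB.instance Definition _ := Topological.on (unit_interval R).

Fact unit_interval0_subproof : (0 : R) \in (`[0, 1]%classic : set R).
Proof. by rewrite mem_set //= in_itv /= lexx ler01. Qed.

HB.instance Definition _ := isPointed.Build (unit_interval R)
  (exist _ (0 : R) unit_interval0_subproof : unit_interval R).

Definition coord (s : unit_interval R) : R := set_val s.

End unit_interval.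

Definition cube (R : realType) : Type :=
  prod_topology (fun _ : nat => unit_interval R).

HB.instance Definition _ (R : realType) := Topological.on (cube R).
HB.instance Definition _ (R : realType) := Pointed.on (cube R).

(* The cube with its Borel sigma-algebra, which is also the product
   sigma-algebra, all factors being second countable. *)
Definition borel_cube (R : realType) : Type :=
  g_sigma_algebraType (@open (cube R)).

HB.instance Definition _ (R : realType) := Measurable.on (borel_cube R).

(* This determines [mu] on all Borel sets: the measurable cylinders form a
   pi-system generating the sigma-algebra. *)
Definition is_product_lebesgue (R : realType)
    (mu : probability (borel_cube R) R) : Prop :=
  forall (n : nat) (A : nat -> set R), (forall j, measurable (A j)) ->
    mu [set t : cube R | forall j, (j < n)%N -> A j (coord (t j))] =
    (\prod_(j < n) lebesgue_measure (A j `&` `[0%R, 1%R]))%E.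

Section gamma.
Context {R : realType} {X : normedModType R}.
Implicit Types (g : cube R -> X) (k : nat) (t : cube R).

Definition diff_quotient k g t (s : unit_interval R) : X :=
  (coord s - coord (t k))^-1 *: (g (dfwith t k s) - g t).

(* The limit is taken in the topological space [0,1], so that it is one-sided
   when [t k] is an endpoint. *)
Definition partial_derivable k g : Prop :=
  forall t, cvg (diff_quotient k g t @ (t k)^').

Definition partial_derivative k g t : X := lim (diff_quotient k g t @ (t k)^').

Definition is_C1 g : Prop :=
  continuous g /\
  forall k, partial_derivable k g /\ continuous (partial_derivative k g).

(* The coordinates of the cube are numbered from 0, so the seminorm number
   [j.+1] concerns the coordinate number [j]. *)
Definition gamma_seminorm k g : R :=
  match k with
  | 0%N => sup [set `|g t| | t in setT]
  | j.+1 => sup [set `|partial_derivative j g t| | t in setT]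
  end.

End gamma.

Record Gamma (R : realType) (X : normedModType R) : Type := MkGamma {
  gamma_fun :> cube R -> X;
  gamma_C1 : is_C1 gamma_fun }.

Section gamma_topology.
Context {R : realType} {X : normedModType R}.

HB.instance Definition _ := gen_eqMixin (Gamma X).
HB.instance Definition _ := gen_choiceMixin (Gamma X).

Definition gamma_ball (g : Gamma X) (n : nat) (e : R) : set (Gamma X) :=
  [set h : Gamma X |
    forall k, (k <= n)%N -> gamma_seminorm k (h \- g) < e].

Definition gamma_open (U : set (Gamma X)) : Prop :=
  forall g, U g -> exists (n : nat) (e : R), 0 < e /\ gamma_ball g n e `<=` U.

Lemma gamma_openT : gamma_open setT.
Proof. by move=> g _; exists 0%N, 1. Qed.

Lemma gamma_openI (A B : set (Gamma X)) :
  gamma_open A -> gamma_open B -> gamma_open (A `&` B).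
Proof.
move=> oA oB g [/oA [n [e [e0 gA]]] /oB [m [d [d0 gB]]]].
exists (maxn n m), (Num.min e d); split; first by rewrite lt_min e0 d0.
move=> h hg; split; [apply: gA|apply: gB] => k kn.
- apply: lt_le_trans (hg k _) _; first by rewrite leq_max kn.
  by rewrite ge_min lexx.
- apply: lt_le_trans (hg k _) _; first by rewrite leq_max kn orbT.
  by rewrite ge_min lexx orbT.
Qed.

Lemma gamma_open_bigU (I : Type) (F : I -> set (Gamma X)) :
  (forall i, gamma_open (F i)) -> gamma_open (\bigcup_i F i).
Proof.
move=> oF g [i _ /oF [n [e [e0 gF]]]].
by exists n, e; split=> // h /gF Fh; exists i.
Qed.

HB.instance Definition _ := isOpenTopological.Build (Gamma X)
  gamma_openT gamma_openI gamma_open_bigU.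

End gamma_topology.

Definition residual (T : topologicalType) (S : set T) : Prop :=
  exists U : nat -> set T,
    (forall n, open (U n) /\ dense (U n)) /\ \bigcap_n U n `<=` S.

Definition borel (T : topologicalType) (N : set T) : Prop := <<s @open T >> N.

Section gamma_null.
Context {R : realType} (mu : probability (borel_cube R) R).
Context {X : normedModType R}.

Definition borel_Gamma_null (N : set X) : Prop :=
  borel N /\
  residual [set g : Gamma X | mu [set t : cube R | N (g t)] = 0%E].

Definition Gamma_null (A : set X) : Prop :=
  exists N : set X, borel_Gamma_null N /\ A `<=` N.

End gamma_null.

(* Injectivity of [J] follows from the last clause, [N] being a norm on [V]. *)
Definition isometric_to (R : realType) (X : normedModType R) (I : Type)
    (V : set (I -> R)) (N : (I -> R) -> R) : Prop :=
  exists J : X -> I -> R,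
    [/\ forall a x y i, J (a *: x + y) i = a * J x i + J y i,
        range J = V &
        forall x, `|x| = N (J x)].

Definition sup_norm (R : realType) (I : Type) (f : I -> R) : R :=
  sup [set `|f i| | i in setT].

Definition c0_seq (R : realType) : set (nat -> R) :=
  [set x | x n @[n --> \oo] --> (0 : R)].

Definition is_c0 (R : realType) (X : normedModType R) : Prop :=
  isometric_to X (@c0_seq R) (@sup_norm R nat).

Definition closed_subspace_of_c0 (R : realType) (V : set (nat -> R)) : Prop :=
  [/\ V `<=` @c0_seq R,
      V (fun=> 0),
      forall a x y, V x -> V y -> V (fun n => a * x n + y n) &
      forall x, @c0_seq R x ->
        (forall e : R, 0 < e ->
           exists2 y, V y & sup_norm (fun n => x n - y n) < e) ->
        V x].

Definition is_closed_subspace_of_c0 (R : realType) (X : normedModType R) :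
    Prop :=
  exists V : set (nat -> R),
    closed_subspace_of_c0 V /\ isometric_to X V (@sup_norm R nat).

Definition is_C_of_countable_compact (R : realType) (X : normedModType R) :
    Prop :=
  exists K : topologicalType,
    [/\ countable [set: K], compact [set: K], hausdorff_space K &
        isometric_to X [set f : K -> R | continuous f] (@sup_norm R K)].

Definition is_dual_of (R : realType) (X Y : normedModType R) : Prop :=
  isometric_to X [set f : Y -> R | scalar f /\ continuous f]
    (fun f => sup [set `|f y| | y in [set y : Y | `|y| <= 1]]).

Section tsirelson.
Context {R : realType}.
Implicit Types (x y : nat -> R) (N : (nat -> R) -> R).

(* Sequences indexed by the positive integers are functions on [nat] that
   vanish at 0. *)
Definition c00 : set (nat -> R) :=
  [set x | x 0%N = 0 /\ finite_set [set n | x n != 0]].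

Definition is_norm_on_c00 N : Prop :=
  [/\ forall x, c00 x -> 0 <= N x,
      forall x, c00 x -> N x = 0 -> x = (fun=> 0),
      forall a x, c00 x -> N (fun n => a * x n) = `|a| * N x &
      forall x y, c00 x -> c00 y -> N (fun n => x n + y n) <= N x + N y].

Definition restr (E : {fset nat}) x : nat -> R :=
  fun n => if n \in E then x n else 0.

(* k >= 1 and E_0 < ... < E_(k-1) are nonempty with k <= min E_0; in
   particular they consist of positive integers. *)
Definition admissible (k : nat) (E : nat -> {fset nat}) : Prop :=
  [/\ (0 < k)%N,
      forall i, (i < k)%N -> E i != fset0,
      forall i j m n, (i < j < k)%N -> m \in E i -> n \in E j -> (m < n)%N &
      forall m, m \in E 0%N -> (k <= m)%N].

(* For a norm [N] and [x] in [c00] the supremum is over a nonempty finite set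
   of values, since [restr E x] only depends on the trace of [E] on the finite
   support of [x]. *)
Definition figiel_johnson_eqn N : Prop :=
  forall x, c00 x ->
    N x = Num.max (sup_norm x)
      (2^-1 * sup [set s | exists k E, admissible k E /\
                             s = \sum_(i < k) N (restr (E i) x)]).

Definition is_completion_of_c00 N (Y : completeNormedModType R)
    (iota : (nat -> R) -> Y) : Prop :=
  [/\ forall a x y, c00 x -> c00 y ->
        iota (fun n => a * x n + y n) = a *: iota x + iota y,
      forall x, c00 x -> `|iota x| = N x &
      dense (iota @` c00)].

Definition is_tsirelson (X : normedModType R) : Prop :=
  exists (N : (nat -> R) -> R) (Y : completeNormedModType R)
         (iota : (nat -> R) -> Y),
    [/\ is_norm_on_c00 N, figiel_johnson_eqn N,
        is_completion_of_c00 N iota & is_dual_of X Y].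

End tsirelson.

(* Main.v *)
Require Import Defs.
From HB Require Import structures.
From mathcomp Require Import all_boot all_order all_algebra finmap.
From mathcomp Require Import all_classical all_reals all_analysis.
From mathcomp Require Import lra ring zify.
Import Order.TTheory GRing.Theory Num.Theory.
Import numFieldNormedType.Exports.
Import Defs.
Local Open Scope classical_set_scope.
Local Open Scope ring_scope.

Set Implicit Arguments.
Unset Strict Implicit.
Unset Printing Implicit Defensive.

(** Say that [A] is porous along a set [P] of directions if each of its points [x]
has, for some fixed [c > 0] and for arbitrarily short [u] in [P], a hole of radius
[c |u|] around [x + u]; and that [P] is good if the sets porous along [P] are
Gamma-null.  One has to show that the set of all directions is good.

Splitting: if every [h] in [V] is [y + z], with [z] in a good set [Q] and [y] in
[P] or negligible, then the part of a [V]-porous set where it is not porous along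
[P] is Gamma-null.  Indeed, it is porous along [Q]: if [x + h] is the centre of a
hole, a point [x'] of this part close to [x + z] would yield a point of the set
close to [x' + y], hence in the hole.

Game: suppose that [A] is porous along each [E k] and that for every [N], choosing
the sets [E k] well against an adversary who picks finitely many directions [u] in
each of them, one keeps all sums of [N] multiples [a u] of norm at most 1 bounded by a
fixed constant.  If [A] is not Gamma-null, the surfaces of some ball of Gamma(X)
can be approximated by surfaces meeting the (closed) porous set in measure at least
[q].  Adding to such a surface disjoint bumps in the directions of the holes
moves a fixed proportion of it out of the closure of [A], and changes the partial
derivatives by multiples of the [u]; the game keeps it in the ball, so that the
step can be repeated until the measure of the parameters leaving [A] exceeds 1.

In subspaces of c_0 one takes for [E k] the vectors that are small on the first
[k] coordinates: what is left of the complement is covered by finitely many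
rays.  For the dual of the Figiel-Johnson space the same works, because the vectors
occurring in the game are, up to small errors, sums of successive blocks starting
beyond the number of summands, on which the predual norm dominates half of the
l_1-sum.  In C(K), a clopen set [L] is good when the clopen subsets of [L] missing
a given point are: [E k] consists of the functions vanishing at [x] and off [T k],
with [T k] shrinking to [x].  Starting from a bad [K] one removes the points of [K]
one by one, keeping a decreasing sequence of nonempty clopen sets, against
compactness. *)

(** * The unit interval and the cube *)

(** The order of the quantifiers shapes the proof. The derivatives of the bumps cannot be made
    negligible: a bump of height |u| with slopes at most e0 needs a radius of order |u| / e0 in each
    controlled coordinate, and the proportion of its support that lands in a hole of size c |u|
    tends to 0 with e0. So e0, then the gain of a step, then the number N of steps are fixed in this
    order, and N changes of the derivatives, each of size up to e0, must add up to less than the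
    radius of the ball. Hence the constant of the game must not depend on N. The gain does not
    depend on the surface because a ball of Gamma(X) controls only finitely many derivatives: in the
    other coordinates the bumps may be as steep as necessary, and all these coordinates together
    cost at most half of the measure. The same freedom makes rays good: a slope in the direction of
    the ray in an uncontrolled coordinate is free of charge, and a shift of that coordinate reaches
    the holes. *)

Section unit_interval_topology.
Context {R : realType}.
Implicit Types s x : unit_interval R.

Lemma coord_itv s : 0 <= coord s <= 1.
Proof. by have /set_mem := valP s; rewrite /= in_itv. Qed.

Lemma coord_inj : injective (@coord R).
Proof. by move=> s x /val_inj. Qed.

Lemma coord_continuous : continuous (@coord R).
Proof. exact: initial_continuous. Qed.

Lemma nbhs_unit_interval x (U : set (unit_interval R)) :
  nbhs x U <-> exists2 e : R, 0 < e & forall s, `|coord s - coord x| < e -> U s.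
Proof.
split=> [|[e e0 eU]].
  move=> [_ [[V oV <-] Vx VU]].
  have /nbhs_ballP[e /= e0 eV] : nbhs (coord x) V by exact: open_nbhs_nbhs.
  by exists e => // s se; apply: VU; apply: eV; rewrite /ball/= distrC.
exists (@coord R @^-1` ball (coord x) e).
split; first by exists (ball (coord x) e) => //; exact: ball_open.
  exact: ballxx.
by move=> s /= se; apply: eU; rewrite distrC.
Qed.

Fact clamp_subproof (x : R) : Num.max 0 (Num.min 1 x) \in `[0, 1]%classic.
Proof. by rewrite inE/= in_itv/= le_max lexx/= ge_max ler01 ge_min lexx. Qed.

(** The retraction of the line onto [0, 1], a total inverse of [coord]: points of the interval can
    be given by real formulas. *)
Definition clamp (x : R) : unit_interval R :=
  exist (fun y => y \in `[0, 1]%classic) _ (clamp_subproof x).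

Lemma coord_clamp (x : R) : 0 <= x <= 1 -> coord (clamp x) = x.
Proof. by move=> /andP[x0 x1]; rewrite /coord/= /set_val/= min_r// max_r. Qed.

Lemma coordK : cancel (@coord R) clamp.
Proof. by move=> s; apply: coord_inj; rewrite coord_clamp// coord_itv. Qed.

Lemma clamp_contract (x y : R) : `|coord (clamp x) - coord (clamp y)| <= `|x - y|.
Proof.
have cE z : coord (clamp z) = if z < 0 then 0 else if 1 < z then 1 else z.
  rewrite (_ : coord _ = Num.max 0 (Num.min 1 z))// /Num.max /Num.min.
  by do !case: ifPn; rewrite -?leNgt => *; lra.
rewrite !cE ler_norml; case: (ger0P (x - y)) => ?;
  by do !case: ifPn; rewrite -?leNgt => *; apply/andP; split; lra.
Qed.

Lemma clamp_continuous : continuous clamp.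
Proof.
move=> x U /nbhs_unit_interval[e e0 eU].
apply/nbhs_ballP; exists e => //= y; rewrite /ball/= => xy.
by apply: eU; rewrite distrC; exact: le_lt_trans (clamp_contract _ _) xy.
Qed.

Lemma compact_unit_interval : compact [set: unit_interval R].
Proof.
rewrite (_ : setT = clamp @` `[0, 1]%classic); last first.
  apply/seteqP; split=> // s _ /=; exists (coord s); rewrite ?coordK//.
  by rewrite in_itv/= coord_itv.
apply: continuous_compact; last exact: segment_compact.
exact/continuous_subspaceT/clamp_continuous.
Qed.

Global Instance unit_interval_dnbhs_filter x : ProperFilter x^'.
Proof.
apply: Build_ProperFilter_ex => A.
rewrite -[x^' A]/(nbhs x (fun y => y != x -> A y)).
move=> /nbhs_unit_interval[e e0 eA].
have /andP[x0 x1] := coord_itv x.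
pose d := Num.min (e / 2) (1 / 2).
have d0 : 0 < d by rewrite /d lt_min !divr_gt0.
have [de d1] : d <= e / 2 /\ d <= 1 / 2 by rewrite /d !ge_min !lexx orbT.
(* A move of at most 1/2 towards the farther endpoint stays in [0, 1]. *)
pose y := if coord x <= 1 / 2 then coord x + d else coord x - d.
have yE : coord (clamp y) = y.
  by apply: coord_clamp; rewrite /y; case: ifPn; rewrite -?ltNge => ?; lra.
exists (clamp y); apply: eA.
  rewrite yE /y; case: ifPn => _.
    by rewrite addrC addKr gtr0_norm//; lra.
  by rewrite addrC addKr normrN gtr0_norm//; lra.
apply/eqP => /(congr1 (@coord R)); rewrite yE /y.
by case: ifPn => _; lra.
Qed.

(* Stated through local increments rather than derivatives, so that no
   extension of [F] outside the interval is needed. *)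
Lemma lipschitz_of_local (X : normedModType R) (F : unit_interval R -> X)
    (L : R) :
  (forall x, \forall s \near x, `|F s - F x| <= L * `|coord s - coord x|) ->
  forall x s, `|F s - F x| <= L * `|coord s - coord x|.
Proof.
move=> loc.
suff main x s : coord x <= coord s ->
    `|F s - F x| <= L * (coord s - coord x).
  move=> x s; have [xs|/ltW sx] := leP (coord x) (coord s).
    by rewrite (ger0_norm (_ : 0 <= coord s - coord x)) ?subr_ge0//; exact: main.
  by rewrite distrC (ler0_norm (_ : coord s - coord x <= 0)) ?subr_le0// opprB;
     exact: main.
move=> xs.
pose a := coord x; pose b := coord s.
have /andP[a0 a1] := coord_itv x; have /andP[b0 b1] := coord_itv s.
have G y : a <= y <= b -> coord (clamp y) = y.
  by move=> /andP[ay yb]; apply: coord_clamp; rewrite -/a -/b in a0 a1 b0 b1; lra.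
(* Induction along the interval: the bound holds up to the supremum [c] of [S], and the local
   hypothesis at [c] carries it past [c] unless [c = b]. *)
pose S := [set y : R | a <= y <= b /\
   forall z, a <= z <= y -> `|F (clamp z) - F x| <= L * (z - a)].
have Sa : S a.
  split; first by rewrite lexx.
  move=> z /andP[az za]; have -> : z = a by apply/eqP; rewrite eq_le az za.
  by rewrite /a coordK !subrr normr0 mulr0.
have hS : has_sup S.
  by split; [exists a | exists b => y [/andP[]]].
pose c := sup S.
have ac : a <= c by exact: ub_le_sup hS.2 _ _.
have cb : c <= b by apply: sup_le_ub => [|y [/andP[]]//]; exists a.
have cE : coord (clamp c) = c by apply: G; rewrite ac.
have /nbhs_unit_interval[e e0 eP] := loc (clamp c).
have below z : a <= z -> z < c -> `|F (clamp z) - F x| <= L * (z - a).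
  move=> az zc.
  have cz : 0 < c - z by rewrite subr_gt0.
  have [y Sy] := sup_adherent cz hS; rewrite subKr => zy.
  by apply: Sy.2; rewrite az ltW.
have Fc : `|F (clamp c) - F x| <= L * (c - a).
  have [->|ca] := eqVneq c a; first by have [_] := Sa; apply; rewrite lexx.
  have {}ca : a < c by rewrite lt_def ca.
  pose z := Num.max a (c - e / 2).
  have zc : z < c by rewrite /z gt_max ca/=; lra.
  have az : a <= z by rewrite /z le_max lexx.
  have ze : c - e / 2 <= z by rewrite /z le_max lexx orbT.
  have zE : coord (clamp z) = z by apply: G; rewrite az/=; lra.
  have h1 := below _ az zc.
  have h2 : `|F (clamp z) - F (clamp c)| <= L * (c - z).
    have := eP (clamp z); rewrite zE cE (_ : `|z - c| = c - z); last first.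
      by rewrite distrC gtr0_norm// subr_gt0.
    by apply; lra.
  rewrite (_ : F (clamp c) - F x = F (clamp z) - F x - (F (clamp z) - F (clamp c))).
    apply: le_trans (ler_normB _ _) _.
    by rewrite (_ : L * (c - a) = L * (z - a) + L * (c - z)) ?lerD//; ring.
  by rewrite opprB [RHS]addrC addrA subrK.
have beyond z : c <= z -> z <= b -> z < c + e ->
    `|F (clamp z) - F x| <= L * (z - a).
  move=> cz zb zce.
  have zE : coord (clamp z) = z by apply: G; rewrite zb andbT; lra.
  have h2 : `|F (clamp z) - F (clamp c)| <= L * (z - c).
    have := eP (clamp z); rewrite zE cE (_ : `|z - c| = z - c); last first.
      by rewrite ger0_norm// subr_ge0.
    by apply; lra.
  rewrite (_ : F (clamp z) - F x = F (clamp z) - F (clamp c) + (F (clamp c) - F x)).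
    apply: le_trans (ler_normD _ _) _.
    by rewrite (_ : L * (z - a) = L * (z - c) + L * (c - a)) ?lerD//; ring.
  by rewrite addrA subrK.
have [cb'|] := ltP c b; last first.
  move=> bc; have cbE : c = b by apply/eqP; rewrite eq_le cb bc.
  by move: Fc; rewrite cbE coordK.
exfalso.
pose z := Num.min b (c + e / 2).
have cz : c < z by rewrite /z lt_min cb'/=; lra.
have zb : z <= b by rewrite /z ge_min lexx.
have ze : z <= c + e / 2 by rewrite /z ge_min lexx orbT.
suff Sz : S z by have := ub_le_sup hS.2 Sz; rewrite -/c leNgt cz.
split; first by rewrite zb andbT; lra.
move=> y /andP[ay yz]; have [yc|cy] := ltP y c; first exact: below.
by apply: beyond => //; lra.
Qed.

End unit_interval_topology.

Section cube_topology.
Context {R : realType}.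
Implicit Types t : cube R.

(* Without this shortcut, instance resolution unfolds the product topology. *)
Global Instance cube_nbhs_filter t : Filter (nbhs t) := nbhs_filter t.

Lemma cube_cst_continuous (Y : topologicalType) (y : Y) :
  continuous (fun _ : cube R => y).
Proof. by move=> t; exact: cvg_cst. Qed.

Lemma cvg_cube (F : set_system (cube R)) t : Filter F ->
  (forall i, (fun u : cube R => u i) @ F --> t i) -> F --> t.
Proof.
move=> FF h; apply/cvg_sup => i U [_ [[V oV <-] Vt VU]].
have /h : nbhs (t i) V by exact: open_nbhs_nbhs.
by rewrite /nbhs/=; apply: filterS.
Qed.

Lemma compact_cube : compact [set: cube R].
Proof.
rewrite (_ : setT = [set t : cube R | forall i, setT (t i)]).
  exact: (@tychonoff nat (fun=> unit_interval R) _ (fun=> compact_unit_interval)).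
by apply/seteqP; split.
Qed.

Lemma coord_proj_continuous i : continuous (fun t => coord (t i)).
Proof.
move=> t; apply: (@continuous_comp _ _ _ (fun t : cube R => t i) (@coord R)).
  exact: (@proj_continuous nat (fun=> unit_interval R) i).
exact: coord_continuous.
Qed.

Lemma nbhs_cube t (U : set (cube R)) : nbhs t U ->
  exists M (e : R), 0 < e /\
    forall u : cube R, (forall i, (i < M)%N -> `|coord (u i) - coord (t i)| < e) -> U u.
Proof.
(* The sets containing a cylinder around [t] form a filter; it converges to [t] in every coordinate,
   so it contains all neighbourhoods of [t]. *)
pose F : set_system (cube R) := fun U => exists M (e : R), 0 < e /\
  forall u : cube R, (forall i, (i < M)%N -> `|coord (u i) - coord (t i)| < e) -> U u.
have FF : Filter F.
  split.
  - by exists 0%N, 1.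
  - move=> P Q [M [e [e0 eP]]] [N [d [d0 dQ]]].
    exists (maxn M N), (Num.min e d); split; first by rewrite lt_min e0.
    move=> u H; split.
      apply: eP => i iM; have := H i; rewrite leq_max iM => /(_ isT).
      by rewrite lt_min => /andP[].
    apply: dQ => i iM; have := H i; rewrite leq_max iM orbT => /(_ isT).
    by rewrite lt_min => /andP[].
  - by move=> P Q PQ [M [e [e0 eP]]]; exists M, e; split=> // u /eP /PQ.
suff : F --> t by exact.
apply: (@cvg_cube F t FF) => i V /nbhs_unit_interval[e e0 eV].
by exists i.+1, e; split=> // u /(_ i (ltnSn i)) /eV.
Qed.

Lemma cylinder_nbhs M t (d : R) : 0 < d ->
  nbhs t [set u : cube R | forall i, (i < M)%N -> `|coord (u i) - coord (t i)| < d].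
Proof.
move=> d0; elim: M => [|M IH]; first by apply: filterS filterT => u.
have := @coord_proj_continuous M t; move/cvgrPdist_lt => /(_ d d0) H.
apply: filterS2 H IH => u H IH i; rewrite ltnS leq_eqVlt => /predU1P[->|].
  by rewrite distrC.
exact: IH.
Qed.

(** Composition with this map gives surfaces depending on finitely many coordinates, to which the
    box estimates apply. *)
Definition truncate (M : nat) t : cube R :=
  fun i => if (i < M)%N then t i else clamp 0.

Lemma truncate_dfwith M t k s : (k < M)%N ->
  truncate M (dfwith t k s) = dfwith (truncate M t) k s.
Proof.
move=> kM; apply/funext => i; rewrite /truncate.
have [->|ik] := eqVneq i k; first by rewrite kM !dfwithin.
by rewrite !dfwithout// eq_sym.
Qed.

Lemma truncate_continuous M : continuous (truncate M).
Proof.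
move=> t U /nbhs_cube[N [e [e0 eU]]].
apply: filterS (cylinder_nbhs N t e0) => u ut; apply: eU => i iN.
by rewrite /truncate; case: ifPn => _; [exact: ut|rewrite subrr normr0].
Qed.

(** A truncation that keeps the coordinates defining a cylinder does not leave it; compactness makes
    their number uniform in [t]. *)
Lemma cube_unif_truncate (X : normedModType R) (f : cube R -> X) (e : R) :
  continuous f -> 0 < e ->
  exists M, forall m t, (M <= m)%N -> `|f (truncate m t) - f t| < e.
Proof.
move=> cf e0.
have /compact_near_coveringP/(_ nat \oo
  (fun m t => `|f (truncate m t) - f t| < e)) := compact_cube.
case=> [t _|M _ H]; last by exists M => m t Mm; exact: H.
have : nbhs t [set u | `|f t - f u| < e / 2].
  by have := cf t; move/cvgrPdist_lt; apply; rewrite divr_gt0.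
move=> /nbhs_cube[M [d [d0 dU]]].
exists ([set u : cube R | forall i, (i < M)%N ->
           `|coord (u i) - coord (t i)| < d], [set m | (M <= m)%N]).
  by split=> /=; [exact: cylinder_nbhs|exists M].
move=> [u m] /= [ut Mm].
have h1 := dU u ut.
have h2 : `|f t - f (truncate m u)| < e / 2.
  by apply: dU => i iM; rewrite /truncate (leq_trans iM Mm); exact: ut.
rewrite (_ : f (truncate m u) - f u = f t - f u - (f t - f (truncate m u))).
  by rewrite (splitr e); apply: le_lt_trans (ler_normB _ _) _; exact: ltrD.
by rewrite opprB [RHS]addrC addrA subrK.
Qed.

Lemma cube_bounded (X : normedModType R) (f : cube R -> X) :
  continuous f -> exists2 B : R, 0 < B & forall t, `|f t| <= B.
Proof.
move=> cf.
have /compact_bounded[B [_ HB]] : compact (f @` setT).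
  apply: continuous_compact compact_cube.
  exact: continuous_subspaceT.
exists (`|B| + 1) => [|t]; first by rewrite ltr_pwDr.
apply: HB; last by exists t.
by apply: le_lt_trans (ler_norm B) _; rewrite ltrDl.
Qed.

End cube_topology.

(** * Surfaces of class C^1 *)

Section derives.
Context {R : realType}.
Implicit Types f df g dg : R -> R.

(** With the difference quotient multiplied out there is no division at [y = x], and [y] can be
    restricted to values of [coord]. *)
Definition derives f df := forall x e : R, 0 < e ->
  exists2 d : R, 0 < d &
    forall y, `|y - x| < d -> `|f y - f x - df x * (y - x)| <= e * `|y - x|.

Lemma derives_cst (c : R) : derives (fun=> c) (fun=> 0).
Proof.
move=> x e e0; exists 1 => // y _.
by rewrite subrr mul0r subrr normr0 mulr_ge0// ltW.
Qed.

Lemma derives_affine (a b : R) : derives (fun x => a * x + b) (fun=> a).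
Proof.
move=> x e e0; exists 1 => // y _.
rewrite [X in `|X| <= _](_ : _ = 0) ?normr0 ?mulr_ge0 ?(ltW e0)//; ring.
Qed.

Lemma derivesD f df g dg : derives f df -> derives g dg ->
  derives (fun x => f x + g x) (fun x => df x + dg x).
Proof.
move=> hf hg x e e0.
have e20 : 0 < e / 2 by rewrite divr_gt0.
have [d d0 H] := hf x _ e20; have [d' d'0 H'] := hg x _ e20.
exists (Num.min d d'); first by rewrite lt_min d0.
move=> y; rewrite lt_min => /andP[/H h /H' h'].
rewrite [X in `|X| <= _](_ : _ = f y - f x - df x * (y - x) + (g y - g x - dg x * (y - x))).
  apply: le_trans (ler_normD _ _) _.
  by rewrite [e in leRHS]splitr mulrDl lerD.
ring.
Qed.

Lemma derivesZ (c : R) f df : derives f df ->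
  derives (fun x => c * f x) (fun x => c * df x).
Proof.
move=> hf x e e0.
have c0 : 0 < `|c| + 1 by rewrite ltr_wpDl.
have [d d0 H] := hf x _ (divr_gt0 e0 c0); exists d => // y /H h.
rewrite [X in `|X| <= _](_ : _ = c * (f y - f x - df x * (y - x))); last by ring.
rewrite normrM; apply: le_trans (ler_wpM2l (normr_ge0 _) h) _.
rewrite mulrA ler_wpM2r// mulrCA ger_pMr// ler_pdivrMr// mul1r.
by rewrite lerDl.
Qed.

Lemma derives_lip f df x : derives f df -> exists2 d : R, 0 < d &
  forall y, `|y - x| < d -> `|f y - f x| <= (`|df x| + 1) * `|y - x|.
Proof.
move=> hf; have [d d0 H] := hf x _ ltr01; exists d => // y /H h.
rewrite -(subrK (df x * (y - x)) (f y - f x)).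
apply: le_trans (ler_normD _ _) _.
by rewrite normrM mulrDl addrC lerD2l.
Qed.

Lemma derives_continuous f df : derives f df -> continuous f.
Proof.
move=> hf x; apply/cvgrPdist_lt => e e0.
have [d d0 H] := derives_lip x hf.
have c0 : 0 < `|df x| + 1 by rewrite ltr_wpDl.
apply/nbhs_ballP; exists (Num.min d (e / (`|df x| + 1))) => /=.
  by rewrite lt_min d0 divr_gt0.
move=> y; rewrite /ball/= lt_min => /andP[yd ye].
rewrite distrC; rewrite distrC in yd; rewrite distrC in ye.
by apply: le_lt_trans (H _ yd) _; rewrite mulrC -ltr_pdivlMr.
Qed.

Lemma derivesM f df g dg : derives f df -> derives g dg ->
  derives (fun x => f x * g x) (fun x => df x * g x + f x * dg x).
Proof.
move=> hf hg x e e0.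
have [d1 d10 H1] := derives_lip x hf; have [d2 d20 H2] := derives_lip x hg.
set B := `|df x| + 1 in H1; set C := `|dg x| + 1 in H2.
have B0 : 0 < B by rewrite ltr_wpDl.
have C0 : 0 < C by rewrite ltr_wpDl.
pose D : R := `|f x| + `|g x| + 1.
have D0 : 0 < D by rewrite ltr_wpDl// addr_ge0.
have eD : 0 < e / 2 / D by rewrite !divr_gt0.
have [d3 d30 H3] := hf x _ eD; have [d4 d40 H4] := hg x _ eD.
have eBC : 0 < e / 2 / (B * C) by rewrite !divr_gt0// mulr_gt0.
exists (Num.min (Num.min d1 d2) (Num.min (Num.min d3 d4) (e / 2 / (B * C)))).
  by rewrite !lt_min d10 d20 d30 d40.
move=> y; rewrite !lt_min => /andP[/andP[/H1 h1 /H2 h2] /andP[/andP[/H3 h3 /H4 h4] h5]].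
rewrite [X in `|X| <= _](_ : _ = (f y - f x - df x * (y - x)) * g x +
  f x * (g y - g x - dg x * (y - x)) + (f y - f x) * (g y - g x)); last by ring.
apply: le_trans (ler_normD _ _) _.
rewrite [in leRHS](splitr e) [in leRHS]mulrDl; apply: lerD.
  apply: le_trans (ler_normD _ _) _; rewrite !normrM.
  apply: (@le_trans _ _ (e / 2 / D * `|y - x| * `|g x| + `|f x| * (e / 2 / D * `|y - x|))).
    by apply: lerD; [exact: ler_wpM2r|exact: ler_wpM2l].
  rewrite (_ : _ + _ = e / 2 * `|y - x| * ((`|f x| + `|g x|) / D)); last by ring.
  apply: ler_piMr; last by rewrite ler_pdivrMr// mul1r lerDl.
  by rewrite mulr_ge0// ltW// divr_gt0.
rewrite normrM.
apply: le_trans (ler_pM (normr_ge0 _) (normr_ge0 _) h1 h2) _.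
rewrite mulrACA (mulrA (B * C)) ler_wpM2r//.
by rewrite -ler_pdivlMl ?mulr_gt0// mulrC ltW.
Qed.

Lemma derives_comp_affine f df (a b : R) : derives f df ->
  derives (fun x => f (a * x + b)) (fun x => a * df (a * x + b)).
Proof.
move=> hf x e e0.
have c0 : 0 < `|a| + 1 by rewrite ltr_wpDl.
have [d d0 H] := hf (a * x + b) _ (divr_gt0 e0 c0).
exists (d / (`|a| + 1)); first by rewrite divr_gt0.
move=> y; rewrite ltr_pdivlMr// => yd.
have E : a * y + b - (a * x + b) = a * (y - x) by ring.
have yxd : `|a * y + b - (a * x + b)| < d.
  rewrite E normrM; apply: le_lt_trans yd.
  by rewrite mulrC ler_wpM2l// lerDl.
have := H _ yxd; rewrite E (_ : df _ * _ = a * df (a * x + b) * (y - x)); last by ring.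
move=> h; apply: le_trans h _; rewrite normrM.
rewrite mulrA ler_wpM2r// mulrAC -mulrA ger_pMr// ler_pdivrMr// mul1r lerDl//.
Qed.

Let pos (x : R) : R := Num.max 0 x.

Let derives_pos2 : derives (fun x => pos x ^+ 2) (fun x => 2 * pos x).
Proof.
move=> x e e0; exists e => // y ye.
apply: (@le_trans _ _ (`|y - x| ^+ 2)); last first.
  by rewrite expr2 ler_wpM2r// ltW.
rewrite real_normK ?num_real// ler_norml /pos.
have h := sqr_ge0 (y - x).
case: (leP 0 x) => x0; case: (leP 0 y) => y0; apply/andP; split; nra.
Qed.

Let pos_continuous : continuous pos.
Proof.
move=> x; apply: continuous_max; [exact: cvg_cst|exact: cvg_id].
Qed.

(** The quadratic spline with knots 0, 1/2, 1 that rises from 0 to 1; its slope reaches 2 at 1/2. *)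
Let step (x : R) := 2 * (pos x ^+ 2) + (- 4) * (pos (1 * x + - 2^-1) ^+ 2)
  + 2 * (pos (1 * x + - 1) ^+ 2).
Let dstep (x : R) := 2 * (2 * pos x) + (- 4) * (1 * (2 * pos (1 * x + - 2^-1)))
  + 2 * (1 * (2 * pos (1 * x + - 1))).

Let derives_step : derives step dstep.
Proof.
apply: derivesD; first apply: derivesD.
- exact: derivesZ derives_pos2.
- by apply: derivesZ; exact: derives_comp_affine derives_pos2.
- by apply: derivesZ; exact: derives_comp_affine derives_pos2.
Qed.

Let dstep_continuous : continuous dstep.
Proof.
have H (a b : R) : continuous (fun x => pos (a * x + b)).
  move=> x; apply: (@continuous_comp _ _ _ (fun x => a * x + b) pos).
    apply: cvgD; last exact: cvg_cst.
    by apply: cvgM; [exact: cvg_cst|exact: cvg_id].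
  exact: pos_continuous.
move=> x; rewrite /dstep; apply: cvgD; first apply: cvgD.
- apply: cvgM; first exact: cvg_cst.
  by apply: cvgM; [exact: cvg_cst|exact: pos_continuous].
- apply: cvgM; first exact: cvg_cst.
  apply: cvgM; first exact: cvg_cst.
  by apply: cvgM; [exact: cvg_cst|exact: H].
- apply: cvgM; first exact: cvg_cst.
  apply: cvgM; first exact: cvg_cst.
  by apply: cvgM; [exact: cvg_cst|exact: H].
Qed.

Let step_bounds x : [/\ 0 <= step x <= 1, `|dstep x| <= 2,
  x <= 0 -> step x = 0 /\ dstep x = 0 & 1 <= x -> step x = 1].
Proof.
rewrite /step /dstep /pos ler_norml.
case: (leP 0 x) => h1; case: (leP 0 (1 * x + - 2^-1)) => h2;
  case: (leP 0 (1 * x + - 1)) => h3; (split=> [| |?|?];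
  [apply/andP; split; nra|apply/andP; split; nra|split; nra|nra]).
Qed.

(** The product of a step rising on [a, a + d] and one falling on [b - d, b]. Each has slope at most
    [2 / d]; they may overlap, whence [4 / d]. *)
Lemma plateau (a b d : R) : 0 < d -> exists f df,
  [/\ derives f df, continuous df, forall x, 0 <= f x <= 1,
      forall x, `|df x| <= 4 / d &
      (forall x, a + d <= x <= b - d -> f x = 1) /\
      forall x, x <= a \/ b <= x -> f x = 0 /\ df x = 0].
Proof.
move=> d0.
have V : d^-1 * d = 1 by rewrite mulVf// gt_eqF.
have dV0 : 0 < d^-1 by rewrite invr_gt0.
exists (fun x => step (d^-1 * x + - (a / d)) * step ((- d^-1) * x + b / d)).
exists (fun x => d^-1 * dstep (d^-1 * x + - (a / d)) * step ((- d^-1) * x + b / d) +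
   step (d^-1 * x + - (a / d)) * (- d^-1 * dstep ((- d^-1) * x + b / d))).
have cont (p q : R) (g : R -> R) : continuous g ->
    continuous (fun x => g (p * x + q)).
  move=> cg x; apply: (@continuous_comp _ _ _ (fun x => p * x + q) g).
    apply: cvgD; last exact: cvg_cst.
    by apply: cvgM; [exact: cvg_cst|exact: cvg_id].
  exact: cg.
have cstep : continuous step := derives_continuous derives_step.
split.
- by apply: derivesM; apply: derives_comp_affine.
- move=> x; apply: cvgD; (apply: cvgM; last (idtac)).
  + by apply: cvgM; [exact: cvg_cst|exact: cont dstep_continuous x].
  + exact: cont cstep x.
  + exact: cont cstep x.
  + by apply: cvgM; [exact: cvg_cst|exact: cont dstep_continuous x].
- move=> x; have [/andP[s0 s1] _ _ _] := step_bounds (d^-1 * x + - (a / d)).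
  have [/andP[t0 t1] _ _ _] := step_bounds (- d^-1 * x + b / d).
  by rewrite mulr_ge0// mulr_ile1.
- move=> x; have [/andP[s0 s1] S _ _] := step_bounds (d^-1 * x + - (a / d)).
  have [/andP[t0 t1] T _ _] := step_bounds (- d^-1 * x + b / d).
  apply: le_trans (ler_normD _ _) _; rewrite !normrM normrN (gtr0_norm dV0).
  rewrite (ger0_norm s0) (ger0_norm t0).
  rewrite (_ : 4 / d = d^-1 * 2 * 1 + 1 * (d^-1 * 2)); last by ring.
  apply: lerD.
    by apply: ler_pM => //; [rewrite mulr_ge0// ltW|rewrite ler_wpM2l// ltW].
  by apply: ler_pM => //; [rewrite mulr_ge0// ltW|rewrite ler_wpM2l// ltW].
- split=> x.
    move=> /andP[ax xb].
    have [_ _ _ ->] := step_bounds (d^-1 * x + - (a / d)).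
      have [_ _ _ ->] := step_bounds (- d^-1 * x + b / d); first by rewrite mulr1.
      rewrite (_ : _ + _ = (b - x) / d); last by ring.
      by rewrite ler_pdivlMr// mul1r; lra.
    rewrite (_ : _ + _ = (x - a) / d); last by ring.
    by rewrite ler_pdivlMr// mul1r; lra.
  case=> h.
    have [_ _ + _] := step_bounds (d^-1 * x + - (a / d)).
    rewrite (_ : d^-1 * x + - (a / d) = (x - a) / d); last by ring.
    by move=> [|-> ->]; rewrite ?(mul0r, mulr0, addr0)// ler_pdivrMr// mul0r; lra.
  have [_ _ + _] := step_bounds (- d^-1 * x + b / d).
  rewrite (_ : - d^-1 * x + b / d = (b - x) / d); last by ring.
  by move=> [|-> ->]; rewrite ?(mul0r, mulr0, addr0)// ler_pdivrMr// mul0r; lra.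
Qed.

End derives.

(** * Partial derivatives and Lipschitz estimates on the cube *)

Section partial_derivatives.
Context {R : realType} {X : normedModType R}.
Implicit Types (g h : cube R -> X) (k : nat) (t : cube R).

Definition has_partial k g (dg : cube R -> X) : Prop :=
  forall t, diff_quotient k g t @ (t k)^' --> dg t.

Lemma has_partialE k g dg : has_partial k g dg ->
  partial_derivable k g /\ partial_derivative k g = dg.
Proof.
move=> H; split; first by move=> t; apply/cvg_ex; exists (dg t); exact: H.
by apply/funext => t; apply: cvg_lim => //; exact: H.
Qed.

Lemma partial_derivableP k g : partial_derivable k g ->
  has_partial k g (partial_derivative k g).
Proof. by move=> H t; exact: H. Qed.

Lemma has_partialD k g h dg dh : has_partial k g dg -> has_partial k h dh ->
  has_partial k (g \+ h) (dg \+ dh).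
Proof.
move=> Hg Hh t.
rewrite (_ : diff_quotient k (g \+ h) t =
  diff_quotient k g t \+ diff_quotient k h t); first exact: cvgD.
apply/funext => s; rewrite /diff_quotient/= -scalerDr; congr (_ *: _).
by rewrite opprD addrACA.
Qed.

Lemma has_partialN k g dg : has_partial k g dg -> has_partial k (\- g) (\- dg).
Proof.
move=> Hg t.
rewrite (_ : diff_quotient k (\- g) t = \- diff_quotient k g t); first exact: cvgN.
by apply/funext => s; rewrite /diff_quotient/= -scalerN opprD.
Qed.

Lemma has_partial_cst k (x : X) : has_partial k (fun=> x) (fun=> 0).
Proof.
move=> t; rewrite (_ : diff_quotient k _ t = fun=> 0); first exact: cvg_cst.
by apply/funext => s; rewrite /diff_quotient subrr scaler0.
Qed.

Lemma is_C1P g (dg : nat -> cube R -> X) : continuous g ->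
  (forall k, has_partial k g (dg k)) -> (forall k, continuous (dg k)) ->
  is_C1 g /\ forall k, partial_derivative k g = dg k.
Proof.
move=> cg hg cdg; split; last by move=> k; have [] := has_partialE (hg k).
by split=> // k; have [h ->] := has_partialE (hg k).
Qed.

Lemma is_C1_partial g : is_C1 g ->
  [/\ continuous g, forall k, has_partial k g (partial_derivative k g) &
      forall k, continuous (partial_derivative k g)].
Proof.
by move=> [cg hg]; split=> // k; [exact/partial_derivableP/(hg k).1|exact: (hg k).2].
Qed.

Lemma is_C1D g h : is_C1 g -> is_C1 h -> is_C1 (g \+ h) /\
  forall k, partial_derivative k (g \+ h) =
    partial_derivative k g \+ partial_derivative k h.
Proof.
move=> /is_C1_partial[cg pg dg] /is_C1_partial[ch ph dh].
apply: (@is_C1P _ (fun k => partial_derivative k g \+ partial_derivative k h)) => [t|k|k t]; [exact: (cvgD (cg t) (ch t))|exact: has_partialD|].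
exact: (cvgD (dg k t) (dh k t)).
Qed.

Lemma is_C1N g : is_C1 g -> is_C1 (\- g) /\
  forall k, partial_derivative k (\- g) = \- partial_derivative k g.
Proof.
move=> /is_C1_partial[cg pg dg].
apply: (@is_C1P _ (fun k => \- partial_derivative k g)) => [t|k|k t]; [exact: (cvgN (cg t))|exact: has_partialN|].
exact: (cvgN (dg k t)).
Qed.

Lemma is_C1B g h : is_C1 g -> is_C1 h -> is_C1 (g \- h) /\
  forall k, partial_derivative k (g \- h) =
    partial_derivative k g \- partial_derivative k h.
Proof.
move=> cg ch; have [ch' E] := is_C1N ch; have [cgh F] := is_C1D cg ch'.
by split=> // k; rewrite (F k) E.
Qed.

Lemma is_C1_cst (x : X) : is_C1 (fun=> x : X) /\
  forall k, partial_derivative k (fun=> x) = fun=> 0.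
Proof.
apply: (@is_C1P _ (fun k => fun=> 0)) => [t|k|k t]; [exact: (@cube_cst_continuous R X x t)|exact: has_partial_cst|].
exact: (@cube_cst_continuous R X 0 t).
Qed.

Lemma is_C1_sum (I : eqType) (s : seq I) (F : I -> cube R -> X) :
  (forall i, i \in s -> is_C1 (F i)) ->
  is_C1 (fun t => \sum_(i <- s) F i t) /\
  forall k t, partial_derivative k (fun t => \sum_(i <- s) F i t) t =
    \sum_(i <- s) partial_derivative k (F i) t.
Proof.
elim: s => [|i s IH] H.
  rewrite (_ : (fun t => _) = fun=> 0); last by apply/funext => t; rewrite big_nil.
  by have [h E] := is_C1_cst 0; split=> // k t; rewrite E big_nil.
have [hs Es] : is_C1 (fun t => \sum_(i <- s) F i t) /\
  forall k t, partial_derivative k (fun t => \sum_(i <- s) F i t) t =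
    \sum_(i <- s) partial_derivative k (F i) t.
  by apply: IH => j js; apply: H; rewrite inE js orbT.
have hi : is_C1 (F i) by apply: H; rewrite inE eqxx.
have [h E] := is_C1D hi hs.
rewrite (_ : (fun t => _) = F i \+ (fun t => \sum_(i <- s) F i t)); last first.
  by apply/funext => t; rewrite big_cons.
by split=> // k t; rewrite E big_cons/= Es.
Qed.

Lemma diff_quotient_truncate M k g t : (k < M)%N ->
  diff_quotient k (g \o truncate M) t = diff_quotient k g (truncate M t).
Proof.
move=> kM; apply/funext => s; rewrite /diff_quotient/= truncate_dfwith//.
by rewrite (_ : truncate M t k = t k)// /truncate kM.
Qed.

Lemma is_C1_truncate M g : is_C1 g -> is_C1 (g \o truncate M) /\
  forall k, partial_derivative k (g \o truncate M) =
    if (k < M)%N then partial_derivative k g \o truncate M else fun=> 0.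
Proof.
move=> /is_C1_partial[cg pg dg].
have ct : continuous (truncate M) := @truncate_continuous R M.
apply: (@is_C1P _ (fun k => if (k < M)%N then partial_derivative k g \o truncate M
  else fun=> 0)) => [t|k|k t].
- by apply: continuous_comp; [exact: ct|exact: cg].
- move=> t; case: ifPn => kM.
    rewrite diff_quotient_truncate//=.
    have -> : t k = truncate M t k by rewrite /truncate kM.
    exact: pg.
  rewrite (_ : diff_quotient _ _ _ = fun=> 0); first exact: cvg_cst.
  apply/funext => s; rewrite /diff_quotient/=.
  rewrite (_ : truncate M (dfwith t k s) = truncate M t) ?subrr ?scaler0//.
  apply/funext => i; rewrite /truncate; case: ifPn => // iM.
  rewrite dfwithout//; apply/eqP => ki; move: kM.
  by rewrite ki iM.
- case: ifPn => kM; last exact: (@cube_cst_continuous R X 0 t).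
  by apply: continuous_comp; [exact: ct|exact: dg].
Qed.

Lemma coordinate_lipschitz k g dg (L : R) t (s : unit_interval R) :
  has_partial k g dg -> (forall t, `|dg t| <= L) ->
  `|g (dfwith t k s) - g t| <= L * `|coord s - coord (t k)|.
Proof.
move=> hg hL; apply/ler_addgt0Pr => e e0.
have E : dfwith t k (t k) = t.
  by apply/funext => i; case: dfwithP.
(* The slack [e] turns the convergence of the difference quotients into a local Lipschitz bound. It
   disappears at the end because two coordinates differ by at most 1. *)
pose L' := L + e.
have main : forall x u, `|g (dfwith t k u) - g (dfwith t k x)| <=
    L' * `|coord u - coord x|.
  apply: (@lipschitz_of_local _ _ (fun s => g (dfwith t k s)) L') => x.
  have := hg (dfwith t k x); rewrite dfwithin => /cvgrPdist_le/(_ e e0) H.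
  suff : \forall s \near x, s != x -> `|g (dfwith t k s) - g (dfwith t k x)| <=
       L' * `|coord s - coord x|.
    apply: filterS => u hu; have [->|ux] := eqVneq u x; last exact: hu.
    by rewrite !subrr !normr0 mulr0.
  suff : x^' [set s | `|g (dfwith t k s) - g (dfwith t k x)| <=
       L' * `|coord s - coord x|] by [].
  have ne : x^' [set s | s != x] by exact: nbhs_dnbhs_neq.
  near=> u.
  have ux : u != x by near: u.
  have ux' : coord u - coord x != 0.
    by rewrite subr_eq0; apply: contra_neq ux => /coord_inj.
  have h : `|dg (dfwith t k x) - diff_quotient k g (dfwith t k x) u| <= e.
    by near: u; exact: H.
  have dd : dfwith (dfwith t k x) k u = dfwith t k u.
    apply/funext => i; have [->|ik] := eqVneq i k; first by rewrite !dfwithin.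
    by rewrite !dfwithout// eq_sym.
  have {h} : `|diff_quotient k g (dfwith t k x) u| <= L'.
    rewrite -(subrK (dg (dfwith t k x)) (diff_quotient _ _ _ _)).
    apply: le_trans (ler_normD _ _) _; rewrite addrC distrC.
    exact: lerD.
  rewrite /diff_quotient dd dfwithin normrZ normfV.
  by rewrite mulrC ler_pdivrMr// normr_gt0.
have := main (t k) s; rewrite E => h; apply: le_trans h _.
rewrite /L' mulrDl lerD2l ger_pMr//.
have := coord_itv s; have := coord_itv (t k).
by move=> /andP[? ?] /andP[? ?]; rewrite ler_norml; apply/andP; split; lra.
Unshelve. all: by end_near. Qed.

Lemma cylinder_lipschitz M g (L : nat -> R) (u t : cube R) :
  (forall v, g (truncate M v) = g v) ->
  (forall k, (k < M)%N -> exists2 dg, has_partial k g dg & forall t, `|dg t| <= L k) ->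
  `|g u - g t| <= \sum_(i < M) L i * `|coord (u i) - coord (t i)|.
Proof.
move=> gM hL.
(* The first [M] coordinates of [t] are replaced by those of [u] one at a time; the later ones do
   not affect [g]. *)
pose mix m : cube R := fun i => if (i < m)%N then u i else t i.
have -> : g u = g (mix M).
  rewrite -gM -[RHS]gM; congr g; apply/funext => i; rewrite /truncate /mix.
  by case: ifP.
have : forall m, (m <= M)%N -> `|g (mix m) - g t| <=
    \sum_(i < m) L i * `|coord (u i) - coord (t i)|.
  elim=> [_|m IH mM].
    rewrite big_ord0 (_ : mix 0%N = t) ?subrr ?normr0//.
  rewrite big_ord_recr/=.
    rewrite (_ : _ - g t = (g (mix m) - g t) + (g (mix m.+1) - g (mix m))); last first.
      by rewrite [RHS]addrC addrA subrK.
  apply: le_trans (ler_normD _ _) _; apply: lerD.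
    by apply: IH; exact: ltnW.
  have [dg hdg Ldg] := hL m mM.
  have -> : mix m.+1 = dfwith (mix m) m (u m).
    apply/funext => i; have [->|im] := eqVneq i m.
      by rewrite dfwithin /mix ltnS leqnn.
    by rewrite dfwithout 1?eq_sym// /mix ltnS leq_eqVlt (negbTE im).
  have -> : t m = mix m m by rewrite /mix ltnn.
  exact: coordinate_lipschitz hdg Ldg.
by move=> /(_ M (leqnn M)).
Qed.

End partial_derivatives.

(** * Products of functions of one coordinate *)

Section tensor.
Context {R : realType} {X : normedModType R}.
Implicit Types (f df : nat -> R -> R) (M k : nat) (t : cube R).

Definition tensor M f t : R := \prod_(i < M) f i (coord (t i)).

Lemma tensor_continuous M f : (forall i, (i < M)%N -> continuous (f i)) ->
  continuous (tensor M f).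
Proof.
elim: M => [|M IH] cf t.
  rewrite (_ : tensor 0 f = fun=> 1); first exact: (@cube_cst_continuous R R 1 t).
  by apply/funext => u; rewrite /tensor big_ord0.
rewrite (_ : tensor M.+1 f = fun t => tensor M f t * f M (coord (t M))); last first.
  by apply/funext => u; rewrite /tensor big_ord_recr.
have h1 : continuous (tensor M f).
  by apply: IH => i iM; apply: cf; rewrite ltnS ltnW.
have h2 : continuous (fun t : cube R => f M (coord (t M))).
  move=> u; apply: (@continuous_comp _ _ _ (fun t : cube R => coord (t M)) (f M)).
    exact: coord_proj_continuous.
  by apply: cf.
exact: (cvgM (h1 t) (h2 t)).
Qed.

Lemma diff_quotient_tensor M f k t (u : X) (s : unit_interval R) : (k < M)%N ->
  diff_quotient k (fun t => tensor M f t *: u) t s =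
  ((coord s - coord (t k))^-1 * (f k (coord s) - f k (coord (t k)))) *:
   (tensor M (fun i => if i == k then fun=> 1 else f i) t *: u).
Proof.
move=> kM; rewrite /diff_quotient -scalerBl !scalerA; congr (_ *: _).
rewrite -mulrA; congr (_ * _).
rewrite /tensor (bigD1 (Ordinal kM))//= [X in _ - X](bigD1 (Ordinal kM))//=.
rewrite [X in _ = _ * X](bigD1 (Ordinal kM))//= eqxx mul1r dfwithin mulrBl.
congr (_ - _); congr (_ * _); apply: eq_bigr => i ik.
  by rewrite dfwithout 1?eq_sym//; case: eqP => // ki; rewrite -val_eqE/= ki eqxx in ik.
by case: eqP => // ki; rewrite -val_eqE/= ki eqxx in ik.
Qed.

Lemma is_C1_tensor M f df (u : X) :
  (forall i, (i < M)%N -> derives (f i) (df i)) ->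
  (forall i, (i < M)%N -> continuous (df i)) ->
  is_C1 (fun t => tensor M f t *: u) /\
  forall k, partial_derivative k (fun t => tensor M f t *: u) =
    fun t => if (k < M)%N then
      tensor M (fun i => if i == k then df i else f i) t *: u else 0.
Proof.
move=> hf cdf.
have cf i : (i < M)%N -> continuous (f i).
  by move=> /hf; exact: derives_continuous.
apply: (@is_C1P _ _ _ (fun k t => if (k < M)%N then
      tensor M (fun i => if i == k then df i else f i) t *: u else 0)) => [t|k t|k t].
- apply: (@cvgZr_tmp R X (cube R) (nbhs t) _ (tensor M f) _ u).
  exact: tensor_continuous.
- case: ifPn => kM; last first.
    rewrite (_ : diff_quotient _ _ _ = fun=> 0); first exact: cvg_cst.
    apply/funext => s; rewrite /diff_quotient -scalerBl scalerA.
    rewrite (_ : tensor M f (dfwith t k s) = tensor M f t) ?subrr ?mulr0 ?scale0r//.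
    apply: eq_bigr => i _; rewrite dfwithout//; apply: contraNneq kM => ->.
    exact: ltn_ord.
  set T1 := tensor M (fun i => if i == k then fun=> 1 else f i) t.
  rewrite (_ : diff_quotient _ _ _ = fun s =>
     ((coord s - coord (t k))^-1 * (f k (coord s) - f k (coord (t k)))) *:
       (T1 *: u)); last first.
    by apply/funext => s; rewrite diff_quotient_tensor.
  have -> : tensor M (fun i => if i == k then df i else f i) t *: u =
      df k (coord (t k)) *: (T1 *: u).
    rewrite scalerA; congr (_ *: _); rewrite /T1 /tensor (bigD1 (Ordinal kM))//=.
    rewrite [X in _ = _ * X](bigD1 (Ordinal kM))//=.
    rewrite eqxx mul1r; congr (_ * _); apply: eq_bigr => i ik.
    by case: eqP => // ki; rewrite -val_eqE/= ki eqxx in ik.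
  apply: cvgZr_tmp; apply/cvgrPdist_le => e e0.
  have [d d0 H] := hf k kM (coord (t k)) e e0.
  have ne : (t k)^' [set s | s != t k] by exact: nbhs_dnbhs_neq.
  have nd : (t k)^' [set s | `|coord s - coord (t k)| < d].
    by apply: nbhs_dnbhs; apply/nbhs_unit_interval; exists d.
  apply: filterS2 ne nd => s st sd.
  have st' : coord s - coord (t k) != 0.
    by rewrite subr_eq0; apply: contra_neq st => /coord_inj.
  have h := H _ sd.
  rewrite distrC (_ : _ - _ = (coord s - coord (t k))^-1 *
    (f k (coord s) - f k (coord (t k)) - df k (coord (t k)) * (coord s - coord (t k)))).
    by rewrite normrM normfV mulrC ler_pdivrMr// normr_gt0.
  by rewrite [RHS]mulrBr [X in _ = _ - X]mulrC mulfK.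
- case: (k < M)%N; last exact: (@cube_cst_continuous R X 0 t).
  apply: (@cvgZr_tmp R X (cube R) (nbhs t) _ _ _ u).
  apply: (@tensor_continuous M) => i iM.
  by case: ifPn => _; [exact: cdf|exact: cf].
Qed.

End tensor.

(** The form in which total boundedness is used: with rounding to a finite grid as [kap], the list
    is a finite net of [K] consisting of points of [K]. *)
Lemma finite_reps (A : eqType) (F : finType) (kap : A -> F) (K : set A) :
  exists s : seq A, (forall p, p \in s -> K p) /\
    forall t, K t -> exists2 p, p \in s & kap t = kap p.
Proof.
suff H (r : seq F) : exists s : seq A, (forall p, p \in s -> K p) /\
    forall t, K t -> kap t \in r -> exists2 p, p \in s & kap t = kap p.
  have [s [sK covs]] := H (enum F); exists s; split=> // t Kt.
  by apply: covs => //; rewrite mem_enum.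
elim: r => [|k r [s [sK covs]]]; first by exists [::].
have [[p Kp pk]|nk] := pselect (exists2 p, K p & kap p = k).
  exists (p :: s); split=> [q|t Kt]; rewrite inE => /predU1P[].
  - by move=> ->.
  - exact: sK.
  - by move=> ->; exists p; rewrite // inE eqxx.
  by move=> /(covs t Kt)[q qs e]; exists q => //; rewrite inE qs orbT.
exists s; split=> // t Kt; rewrite inE => /predU1P[tk|]; last exact: covs.
by exfalso; apply: nk; exists t.
Qed.

(** * A covering lemma *)

Section greedy.
Context {R : realType} {T : eqType}.

(** The list is sorted by increasing [rho] and the induction treats its tail first. So the larger
    points are selected first, and a point is rejected only because of a selected one that is at
    least as large. *)
Lemma greedy_separated (rho : T -> R) (sep : T -> T -> Prop) (s : seq T) :
  (forall p q, sep p q -> sep q p) ->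
  exists P : seq T, [/\ uniq P, {subset P <= s},
    forall p q, p \in P -> q \in P -> p != q -> sep p q &
    forall p, p \in s -> exists2 q, q \in P & rho p <= rho q /\ (p = q \/ ~ sep p q)].
Proof.
move=> symS.
pose leT := relpre rho <=%R.
have leT_tot : total leT by move=> x y; exact: le_total.
have leT_tr : transitive leT by move=> x y z; exact: le_trans.
suff H s' : sorted leT s' -> exists P : seq T, [/\ uniq P, {subset P <= s'},
    forall p q, p \in P -> q \in P -> p != q -> sep p q &
    forall p, p \in s' -> exists2 q, q \in P & rho p <= rho q /\ (p = q \/ ~ sep p q)].
  have [P [h1 h2 h3 h4]] := H _ (sort_sorted leT_tot s).
  exists P; split=> // [p /h2|p ps]; first by rewrite mem_sort.
  by apply: h4; rewrite mem_sort.
elim: s' => [_|p s' IH]; first by exists [::]; split.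
move=> /= pth; have /IH[P [uP sP sepP covP]] := path_sorted pth.
have pmin q : q \in s' -> rho p <= rho q.
  by move: q; apply/allP; exact: order_path_min pth.
have [[q qP npq]|nsep] := pselect (exists2 q, q \in P & p = q \/ ~ sep p q).
  exists P; split=> //; first by move=> r /sP rs; rewrite inE rs orbT.
  move=> r; rewrite inE => /predU1P[->|/covP//]; exists q => //.
  by split=> //; exact/pmin/sP.
have sepp q : q \in P -> sep p q.
  by move=> qP; apply: contra_notP nsep => npq; exists q => //; right.
exists (p :: P); split.
- rewrite /= uP andbT; apply/negP => pP; apply: nsep; exists p => //; by left.
- by move=> r; rewrite !inE => /predU1P[->|/sP ->]; rewrite ?eqxx ?orbT.
- move=> a b; rewrite !inE => /predU1P[->|aP] /predU1P[->|bP].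
  + by rewrite eqxx.
  + by move=> _; exact: sepp.
  + by move=> _; apply: symS; exact: sepp.
  + exact: sepP.
- move=> r; rewrite inE => /predU1P[->|/covP[q qP h]].
    by exists p; [rewrite inE eqxx|split=> //; left].
  by exists q => //; rewrite inE qP orbT.
Qed.

End greedy.

(** * Boxes, their measure, and a Vitali argument *)

Section cube_measure.
Context {R : realType}.
Implicit Types (t p q : cube R) (M m i : nat) (a b : nat -> R).

Lemma open_measurable_cube (A : set (cube R)) :
  open A -> measurable (A : set (borel_cube R)).
Proof. by move=> oA; exact: sub_sigma_algebra. Qed.

Lemma closed_measurable_cube (A : set (cube R)) :
  closed A -> measurable (A : set (borel_cube R)).
Proof.
move=> cA; rewrite -[A]setCK; apply: measurableC.
by apply: open_measurable_cube; exact: closed_openC.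
Qed.

Definition box M a b : set (cube R) :=
  [set t | forall i, (i < M)%N -> a i <= coord (t i) <= b i].

Lemma closed_box M a b : closed (box M a b).
Proof.
rewrite (_ : box M a b = \bigcap_(i in `I_M)
    ((fun t => coord (t i)) @^-1` `[a i, b i]%classic)).
  apply: closed_bigI => i _; apply: closed_comp; last exact: itv_closed.
  by move=> t _; exact: coord_proj_continuous.
apply/seteqP; split=> t H i iM; first by rewrite /= in_itv/=; exact: H.
by have := H i iM; rewrite /= in_itv.
Qed.

(** The length of the trace of [x, y] on [0, 1]. *)
Definition len (x y : R) : R := Num.max 0 (Num.min y 1 - Num.max x 0).

Lemma len_ge0 x y : 0 <= len x y. Proof. by rewrite le_max lexx. Qed.

Variable mu : probability (borel_cube R) R.
Hypothesis mu_lebesgue : is_product_lebesgue mu.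

Lemma measure_box M a b : mu (box M a b) = (\prod_(i < M) len (a i) (b i))%:E.
Proof.
have := mu_lebesgue M (fun i => measurable_itv `[a i, b i]).
rewrite (_ : [set t | _] = box M a b); last first.
  apply/seteqP; split=> t H i iM; have := H i iM; by rewrite /= in_itv.
move=> ->; rewrite -prodEFin; apply: eq_bigr => i _.
rewrite (_ : _ `&` _ = `[Num.max (a i) 0, Num.min (b i) 1]%classic); last first.
  apply/seteqP; split=> x /=; rewrite !in_itv/= ge_max le_min.
    by move=> [/andP[-> ->] /andP[-> ->]].
  by move=> /andP[/andP[-> ->] /andP[-> ->]].
rewrite lebesgue_measure_itv/= lte_fin /len.
case: ifPn => h; first by rewrite -EFinB (@max_r _ _ 0)// ltW// subr_gt0.
by rewrite (@max_l _ _ 0)// subr_le0 leNgt.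
Qed.

Lemma measure_cover (A : eqType) (P : seq A) (B : A -> set (cube R)) :
  (forall p : A, p \in P -> measurable (B p : set (borel_cube R))) ->
  measurable (\big[setU/set0]_(p <- P) B p : set (borel_cube R)) /\
  (mu (\big[setU/set0]_(p <- P) B p) <= \sum_(p <- P) mu (B p))%E.
Proof.
elim: P => [|p P IH] mB; first by rewrite !big_nil measure0.
have [m1 le1] := IH (fun (q : A) qP => mB q (mem_behead (s := p :: P) qP)).
have m0 : measurable (B p : set (borel_cube R)) by apply: mB; rewrite inE eqxx.
rewrite !big_cons; split; first exact: measurableU.
apply: le_trans (measureU2 _ m0 m1) _.
exact: leeD2l.
Qed.

Lemma measure_packing (A : eqType) (P : seq A) (B : A -> set (cube R))
    (G G' : set (cube R)) :
  uniq P -> (forall p : A, p \in P -> measurable (B p : set (borel_cube R))) ->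
  measurable (G : set (borel_cube R)) -> measurable (G' : set (borel_cube R)) ->
  (forall p q : A, p \in P -> q \in P -> p != q -> B p `&` B q = set0) ->
  G `<=` G' -> (forall p : A, p \in P -> B p `<=` G' /\ B p `&` G = set0) ->
  (mu G + \sum_(p <- P) mu (B p) <= mu G')%E.
Proof.
elim: P G => [|p P IH] G /=.
  move=> _ _ mG mG' _ GG' _; rewrite big_nil adde0.
  by apply: le_measure; rewrite ?inE.
move=> /andP[pP uP] mB mG mG' dis GG' BG.
have m0 : measurable (B p : set (borel_cube R)) by apply: mB; rewrite inE eqxx.
have [BpG' BpG] := BG p (mem_head _ _).
rewrite big_cons addeA -measureU//; last by rewrite setIC.
apply: IH => //.
- by move=> q qP; apply: mB; rewrite inE qP orbT.
- exact: measurableU.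
- by move=> q r qP rP; apply: dis; rewrite inE ?qP ?rP orbT.
- by rewrite subUset.
- move=> q qP; have [h1 h2] : B q `<=` G' /\ B q `&` G = set0.
    by apply: BG; rewrite inE qP orbT.
  split=> //; rewrite setIUr h2 set0U; apply: dis; rewrite ?inE ?qP ?eqxx ?orbT//.
  by apply: contraNneq pP => <-.
Qed.

Section covering.
Variables (M m : nat) (J : pred nat) (rho : cube R -> R).
Hypothesis m0 : (0 < m)%N.

Definition cell t i : nat := Num.trunc (m%:R * coord (t i)).

Lemma cell_itv t i : (cell t i)%:R / m%:R <= coord (t i) < (cell t i).+1%:R / m%:R.
Proof.
have mR : 0 < m%:R :> R by rewrite ltr0n.
have /andP[t0 _] := coord_itv (t i).
have /truncn_itv : 0 <= m%:R * coord (t i) by rewrite mulr_ge0.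
by rewrite ler_pdivrMr// ltr_pdivlMr// [_ * m%:R]mulrC.
Qed.

Lemma cell_le t i : (cell t i <= m)%N.
Proof.
have /andP[t0 t1] := coord_itv (t i).
have /andP[h _] := cell_itv t i.
rewrite -(ler_nat R); rewrite ler_pdivrMr ?ltr0n// in h.
by apply: le_trans h _; rewrite ger_pMl// ltr0n.
Qed.

Lemma cell_eq t p i : cell t i = cell p i -> `|coord (t i) - coord (p i)| <= m%:R^-1.
Proof.
move=> e; have := cell_itv t i; have := cell_itv p i; rewrite e -addn1 natrD mulrDl mul1r.
by move=> /andP[? ?] /andP[? ?]; rewrite ler_norml; apply/andP; split; lra.
Qed.

(** This makes the boxes of [p] and [q] disjoint, a box being a product of open intervals of radius
    [rho] in the coordinates of [J] and of grid cells in the others. *)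
Definition separated p q : Prop := exists2 i, (i < M)%N &
  if J i then rho p + rho q <= `|coord (p i) - coord (q i)| else cell p i != cell q i.

Lemma grid_reps (K : set (cube R)) : exists s : seq (cube R),
  (forall p, p \in s -> K p) /\
  forall t, K t -> exists2 p, p \in s & forall i, (i < M)%N -> cell t i = cell p i.
Proof.
pose kap t : {ffun 'I_M -> 'I_m.+1} := [ffun i : 'I_M => inord (cell t i)].
have [s [sK covs]] := finite_reps kap K; exists s; split=> // t /covs[p ps e].
exists p => // i iM.
have := congr1 (fun f : {ffun 'I_M -> 'I_m.+1} => val (f (Ordinal iM))) e.
by rewrite /kap !ffunE/= !inordK ?ltnS ?cell_le.
Qed.

(** A point [t] is within [m%:R^-1 <= rho p] of the representative [r] of its cell, and [r] is
    within [rho r + rho p <= 2 * rho p] of the selected [p] that excluded it; hence the factor 3. *)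
Lemma covering_points (K : set (cube R)) : (forall p, K p -> m%:R^-1 <= rho p) ->
  exists P : seq (cube R), [/\ uniq P, forall p, p \in P -> K p,
    forall p q, p \in P -> q \in P -> p != q -> separated p q &
    forall t, K t -> exists2 p, p \in P & forall i, (i < M)%N ->
      if J i then `|coord (t i) - coord (p i)| <= 3 * rho p else cell t i == cell p i].
Proof.
move=> mrho; have [s [sK covs]] := grid_reps K.
have [|P [uP Ps sepP covP]] := @greedy_separated R _ rho separated s.
  move=> p q [i iM h]; exists i => //; move: h.
  by case: (J i); rewrite 1?distrC 1?addrC 1?eq_sym.
exists P; split=> // [p /Ps/sK//|t Kt].
have [r rs tr] := covs t Kt; have [p pP [rp h]] := covP r rs.
exists p => // i iM; have mp := mrho p (sK p (Ps p pP)).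
have tr1 := cell_eq (tr i iM).
have V : 0 < m%:R^-1 :> R by rewrite invr_gt0 ltr0n.
case: ifPn => Ji.
  case: h => [rpE|nsep].
    rewrite -rpE in mp *; apply: le_trans tr1 _; lra.
  have {nsep} h : `|coord (r i) - coord (p i)| < rho r + rho p.
    rewrite ltNge; apply/negP => h; apply: nsep; exists i => //; by rewrite Ji.
  rewrite -(subrK (coord (r i)) (coord (t i))) -addrA.
  apply: le_trans (ler_normD _ _) _; lra.
rewrite tr//; case: h => [->//|nsep].
apply: contra_notT nsep => h; exists i => //; by rewrite (negbTE Ji).
Qed.

Variables (alpha beta : cube R -> nat -> R) (d : R).

(** The part of the box of [p] that is to be moved into the hole found at [p]. The margin [d / m] in
    the cells leaves room for the slopes of a bump. *)
Definition inner p : set (cube R) := box M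
  (fun i => if J i then alpha p i else ((cell p i)%:R + d) / m%:R)
  (fun i => if J i then beta p i else ((cell p i)%:R + 1 - d) / m%:R).

(* A Vitali argument: the sides of [inner p] are of order [rho p] in the coordinates of
   [J], and nearly those of a cell of the grid of mesh [1 / m] in the others.  A greedy
   choice of [P] makes the boxes of radius [3 * rho p], respectively the cells, cover
   [K], while the inner boxes are disjoint. *)
Lemma covering_gain (K : set (cube R)) (tau f0 : R) :
  measurable (K : set (borel_cube R)) ->
  0 < d < 2^-1 -> 0 <= tau ->
  (forall p, K p -> m%:R^-1 <= rho p) ->
  (forall p i, K p -> (i < M)%N -> J i ->
     [/\ 0 <= alpha p i, beta p i <= 1, tau * rho p <= beta p i - alpha p i,
         coord (p i) - rho p < alpha p i & beta p i < coord (p i) + rho p]) ->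
  0 <= f0 -> f0 <= \prod_(i < M) (if J i then tau / 6 else 1 - 2 * d) ->
  exists P : seq (cube R), [/\ uniq P, forall p, p \in P -> K p,
    forall p q, p \in P -> q \in P -> p != q -> separated p q &
    forall G G' : set (cube R),
      measurable (G : set (borel_cube R)) -> measurable (G' : set (borel_cube R)) ->
      G `<=` G' -> (forall p, p \in P -> inner p `<=` G' /\ inner p `&` G = set0) ->
      (mu G + f0%:E * mu K <= mu G')%E].
Proof.
move=> mK /andP[d0 d1] tau0 mrho ab f00 f0le.
have [P [uP PK sepP covP]] := covering_points mrho.
exists P; split=> // G G' mG mG' GG' PG.
have mR : 0 < m%:R :> R by rewrite ltr0n.
pose outer p := box M
  (fun i => if J i then coord (p i) - 3 * rho p else (cell p i)%:R / m%:R)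
  (fun i => if J i then coord (p i) + 3 * rho p else (cell p i).+1%:R / m%:R).
(* In a coordinate of [J] the outer length is at most [6 * rho p] and the inner one at least
   [tau * rho p]; elsewhere a cell of length [1 / m] loses [d / m] at both ends. *)
have lenle p i : p \in P -> (i < M)%N ->
  (if J i then tau / 6 else 1 - 2 * d) *
  len (if J i then coord (p i) - 3 * rho p else (cell p i)%:R / m%:R)
      (if J i then coord (p i) + 3 * rho p else (cell p i).+1%:R / m%:R) <=
  len (if J i then alpha p i else ((cell p i)%:R + d) / m%:R)
      (if J i then beta p i else ((cell p i)%:R + 1 - d) / m%:R).
  move=> /PK Kp iM; have := ab p i Kp iM; case: (J i) => [/(_ isT)|_].
    move=> [a0 b1 tab _ _].
    have r0 : 0 <= rho p by apply: le_trans (mrho p Kp); rewrite invr_ge0.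
    have h1 : len (coord (p i) - 3 * rho p) (coord (p i) + 3 * rho p) <= 6 * rho p.
      rewrite /len ge_max mulr_ge0//=.
      have : Num.min (coord (p i) + 3 * rho p) 1 <= coord (p i) + 3 * rho p.
        by rewrite ge_min lexx.
      have : coord (p i) - 3 * rho p <= Num.max (coord (p i) - 3 * rho p) 0.
        by rewrite le_max lexx.
      lra.
    have h2 : beta p i - alpha p i <= len (alpha p i) (beta p i).
      by rewrite /len (min_l b1) (max_l a0) le_max lexx orbT.
    apply: le_trans h2; apply: le_trans tab.
    rewrite mulrAC ler_pdivrMr// -mulrA.
    by rewrite ler_wpM2l// [rho p * 6]mulrC.
  have d2 : 0 <= 1 - 2 * d by lra.
  have /andP[c1 _] := cell_itv p i; have := cell_le p i.
  have cp : 0 <= (cell p i)%:R / m%:R :> R by rewrite divr_ge0.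
  (* The cell numbered [m] meets [0, 1] only in the point 1, so its length is 0. *)
  rewrite leq_eqVlt => /predU1P[->|cm].
    rewrite (_ : len (m%:R / m%:R) _ = 0) ?mulr0 ?len_ge0//.
    rewrite /len divff ?gt_eqF// (max_l ler01) max_l// subr_le0.
  have cm1 : (cell p i).+1%:R / m%:R <= 1 :> R.
    by rewrite ler_pdivrMr// mul1r ler_nat.
  rewrite -addn1 natrD in cm1 *.
  have V : 0 < m%:R^-1 :> R by rewrite invr_gt0.
  have e1 : ((cell p i)%:R + d) / m%:R = (cell p i)%:R / m%:R + d / m%:R by rewrite mulrDl.
  have e2 : ((cell p i)%:R + 1 - d) / m%:R = ((cell p i)%:R + 1) / m%:R - d / m%:R.
    by rewrite mulrBl.
  have dm : 0 < d / m%:R by rewrite divr_gt0.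
  rewrite /len (min_l cm1) (max_l cp) e1 e2.
  rewrite (@min_l _ _ (_ - _)); last by lra.
  rewrite (@max_l _ _ (_ + d / _)); last by lra.
  rewrite (_ : ((cell p i)%:R + 1) / m%:R - (cell p i)%:R / m%:R = m%:R^-1); last by ring.
  rewrite (max_r (ltW V)).
  rewrite le_max; apply/orP; right.
  by rewrite le_eqVlt; apply/orP; left; apply/eqP; ring.
have mugain p : p \in P -> (f0%:E * mu (outer p) <= mu (inner p))%E.
  move=> pP; rewrite /outer /inner !measure_box -EFinM lee_fin.
  apply: (@le_trans _ _ ((\prod_(i < M) (if J i then tau / 6 else 1 - 2 * d)) *
    \prod_(i < M) len (if J i then coord (p i) - 3 * rho p else (cell p i)%:R / m%:R)
      (if J i then coord (p i) + 3 * rho p else (cell p i).+1%:R / m%:R))).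
    by apply: ler_wpM2r => //; apply: prodr_ge0 => i _; exact: len_ge0.
  rewrite -big_split/=; apply: ler_prod => i _.
  rewrite lenle ?andbT// mulr_ge0 ?len_ge0//.
  by case: ifP => _; [rewrite divr_ge0|lra].
have mbox p a b : measurable (box M a b : set (borel_cube R)).
  by apply: closed_measurable_cube; exact: closed_box.
have Kcov : K `<=` \big[setU/set0]_(p <- P) outer p.
  move=> t /covP[p pP h]; rewrite -bigcup_seq; exists p => // i iM.
  have := h i iM; case: (J i) => [|/eqP<-].
    by rewrite ler_norml => /andP[? ?]; apply/andP; split; lra.
  by have /andP[-> /ltW ->] := cell_itv t i.
have [mU leU] := @measure_cover _ P outer (fun p _ => mbox p _ _).
have Kle : (mu K <= \sum_(p <- P) mu (outer p))%E.
  by apply: le_trans leU; apply: le_measure; rewrite ?inE.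
have pack : (mu G + \sum_(p <- P) mu (inner p) <= mu G')%E.
  apply: measure_packing => //; first by move=> p _; exact: mbox.
  move=> p q pP qP pq; rewrite -subset0 => t [tp tq].
  have [i iM] := sepP p q pP qP pq; have := tp i iM; have := tq i iM.
  case: ifPn => Ji.
    have [_ _ _ h1 h2] := ab p i (PK p pP) iM Ji.
    have [_ _ _ h3 h4] := ab q i (PK q qP) iM Ji.
    move=> /andP[? ?] /andP[? ?] /=; apply/negP; rewrite -ltNge.
    by rewrite ltr_norml; apply/andP; split; lra.
  rewrite !ler_pdivrMr// !ler_pdivlMr//.
  move=> /andP[q1 q2] /andP[p1 p2]; rewrite neq_ltn => /orP[].
    rewrite -(ler_nat R) -addn1 natrD => ?; lra.
  rewrite -(ler_nat R) -addn1 natrD => ?; lra.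
apply: le_trans pack; apply: leeD2l.
apply: (@le_trans _ _ (\sum_(p <- P) (f0%:E * mu (outer p)))%E).
  rewrite -ge0_sume_distrr//.
  by rewrite lee_wpmul2l// lee_fin.
by rewrite [leLHS]big_seq [leRHS]big_seq; apply: lee_sum => p pP; exact: mugain.
Qed.

End covering.

End cube_measure.

Lemma exists_invn {R : realType} (e : R) : 0 < e -> exists i : nat, i.+1%:R^-1 < e.
Proof.
move=> e0; exists (Num.trunc e^-1); rewrite invf_plt ?posrE//.
have /truncn_itv/andP[_ //] : 0 <= e^-1 by rewrite invr_ge0 ltW.
Qed.

(** * Surfaces and holes *)

Section gamma_space.
Context {R : realType} {X : normedModType R}.
Implicit Types (g h : Gamma X) (n k : nat) (e : R) (t : cube R).
Local Notation D := partial_derivative.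

(** [gamma_ball] without suprema and with weak inequalities. Coordinate [k] belongs to seminorm
    [k.+1], so [k < n] here matches [k <= n] there. *)
Definition close n e (f g : cube R -> X) : Prop :=
  (forall t, `|g t - f t| <= e) /\
  forall k t, (k < n)%N -> `|D k g t - D k f t| <= e.

Lemma sup_norm_ge (f : cube R -> X) t : continuous f ->
  `|f t| <= sup [set `|f t| | t in setT].
Proof.
move=> /cube_bounded[B _ fB]; apply: ub_le_sup; last by exists t.
by exists B => _ [u _ <-].
Qed.

Lemma sup_norm_le (f : cube R -> X) e : (forall t, `|f t| <= e) ->
  sup [set `|f t| | t in setT] <= e.
Proof.
move=> fe; apply: ge_sup => [|_ [t _ <-]//].
by exists `|f point|, point.
Qed.

(** Finitely many seminorms are involved, so their maximum is still below [e]; the gap is the room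
    left for further perturbations. *)
Lemma gamma_ball_close g h n e : gamma_ball g n e h ->
  exists2 e', e' < e & close n e' g h.
Proof.
move=> gh.
have [e' e'e H] : exists2 e', e' < e &
    forall k, (k <= n)%N -> gamma_seminorm k (h \- g) <= e'.
  have : forall m, (m <= n)%N -> exists2 e', e' < e &
    forall k, (k <= m)%N -> gamma_seminorm k (h \- g) <= e'.
    elim=> [_|m IH mn].
      exists (gamma_seminorm 0 (h \- g)); first exact: gh.
      by move=> k; rewrite leqn0 => /eqP ->.
    have [e' e'e H] := IH (ltnW mn).
    exists (Num.max e' (gamma_seminorm m.+1 (h \- g))).
      by rewrite gt_max e'e; apply: gh.
    move=> k; rewrite leq_eqVlt => /predU1P[->|km].
      by rewrite le_max lexx orbT.
    by rewrite le_max H.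
  by move=> /(_ n (leqnn n)).
have [cgh E] := is_C1B (gamma_C1 h) (gamma_C1 g).
have [c1 _ c2] := is_C1_partial cgh.
exists e' => //; split=> [t|k t kn].
  by apply: le_trans (H 0%N (leq0n n)); exact: (@sup_norm_ge (h \- g)).
apply: le_trans (H k.+1 kn).
have := @sup_norm_ge (D k (h \- g)) t (c2 k).
by rewrite {1}E.
Qed.

Lemma close_gamma_ball g h n e e' : e' < e -> close n e' g h -> gamma_ball g n e h.
Proof.
move=> e'e [H0 H] [|k] kn; apply: le_lt_trans e'e.
  exact: sup_norm_le.
have [_ E] := is_C1B (gamma_C1 h) (gamma_C1 g).
by apply: sup_norm_le => t; rewrite E; exact: H.
Qed.

Lemma close_refl n e (f : cube R -> X) : 0 <= e -> close n e f f.
Proof. by move=> e0; split=> *; rewrite subrr normr0. Qed.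

Lemma close_trans n (e1 e2 : R) (f1 f2 f3 : cube R -> X) :
  close n e1 f1 f2 -> close n e2 f2 f3 -> close n (e1 + e2) f1 f3.
Proof.
move=> [h1 h2] [h3 h4]; split=> [t|k t kn].
  rewrite -(subrK (f2 t) (f3 t)) -addrA addrC.
  exact: le_trans (ler_normD _ _) (lerD (h1 t) (h3 t)).
rewrite -(subrK (D k f2 t) (D k f3 t)) -addrA addrC.
exact: le_trans (ler_normD _ _) (lerD (h2 k t kn) (h4 k t kn)).
Qed.

Lemma close_widen n n' (e e' : R) (f1 f2 : cube R -> X) :
  (n' <= n)%N -> e <= e' -> close n e f1 f2 -> close n' e' f1 f2.
Proof.
move=> nn ee [h1 h2]; split=> [t|k t kn]; first exact: le_trans ee.
by apply: le_trans ee; apply: h2; exact: leq_trans nn.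
Qed.

Lemma gamma_ball_trans g h f n e e' : gamma_ball g n e h -> gamma_ball h n e' f ->
  gamma_ball g n (e + e') f.
Proof.
move=> /gamma_ball_close[d de H] /gamma_ball_close[d' de' H'].
exact: close_gamma_ball (ltrD de de') (close_trans H H').
Qed.

Lemma gamma_ball_refl g n e : 0 < e -> gamma_ball g n e g.
Proof. by move=> e0; exact: close_gamma_ball e0 (close_refl n g (lexx 0)). Qed.

Lemma gamma_continuous g : continuous g.
Proof. by have [] := is_C1_partial (gamma_C1 g). Qed.

Lemma gamma_partial_continuous g k : continuous (D k g).
Proof. by have [] := is_C1_partial (gamma_C1 g). Qed.

Lemma gamma_partial_bound g : exists2 L : nat -> R, (forall k, 0 <= L k) &
  forall k t, `|D k g t| <= L k.
Proof.
have /choice[L HL] : forall k, exists B, 0 <= B /\ forall t, `|D k g t| <= B.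
  move=> k; have [B B0 HB] := cube_bounded (@gamma_partial_continuous g k).
  by exists B; split=> //; exact: ltW.
by exists L => [k|k t]; [exact: (HL k).1|exact: (HL k).2].
Qed.

Definition truncate_gamma M g : Gamma X :=
  MkGamma (is_C1_truncate M (gamma_C1 g)).1.

Lemma truncate_idem M t : truncate M (truncate M t) = truncate M t.
Proof. by apply/funext => i; rewrite /truncate; case: (i < M)%N. Qed.

(** Truncation annihilates the derivatives in the coordinates that it drops, so [m] must also be at
    least [n] for the controlled ones to survive. *)
Lemma truncate_gamma_close g n e : 0 < e -> exists M, forall m, (M <= m)%N ->
  close n e g (truncate_gamma m g).
Proof.
move=> e0; elim: n => [|n [M IH]].
  have [M HM] := cube_unif_truncate (@gamma_continuous g) e0.
  by exists M => m Mm; split=> // t; rewrite ltW//; exact: HM.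
have [N HN] := cube_unif_truncate (@gamma_partial_continuous g n) e0.
exists (maxn M (maxn N n.+1)) => m; rewrite !geq_max => /andP[/IH[h1 h2] /andP[Nm nm]].
split=> // k t; rewrite ltnS leq_eqVlt => /predU1P[->|]; last exact: h2.
have [_ E] := is_C1_truncate m (gamma_C1 g).
by rewrite /= E nm ltW//; exact: HN.
Qed.

Lemma gamma_cylinder_lipschitz (f : cube R -> X) M (L : nat -> R) (u t : cube R) :
  is_C1 f -> (forall v, f (truncate M v) = f v) ->
  (forall k t, (k < M)%N -> `|D k f t| <= L k) ->
  `|f u - f t| <= \sum_(i < M) L i * `|coord (u i) - coord (t i)|.
Proof.
move=> /is_C1_partial[_ pf _] fM fL; apply: cylinder_lipschitz => // k kM.
by exists (D k f) => [|v]; [exact: pf|exact: fL].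
Qed.

End gamma_space.

(** * A criterion for nullness, and surfaces passing near holes *)

Section null_criterion.
Context {R : realType} (mu : probability (borel_cube R) R).
Context {X : normedModType R}.
Implicit Types (g h : Gamma X) (C O : set X).

Lemma open_preimage_measurable (g : Gamma X) (O : set X) : open O ->
  measurable (g @^-1` O : set (borel_cube R)).
Proof.
move=> oO; apply: open_measurable_cube; apply: open_comp => // t _.
exact: (@gamma_continuous R X g).
Qed.

Lemma closed_preimage_measurable (g : Gamma X) (C : set X) : closed C ->
  measurable (g @^-1` C : set (borel_cube R)).
Proof.
move=> cC.
have := measurableC (@open_preimage_measurable g _ (closed_openC cC)).
by rewrite -preimage_setC setCK.
Qed.

(* The last hypothesis is what the Baire category theorem would need: the surfaces
   that have a neighbourhood in which the preimages of some [C `&` O k m] have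
   measure less than [q] form an open set, dense unless the premises hold. *)
Lemma null_criterion (C : set X) (O : nat -> nat -> set X) : closed C ->
  (forall k m, open (O k m)) ->
  (forall g0 n (e q : R), 0 < e -> 0 < q ->
    (forall k m g n' (e' : R), gamma_ball g0 n e g -> 0 < e' ->
      exists2 h, gamma_ball g n' e' h & (q%:E <= mu (h @^-1` (C `&` O k m)))%E) ->
    False) ->
  borel_Gamma_null mu (C `&` \bigcap_k \bigcap_m O k m).
Proof.
move=> cC oO crit; set N := C `&` _.
have mO k m g : measurable (g @^-1` (C `&` O k m) : set (borel_cube R)).
  rewrite preimage_setI; apply: measurableI.
    exact: closed_preimage_measurable.
  exact: open_preimage_measurable.
have mN g : measurable (g @^-1` N : set (borel_cube R)).
  rewrite preimage_setI; apply: measurableI; first exact: closed_preimage_measurable.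
  rewrite preimage_bigcap; apply: bigcapT_measurable => k.
  rewrite preimage_bigcap; apply: bigcapT_measurable => m.
  exact: open_preimage_measurable.
split.
  have mopen (A : set X) : open A -> measurable (A : set (g_sigma_algebraType (@open X))).
    by move=> oA; exact: sub_sigma_algebra.
  suff : measurable (N : set (g_sigma_algebraType (@open X))) by [].
  apply: measurableI.
    by rewrite -[C]setCK; apply: measurableC; apply: mopen; exact: closed_openC.
  apply: bigcapT_measurable => k; apply: bigcapT_measurable => m.
  exact: mopen.
pose U (i : nat) := [set g : Gamma X | exists n (e : R) k m, 0 < e /\
  forall h, gamma_ball g n e h -> (mu (h @^-1` (C `&` O k m)) < (i.+1%:R^-1)%:E)%E].
exists U; split=> [i|g Ug]; last first.
  apply/eqP; rewrite -measure_le0; apply/lee_addgt0Pr => e e0; rewrite add0e.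
  have [i ie] := exists_invn e0.
  have [n [d [k [m [d0 H]]]]] := Ug i Logic.I.
  have := H g (@gamma_ball_refl _ _ g n d d0) => h1.
  apply: (@le_trans _ _ (mu (g @^-1` (C `&` O k m)))).
    apply: le_measure; rewrite ?inE//; first exact: mN.
    by move=> t [Ct Ot]; split=> //; exact: Ot.
  by rewrite ltW//; apply: lt_trans h1 _; rewrite lte_fin.
split.
  move=> g [n [e [k [m [e0 H]]]]].
  exists n, (e / 2); split; first by rewrite divr_gt0.
  move=> h gh; exists n, (e / 2), k, m; split; first by rewrite divr_gt0.
  by move=> f hf; apply: H; rewrite (splitr e); exact: gamma_ball_trans hf.
move=> W [g0 Wg0] oW.
have [n [e [e0 eW]]] := oW g0 Wg0.
apply: contrapT => nWU.
have q0 : 0 < i.+1%:R^-1 :> R by rewrite invr_gt0.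
apply: (crit g0 n e _ e0 q0) => k m g n' e' g0g e'0.
apply: contrapT => nh; apply: nWU; exists g; split; first exact: eW.
exists n', e', k, m; split=> // h gh; rewrite ltNge; apply/negP => qh.
by apply: nh; exists h.
Qed.

Variables (C : set X) (c : R).
Hypotheses (cC : closed C) (c01 : 0 < c < 1).

Definition hole (x : X) (r : R) : Prop := forall w, `|w - x| < r -> ~ C w.

Lemma hole_le x r r' : r' <= r -> hole x r -> hole x r'.
Proof. by move=> rr h w wx; apply: h; exact: lt_le_trans rr. Qed.

Lemma hole_near x y r : hole x r -> hole y (r - `|x - y|).
Proof.
move=> h w; rewrite ltrBrDr => wy; apply: h.
rewrite -(subrK y w) -addrA; apply: le_lt_trans (ler_normD _ _) _.
by rewrite [X in _ + X]distrC.
Qed.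

(** The slack [s] bounds [u] from below and enlarges the hole: after a perturbation of [x] by at
    most [s] there is still a hole of radius [c * |u|] in the direction [u]. For [s = 0] there is
    only the strictness that makes the set open. *)
Definition porosity_set (D : set X) (e s : R) : set X :=
  [set x | exists u, [/\ D u, s < `|u| < e & exists2 r, c * `|u| + s < r & hole (x + u) r]].

Lemma open_porosity_set D e s : open (porosity_set D e s).
Proof.
rewrite openE => x [u [Du su [r cr H]]].
pose d := (r - (c * `|u| + s)) / 2.
have d0 : 0 < d by rewrite divr_gt0// subr_gt0.
apply/nbhs_ballP; exists d => //= y; rewrite -ball_normE/= => xy.
exists u; split=> //; exists (r - d); first by rewrite /d; lra.
apply: (hole_le _ (@hole_near _ (y + u) _ H)).
by rewrite opprD addrACA subrr addr0 lerD2l lerN2 ltW.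
Qed.

(** The parameters at which [g] has distance at least [r] from [C]. The measure of this set is what
    increases from step to step. *)
Definition avoiding (g : cube R -> X) (r : R) : set (cube R) := [set t | hole (g t) r].

Lemma avoiding_measurable (g : Gamma X) r :
  measurable (avoiding g r : set (borel_cube R)).
Proof.
apply: closed_measurable_cube; rewrite -[avoiding g r]setCK; apply: open_closedC.
rewrite openE => t /existsNP[w /not_implyP[wt /contrapT Cw]].
have := @gamma_continuous R X g t.
move=> /cvgrPdist_lt/(_ (r - `|w - g t|)); rewrite subr_gt0 => /(_ wt).
rewrite /interior; apply: filterS => u /= tu /(_ w); apply => //.
rewrite -(subrK (g t) w) -addrA; apply: le_lt_trans (ler_normD _ _) _.
by lra.
Qed.

(** The sets with slack [l.+1%:R^-1] increase to the set without slack, so by continuity from below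
    one of them has at least half of the measure. *)
Lemma porosity_set_margin (g : Gamma X) (D : set X) (e q : R) : 0 < q ->
  (q%:E <= mu (g @^-1` (C `&` porosity_set D e 0)))%E ->
  exists2 s : R, 0 < s & ((q / 2)%:E <= mu (g @^-1` (C `&` porosity_set D e s)))%E.
Proof.
move=> q0 qle.
pose F (l : nat) : set (borel_cube R) := g @^-1` (C `&` porosity_set D e l.+1%:R^-1).
have mF l : measurable (F l).
  rewrite /F preimage_setI; apply: measurableI.
    exact: closed_preimage_measurable.
  by apply: open_preimage_measurable; exact: open_porosity_set.
have Fsub : \bigcup_l F l = g @^-1` (C `&` porosity_set D e 0).
  apply/seteqP; split=> [t [l _ [Ct [u [Du /andP[lu ue] [r cr h]]]]]|].
    split=> //; exists u; split=> //.
      by rewrite ue andbT; apply: lt_trans lu; rewrite invr_gt0.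
    by exists r => //; apply: le_lt_trans cr; rewrite lerD2l.
  move=> t [Ct [u [Du /andP[u0 ue] [r cr h]]]].
  pose d := Num.min `|u| (r - c * `|u|).
  have d0 : 0 < d by rewrite /d lt_min u0 subr_gt0; rewrite addr0 in cr.
  have [l] := exists_invn d0; rewrite {1}/d lt_min => /andP[l1 l2].
  exists l => //; split=> //; exists u; split=> //.
    by rewrite l1.
  by exists r => //; rewrite addrC -ltrBrDr.
have Fnd : nondecreasing_seq F.
  apply/nondecreasing_seqP => l; apply/subsetPset => t [Ct [u [Du /andP[lu ue] [r cr h]]]].
  have ll : l.+2%:R^-1 <= l.+1%:R^-1 :> R by rewrite lef_pV2 ?posrE// ler_nat.
  split=> //; exists u; split=> //; first by rewrite ue andbT; exact: le_lt_trans lu.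
  by exists r => //; apply: le_lt_trans cr; rewrite lerD2l.
have mU : measurable (\bigcup_l F l) by exact: bigcupT_measurable.
have cvF := nondecreasing_cvg_mu (mu := mu) mF mU Fnd.
rewrite Fsub in cvF; apply: contrapT => nos.
have small l : (mu (F l) <= (q / 2)%:E)%E.
  rewrite leNgt; apply/negP => h; apply: nos; exists l.+1%:R^-1 => //; exact: ltW.
have : (mu (g @^-1` (C `&` porosity_set D e 0)) <= (q / 2)%:E)%E.
  rewrite -(cvg_lim _ cvF)//; apply: lime_le; last exact: nearW.
  by apply/cvg_ex; eexists; exact: cvF.
move=> /(le_trans qle); rewrite lee_fin; lra.
Qed.

(** The surface is first moved to one meeting the porosity set in measure [q], then truncated so
    finely that the slack [s] preserves the holes. [K] refers to the surface before truncation, so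
    [h p] is only close to [C]. *)
Lemma cylinder_selection (g : Gamma X) (D : set X) (e q : R) (n : nat) (d : R) :
  0 < q -> 0 < d ->
  (forall n' (e' : R), 0 < e' -> exists2 h, gamma_ball g n' e' h &
     (q%:E <= mu (h @^-1` (C `&` porosity_set D e 0)))%E) ->
  exists (h : Gamma X) (M : nat) (s : R) (K : set (cube R)),
    [/\ (n <= M)%N, forall t, h (truncate M t) = h t, 0 < s,
        measurable (K : set (borel_cube R)) /\ ((q / 2)%:E <= mu K)%E &
        close n d g h /\
        forall p, K p -> (exists2 x, C x & `|x - h p| < d) /\
          exists u, [/\ D u, s < `|u| < e & hole (h p + u) (c * `|u|)]].
Proof.
move=> q0 d0 dens.
have d20 : 0 < d / 2 by rewrite divr_gt0.
have [h1 /gamma_ball_close[d' d'd gh1] qh1] := dens n (d / 2) d20.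
have [s s0 qs] := porosity_set_margin q0 qh1.
pose d2 := Num.min s (d / 2) / 2.
have m0 : 0 < Num.min s (d / 2) by rewrite lt_min s0.
have d2_0 : 0 < d2 by rewrite divr_gt0.
have [d2s d2d] : d2 < s /\ d2 < d / 2.
  have h : d2 < Num.min s (d / 2) by rewrite /d2; lra.
  by split; apply: lt_le_trans h _; rewrite ge_min lexx ?orbT.
have [M HM] := truncate_gamma_close h1 n d2_0.
pose m := maxn M n.
have h12 := HM m (leq_maxl _ _).
exists (truncate_gamma m h1), m, s, (h1 @^-1` (C `&` porosity_set D e s)); split=> //.
- exact: leq_maxr.
- by move=> t /=; rewrite truncate_idem.
- split=> //; rewrite preimage_setI; apply: measurableI.
    exact: closed_preimage_measurable.
  by apply: open_preimage_measurable; exact: open_porosity_set.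
split.
  apply: (close_widen (leqnn n) _ (close_trans gh1 h12)); lra.
move=> p [Cp [u [Du su [r cr H]]]]; split.
  exists (h1 p) => //; rewrite distrC; apply: le_lt_trans (h12.1 p) _; lra.
exists u; split=> //; apply: (hole_le _ (@hole_near _ (truncate_gamma m h1 p + u) _ H)).
rewrite opprD addrACA subrr addr0 distrC.
have := h12.1 p; lra.
Qed.

End null_criterion.

Section weights.
Context {R : realType}.

(** Bernoulli's inequality: the at most [M] factors [1 - 2 * d] multiply to at least
    [1 - 2 * d * M], which is at least 1/2. Thus the number of uncontrolled coordinates does not
    enter the gain. *)
Lemma prod_weights (M : nat) (J : pred nat) (a : R) : 0 <= a ->
  a ^+ count J (iota 0 M) / 2 <=
    \prod_(i < M) (if J i then a else 1 - 2 * (4 * M.+1%:R)^-1).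
Proof.
move=> a0; set d := (4 * M.+1%:R)^-1.
have d0 : 0 < d by rewrite invr_gt0 mulr_gt0.
have main m : (m <= M)%N -> a ^+ count J (iota 0 m) * (1 - 2 * d * m%:R) <=
    \prod_(i < m) (if J i then a else 1 - 2 * d).
  elim: m => [|m IH] mM; first by rewrite big_ord0 expr0 mulr0 subr0 mul1r.
  have {}IH := IH (ltnW mM).
  have dM : 2 * d * m.+1%:R <= 2^-1.
    apply: (@le_trans _ _ (2 * d * M.+1%:R)).
      by rewrite ler_wpM2l ?mulr_ge0 ?(ltW d0)// ler_nat ltnS ltnW.
    rewrite /d invfM mulrA -mulrA mulVf ?mulr1; last by rewrite pnatr_eq0.
    lra.
  have m1 : m.+1%:R = m%:R + 1 :> R by rewrite -addn1 natrD.
  have mge : 0 <= m%:R :> R by [].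
  have ca : 0 <= a ^+ count J (iota 0 m) by rewrite exprn_ge0.
  rewrite (_ : iota 0 m.+1 = iota 0 m ++ [:: m]); last by rewrite -addn1 iotaD.
  rewrite big_ord_recr count_cat/= addn0.
  apply: le_trans (ler_wpM2r _ IH); last by case: (J m) => //; rewrite m1 in dM; nra.
  rewrite exprD -[leLHS]mulrA -[leRHS]mulrA; apply: ler_wpM2l => //; rewrite m1 in dM *.
  case: (J m); rewrite ?expr1 ?expr0 ?mul1r.
    by rewrite mulrC; apply: ler_wpM2r => //; nra.
  nra.
apply: le_trans (main M (leqnn M)); apply: ler_wpM2l; first exact: exprn_ge0.
have : 2 * d * M%:R <= 2^-1.
  apply: (@le_trans _ _ (2 * d * M.+1%:R)).
    by rewrite ler_wpM2l ?mulr_ge0 ?(ltW d0)// ler_nat.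
  rewrite /d invfM mulrA -mulrA mulVf ?mulr1; last by rewrite pnatr_eq0.
  lra.
lra.
Qed.

Lemma count_ltn_iota n M : (count (fun i => (i < n)%N) (iota 0 M) <= n)%N.
Proof.
suff -> : count (fun i => (i < n)%N) (iota 0 M) = minn n M by exact: geq_minl.
elim: M => [|M IH]; first by rewrite minn0.
rewrite (_ : iota 0 M.+1 = iota 0 M ++ [:: M]); last by rewrite -addn1 iotaD.
rewrite count_cat IH/= addn0.
by case: (ltnP M n) => Mn; lia.
Qed.

End weights.

Lemma natr_large {R : realType} (x : R) : exists m : nat, x < m%:R.
Proof.
exists (Num.trunc `|x|).+1; apply: le_lt_trans (ler_norm x) _.
by have /truncn_itv/andP[_ ->] := normr_ge0 x.
Qed.

(** * Bumps in the directions of the holes *)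

Section bump_step.
Context {R : realType} (mu : probability (borel_cube R) R).
Hypothesis mu_lebesgue : is_product_lebesgue mu.
Context {X : normedModType R}.
Variables (C : set X) (c : R).
Hypothesis c01 : 0 < c < 1.
Local Notation D := partial_derivative.

(** With this [tau], [n] slopes of size at most [L] change a surface by at most [c * |u| / 8] over
    intervals of length [tau * (8 / e0 * |u|)]. The value depends neither on the surface nor on its
    number of coordinates. *)
Definition bump_ratio (n : nat) (L e0 : R) : R :=
  Num.min (2^-1) (c / (8 * n.+1%:R * (L + 1) * (8 / e0))).

Lemma bump_ratio_gt0 n L e0 : 0 <= L -> 0 < e0 -> 0 < bump_ratio n L e0.
Proof.
move=> L0 e00; have /andP[c0 _] := c01.
by rewrite lt_min invr_gt0 ltr0n/= !(divr_gt0, mulr_gt0)// ltr_wpDl.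
Qed.

(* The bump at [p] has radius [8 / e0 * |u|] in the coordinates below [n], so that
   its derivatives there are at most [e0], and it is as thin as necessary in the
   other coordinates, whose seminorms are not controlled. *)
Lemma bump_step (E : set X) (n M : nat) (g : Gamma X) (s e L e0 : R)
    (K : set (cube R)) :
  0 < e0 -> 0 <= L -> 0 < s -> (n <= M)%N ->
  (forall t, g (truncate M t) = g t) ->
  measurable (K : set (borel_cube R)) ->
  (forall k t, (k < n)%N -> `|D k g t| <= L) -> 8 / e0 * e <= 1 ->
  (forall p, K p -> exists u, [/\ E u, s < `|u| < e & hole C (g p + u) (c * `|u|)]) ->
  exists (h : Gamma X) (U : seq X), [/\ forall u, u \in U -> E u,
    forall t, h t = g t \/ `|h t - g t| <= e,
    forall k t, (k < n)%N -> D k h t = D k g t \/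
      exists u a, [/\ u \in U, `|a *: u| <= e0 & D k h t = D k g t + a *: u] &
    forall G G' : set (cube R),
      measurable (G : set (borel_cube R)) -> measurable (G' : set (borel_cube R)) ->
      G `<=` G' -> (forall t, hole C (h t) (c * s / 2) -> G' t) ->
      (forall t p, G t -> K p -> c * e <= `|g t - g p|) ->
      (mu G + ((bump_ratio n L e0 / 6) ^+ n / 2)%:E * mu K <= mu G')%E].
Proof.
move=> e00 L0 s0 nM gM mK gL eA holes.
have /andP[c0 c1] := c01.
set tau := bump_ratio n L e0; have tau0 : 0 < tau := bump_ratio_gt0 n L0 e00.
have tau6 : 0 <= tau / 6 by rewrite divr_ge0// ltW.
have tauf : 0 <= (tau / 6) ^+ n / 2 by rewrite divr_ge0// exprn_ge0.
have tau2 : tau <= 2^-1 by rewrite /tau /bump_ratio ge_min lexx.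
set A := 8 / e0 in eA; have A0 : 0 < A by rewrite divr_gt0.
have /choice[u Hu] : forall p, exists u, K p ->
    [/\ E u, s < `|u| < e & hole C (g p + u) (c * `|u|)].
  move=> p; have [Kp|nKp] := pselect (K p); last by exists 0.
  by have [u] := holes p Kp; exists u.
pose rho p := A * `|u p|.
have [Lb Lb0 HLb] := gamma_partial_bound g.
pose SL := \sum_(i < M) Lb i.
have SL0 : 0 <= SL by apply: sumr_ge0.
(* The mesh [1 / m] is below all radii [rho p], and so fine that the unknown slopes [Lb] change [g]
   by at most [c * s / 8] within a cell. *)
have [m Hm] := natr_large (Num.max (SL / (c * s / 8)) (A * s)^-1).
have cs0 : 0 < c * s / 8 by rewrite divr_gt0// mulr_gt0.
have As0 : 0 < A * s by rewrite mulr_gt0.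
move: Hm; rewrite gt_max => /andP[m1 m2].
have mR : 0 < m%:R :> R by apply: lt_trans m2; rewrite invr_gt0.
have m0 : (0 < m)%N by rewrite -(ltr0n R).
have mSL : SL / m%:R <= c * s / 8.
  by rewrite ler_pdivrMr// mulrC -ler_pdivrMr// ltW.
have mAs : m%:R^-1 <= A * s by rewrite invf_ple ?posrE// ltW.
pose d : R := (4 * M.+1%:R)^-1.
have d0 : 0 < d by rewrite invr_gt0 mulr_gt0.
have d1 : d < 2^-1.
  rewrite ltf_pV2 ?posrE ?mulr_gt0//.
  have : 1 <= M.+1%:R :> R by rewrite ler1n.
  lra.
pose J i := (i < n)%N.
(* An interval of length [tau * rho p] with endpoint [coord (p i)], on the side where [0, 1] has
   room for it. *)
pose alpha p i := if coord (p i) <= 2^-1 then coord (p i) else coord (p i) - tau * rho p.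
pose beta p i := if coord (p i) <= 2^-1 then coord (p i) + tau * rho p else coord (p i).
have rhoK p : K p -> [/\ 0 < rho p, A * s <= rho p & tau * rho p <= 2^-1].
  move=> /Hu[_ /andP[su ue] _].
  have u0 : 0 < `|u p| by exact: lt_trans su.
  have r0 : 0 < rho p by rewrite mulr_gt0.
  split=> //; first by rewrite ler_wpM2l// ltW.
  have : rho p <= 1 by apply: le_trans eA; rewrite ler_wpM2l// ltW.
  nra.
have [P [uP PK sepP gainP]] : exists P : seq (cube R), [/\ uniq P, forall p, p \in P -> K p,
    forall p q, p \in P -> q \in P -> p != q -> separated M m J rho p q &
    forall G G' : set (cube R),
      measurable (G : set (borel_cube R)) -> measurable (G' : set (borel_cube R)) ->
      G `<=` G' -> (forall p, p \in P -> inner M m J alpha beta d p `<=` G' /\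
         inner M m J alpha beta d p `&` G = set0) ->
      (mu G + ((tau / 6) ^+ n / 2)%:E * mu K <= mu G')%E].
  apply: (covering_gain mu_lebesgue m0 mK _ (ltW tau0)).
  - by rewrite d0.
  - by move=> p /rhoK[_ h _]; exact: le_trans h.
  - move=> p i Kp iM Ji; have [r0 _ tr] := rhoK p Kp.
    have /andP[p0 p1] := coord_itv (p i).
    have trr : tau * rho p < rho p by rewrite -subr_gt0; nra.
    have tr0 : 0 < tau * rho p by rewrite mulr_gt0.
    rewrite /alpha /beta; move: p0 p1 trr tr0 tr; clear.
    by case: (leP (coord (p i)) 2^-1) => *; split; lra.
  - exact: tauf.
  apply: (@le_trans _ _ ((tau / 6) ^+ count J (iota 0 M) / 2)).
    rewrite ler_wpM2r ?invr_ge0//.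
    apply: ler_wiXn2l; [exact: tau6|lra|exact: count_ltn_iota].
  exact: prod_weights.
pose lo p i := if J i then coord (p i) - rho p else (cell m p i)%:R / m%:R.
pose hi p i := if J i then coord (p i) + rho p else ((cell m p i)%:R + 1) / m%:R.
(* With this margin the slope bound [4 / wd p i] of [plateau] is [8 / rho p = e0 / |u p|], which
   explains the factor [8 / e0] in [rho]. *)
pose wd p i := if J i then rho p / 2 else d / m%:R.
have /choice[F HF] : forall pi : cube R * nat, exists fdf : (R -> R) * (R -> R),
    K pi.1 -> [/\ derives fdf.1 fdf.2, continuous fdf.2, forall x, 0 <= fdf.1 x <= 1,
      forall x, `|fdf.2 x| <= 4 / wd pi.1 pi.2 &
      (forall x, lo pi.1 pi.2 + wd pi.1 pi.2 <= x <= hi pi.1 pi.2 - wd pi.1 pi.2 ->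
         fdf.1 x = 1) /\
      forall x, x <= lo pi.1 pi.2 \/ hi pi.1 pi.2 <= x -> fdf.1 x = 0 /\ fdf.2 x = 0].
  move=> [p i] /=; have [Kp|nKp] := pselect (K p); last by exists (id, id).
  have [|f [df H]] := @plateau R (lo p i) (hi p i) (wd p i).
    have [r0 _ _] := rhoK p Kp.
    by rewrite /wd; case: ifP => _; rewrite divr_gt0.
  by exists (f, df).
pose f p i := (F (p, i)).1; pose df p i := (F (p, i)).2.
pose phi p := tensor M (f p).
pose bump p t := phi p t *: u p.
have C1bump p : K p -> is_C1 (bump p) /\ forall k, D k (bump p) =
    fun t => if (k < M)%N then
      tensor M (fun i => if i == k then df p i else f p i) t *: u p else 0.
  by move=> Kp; apply: is_C1_tensor => i _; have [] := HF (p, i) Kp.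
have [C1s Es] : is_C1 (fun t => \sum_(p <- P) bump p t) /\
    forall k t, D k (fun t => \sum_(p <- P) bump p t) t = \sum_(p <- P) D k (bump p) t.
  by apply: is_C1_sum => p /PK Kp; have [] := C1bump p Kp.
have [C1h Eh] := is_C1D (gamma_C1 g) C1s.
pose supp p : set (cube R) := [set t | forall i, (i < M)%N -> lo p i < coord (t i) < hi p i].
have off p t : K p -> ~ supp p t -> bump p t = 0 /\ forall k, D k (bump p) t = 0.
  move=> Kp /existsNP[i /not_implyP[iM nlh]].
  have [_ _ _ _ [_ /(_ (coord (t i)))]] := HF (p, i) Kp.
  case=> [|f0 df0].
    move/negP: nlh; rewrite negb_and -!leNgt => /orP[]; by [left|right].
  split=> [|k].
    by rewrite /bump /phi /tensor (bigD1 (Ordinal iM))//= /f f0 mul0r scale0r.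
  have [_ ->] := C1bump p Kp; case: ifP => // kM.
  rewrite /tensor (bigD1 (Ordinal iM))//=.
  by case: ifP => _; rewrite /f /df ?f0 ?df0 mul0r scale0r.
have disj p q t : p \in P -> q \in P -> p != q -> supp p t -> supp q t -> False.
  move=> pP qP pq tp tq; have [i iM] := sepP p q pP qP pq.
  have := tp i iM; have := tq i iM; rewrite /lo /hi.
  case: ifP => Ji.
    move=> /andP[q1 q2] /andP[p1 p2]; apply/negP; rewrite -ltNge ltr_norml.
    by move: q1 q2 p1 p2; clear => *; apply/andP; split; lra.
  rewrite !ltr_pdivrMr// !ltr_pdivlMr// => /andP[q1 q2] /andP[p1 p2].
  rewrite neq_ltn => /orP[]; rewrite -(ler_nat R) -addn1 natrD;
    move: q1 q2 p1 p2; clear => *; lra.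
have sum1 (Z : cube R -> X) p : p \in P -> (forall q, q \in P -> q != p -> Z q = 0) ->
    \sum_(q <- P) Z q = Z p.
  move=> pP Z0; rewrite (bigD1_seq p)//= big_seq_cond big1 ?addr0//.
  by move=> q /andP[qP qp]; exact: Z0.
have cases t : (\sum_(p <- P) bump p t = 0 /\ forall k, \sum_(p <- P) D k (bump p) t = 0) \/
    exists p, [/\ p \in P, supp p t, \sum_(p <- P) bump p t = bump p t &
      forall k, \sum_(p <- P) D k (bump p) t = D k (bump p) t].
  have [[p pP tp]|nt] := pselect (exists2 p, p \in P & supp p t).
    right; exists p; have H q : q \in P -> q != p -> bump q t = 0 /\
        forall k, D k (bump q) t = 0.
      move=> qP qp; apply: off; first exact: PK.
      by move=> tq; exact: disj qp tq tp.
    split=> // [|k].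
      by apply: (sum1 (bump ^~ t)) => // q qP qp; have [] := H q qP qp.
    by apply: (sum1 (fun q => D k (bump q) t)) => // q qP qp; have [_ ->] := H q qP qp.
  left; have H q : q \in P -> bump q t = 0 /\ forall k, D k (bump q) t = 0.
    by move=> qP; apply: off; [exact: PK|move=> tq; apply: nt; exists q].
  by split=> [|k]; rewrite big_seq big1// => q /H[h1 h2].
have f01 p i x : K p -> 0 <= f p i x <= 1.
  by move=> Kp; have [_ _ + _ _] := HF (p, i) Kp; exact.
exists (MkGamma C1h), [seq u p | p <- P]; split.
- by move=> v /mapP[p /PK/Hu[Eu _ _] ->].
- move=> t /=; have [[-> _]|[p [pP _ -> _]]] := cases t; first by left; rewrite addr0.
  right; rewrite addrC addKr /bump normrZ.
  have [_ /andP[_ ue] _] := Hu p (PK p pP).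
  apply: le_trans (ltW ue); rewrite ler_piMl// ger0_norm.
    apply: prodr_ile1 => i _; exact/f01/PK.
  by apply: prodr_ge0 => i _; have /andP[] := f01 p i (coord (t i)) (PK p pP).
- move=> k t kn; rewrite Eh/= Es.
  have [[_ ->]|[p [pP tp _ ->]]] := cases t; first by left; rewrite addr0.
  right; have kM : (k < M)%N by exact: leq_trans nM.
  have [_ ->] := C1bump p (PK p pP); rewrite kM.
  exists (u p), (tensor M (fun i => if i == k then df p i else f p i) t); split=> //.
    by apply/mapP; exists p.
  have [_ /andP[su ue] _] := Hu p (PK p pP).
  have u0 : 0 < `|u p| by exact: lt_trans su.
  rewrite normrZ -ler_pdivlMr//.
  rewrite /tensor (bigD1 (Ordinal kM))//= eqxx normrM.
  have h1 : `|df p k (coord (t k))| <= e0 / `|u p|.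
    have [_ _ _ /(_ (coord (t k))) + _] := HF (p, k) (PK p pP).
    rewrite /df /wd /= /J kn => h; apply: le_trans h _.
    rewrite /rho /A le_eqVlt; apply/orP; left; apply/eqP; field.
    by rewrite !gt_eqF.
  apply: le_trans h1; rewrite ler_piMr// ger0_norm.
    apply: prodr_ile1 => i ik; rewrite ifN; first exact/f01/PK.
    by apply: contraNneq ik => ik; apply/eqP/val_inj.
  apply: prodr_ge0 => i ik; rewrite ifN.
    by have /andP[] := f01 p i (coord (t i)) (PK p pP).
  by apply: contraNneq ik => ik; apply/eqP/val_inj.
move=> G G' mG mG' GG' hG' GK; apply: gainP => // p pP.
have Kp := PK p pP; have [Eu /andP[su ue] Hh] := Hu p Kp.
have u0 : 0 < `|u p| by exact: lt_trans su.
have [r0 _ tr] := rhoK p Kp.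
(* One eighth of [c * |u p|] comes from the controlled coordinates through [tau], another from the
   cells through [m]. *)
have near t : inner M m J alpha beta d p t -> `|g t - g p| <= c * `|u p| / 4.
  move=> tp.
  apply: (@le_trans _ _ (\sum_(i < M) (if (i < n)%N then L else Lb i) *
      `|coord (t i) - coord (p i)|)).
    apply: (@gamma_cylinder_lipschitz _ _ g M (fun i => if (i < n)%N then L else Lb i))
      => //; first exact: gamma_C1.
    by move=> k v kM; case: ifP => kn; [exact: gL|exact: HLb].
  apply: (@le_trans _ _ (\sum_(i < M) ((if (i < n)%N then L * (tau * rho p) else 0) +
      Lb i / m%:R))).
    apply: ler_sum => i _; have iM := ltn_ord i; have := tp i iM; rewrite /J.
    case: ifP => ind.
      move=> /andP[t1 t2]; rewrite -[leLHS]addr0; apply: lerD; last by rewrite divr_ge0.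
      apply: ler_wpM2l => //; have tr0 : 0 < tau * rho p by rewrite mulr_gt0.
      move: t1 t2; rewrite /alpha /beta.
      rewrite ler_norml; move: tr0; clear.
      by case: (leP (coord (p i)) 2^-1) => *; apply/andP; split; lra.
    have := cell_itv m0 p i; rewrite add0r -addn1 natrD addrAC !mulrDl mulNr mul1r.
    have dm : 0 < d / m%:R by rewrite divr_gt0.
    move=> /andP[c1' c2'] /andP[t1 t2]; rewrite ler_wpM2l// ler_norml.
    by move: dm c1' c2' t1 t2; clear => *; apply/andP; split; lra.
  rewrite big_split/= -mulr_suml -/SL.
  have -> : \sum_(i < M) (if (i < n)%N then L * (tau * rho p) else 0) =
      n%:R * (L * (tau * rho p)).
    rewrite -big_mkcond/= -(big_ord_widen M (fun=> L * (tau * rho p)) nM).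
    by rewrite sumr_const card_ord mulr_natl.
  have h1 : n%:R * (L * (tau * rho p)) <= c * `|u p| / 8.
    have L10 : 0 < L + 1 by rewrite ltr_wpDl.
    have Q0 : 0 < 8 * n.+1%:R * (L + 1) * A by rewrite mulr_gt0// mulr_gt0// mulr_gt0.
    have : tau <= c / (8 * n.+1%:R * (L + 1) * A) by rewrite ge_min lexx orbT.
    rewrite ler_pdivlMr// => h3.
    have h4 : tau * (8 * n.+1%:R * (L + 1) * A) * `|u p| <= c * `|u p|.
      by rewrite ler_wpM2r.
    have h5 : n%:R * L <= n.+1%:R * (L + 1).
      by apply: ler_pM => //; [rewrite ler_nat|rewrite lerDl].
    have h6 : 0 <= tau * rho p by rewrite ltW// mulr_gt0.
    have h7 : n%:R * L * (tau * rho p) <= n.+1%:R * (L + 1) * (tau * rho p).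
      by rewrite ler_wpM2r.
    rewrite mulrA; apply: le_trans h7 _; rewrite ler_pdivlMr//.
    by rewrite /rho; apply: le_trans h4; rewrite le_eqVlt; apply/orP; left; apply/eqP; ring.
  have h2 : c * s <= c * `|u p| by rewrite ler_wpM2l// ltW.
  move: h1 h2 mSL; clear => *; lra.
(* On the inner box the bump has its full value [u p], so [h t] is within [c * |u p| / 4] of the
   centre of the hole. No point of [G] lies there, since [g] on [G] keeps distance [c * e] from
   [g p]. *)
split.
  move=> t tp; apply: hG'.
  have bp : bump p t = u p.
    rewrite /bump /phi /tensor big1 ?scale1r// => i _.
    have [_ _ _ _ [+ _]] := HF (p, val i) Kp; rewrite -/(f p i); apply.
    have := tp i (ltn_ord i); rewrite /= /lo /hi /wd /J; case: ifP => ind.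
      have h1 : tau * rho p <= rho p / 2 by rewrite mulrC ler_wpM2l// ltW.
      rewrite /alpha /beta; case: (leP (coord (p i)) 2^-1) => _ /andP[t1 t2];
        move: h1 t1 t2; clear => *; apply/andP; split; lra.
    by rewrite -mulrDl -mulrBl.
  have -> : (MkGamma C1h : cube R -> X) t = g t + u p.
    rewrite /= (sum1 (bump ^~ t) p pP) ?bp// => q qP qp.
    have [|//] := off q t (PK q qP) _; move=> tq; apply: (disj q p t) => //.
    apply: contrapT => ntp; have [] := off p t Kp ntp; rewrite bp => up0.
    by rewrite up0 normr0 ltxx in u0.
  apply: (hole_le _ (@hole_near _ _ _ _ (g t + u p) _ Hh)).
  rewrite opprD addrACA subrr addr0 distrC.
  have h1 := near t tp; have h2 : c * s <= c * `|u p| by rewrite ler_wpM2l// ltW.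
  have h3 : 0 < c * `|u p| by rewrite mulr_gt0.
  by move: h1 h2 h3; clear => *; lra.
rewrite -subset0 => t [/near tp Gt]; have h1 := GK t p Gt Kp.
have h2 : c * `|u p| < c * e by rewrite ltr_pM2l.
have h3 : 0 < c * `|u p| by rewrite mulr_gt0.
by move: tp h1 h2 h3; clear => *; lra.
Qed.

End bump_step.

(** * Games *)

Section game.
Context {R : realType} (mu : probability (borel_cube R) R).
Hypothesis mu_lebesgue : is_product_lebesgue mu.
Context {X : normedModType R}.
Local Notation D := partial_derivative.

Definition dporous (P : set X) (c : R) (A : set X) : Prop :=
  forall x, A x -> forall e : R, 0 < e -> exists u,
    [/\ P u, 0 < `|u| < e & forall w, `|w - (x + u)| <= c * `|u| -> ~ A w].

(* The vectors admissible in [game C0 E N S] are those that can be added to an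
   element of [S] in [N] rounds: in each round a direction set [E k] is chosen,
   the opponent picks finitely many [u] in it, and multiples of norm at most 1
   are allowed.  All resulting sums must have norm at most [C0]. *)
Fixpoint game (C0 : R) (E : nat -> set X) (N : nat) (S : set X) : Prop :=
  (forall x, S x -> `|x| <= C0) /\
  match N with
  | 0%N => True
  | N'.+1 => exists k, forall U : seq X, (forall u, u \in U -> E k u) ->
      game C0 E N' [set x | S x \/
        exists y u a, [/\ S y, u \in U, `|a *: u| <= 1 & x = y + a *: u]]
  end.

Lemma gameS C0 E N S : game C0 E N S -> forall x, S x -> `|x| <= C0.
Proof. by case: N => [|N] []. Qed.

Section bound.
Variables (C : set X) (c C0 : R) (E : nat -> set X).
Hypotheses (cC : closed C) (c01 : 0 < c < 1) (C00 : 0 <= C0).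
Variables (g0 : Gamma X) (n : nat) (e q L : R).
Hypotheses (e_gt0 : 0 < e) (q0 : 0 < q) (L0 : 0 <= L).
Hypothesis g0L : forall k t, (k < n)%N -> `|D k g0 t| + e <= L.
Hypothesis dens : forall k m g n' (e' : R), gamma_ball g0 n e g -> 0 < e' ->
  exists2 h, gamma_ball g n' e' h &
    (q%:E <= mu (h @^-1` (C `&` porosity_set C c (E k) m.+1%:R^-1 0)))%E.

(** All changes of a partial derivative add up to [e0] times a vector of the game, hence to at most
    [e / 2]; the other half of [e] is for the errors [eta]. *)
Let e0 : R := e / (2 * (C0 + 1)).
Let gain : R := (bump_ratio c n L e0 / 6) ^+ n / 2 * (q / 2).

Let e0_gt0 : 0 < e0.
Proof. by rewrite divr_gt0// mulr_gt0// ltr_wpDl. Qed.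

Let e0C0 : e0 * C0 <= e / 2.
Proof.
have C1 : 0 < C0 + 1 by rewrite ltr_wpDl.
rewrite /e0 invfM mulrA -[leLHS]mulrA ler_piMr ?divr_ge0 ?(ltW e_gt0)//.
by rewrite mulrC ler_pdivrMr// mul1r lerDl.
Qed.

(** Induction on the remaining rounds. Up to [eta], the controlled derivatives of [g] differ from
    those of [g0] by [e0] times elements of the current position [S], so [g] stays in the ball where
    [dens] applies. Each round adds [gain] to the avoided measure, while [th] shrinks but stays
    positive. *)
Lemma game_bound (N : nat) (S : set X) (g : Gamma X) (eta th : R) :
  game C0 E N S -> 0 < th -> 0 <= eta < e / 2 ->
  (forall t, `|g t - g0 t| <= eta) ->
  (forall k t, (k < n)%N -> exists2 x, S x & `|D k g t - D k g0 t - e0 *: x| <= eta) ->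
  (mu (avoiding C g th) + (gain *+ N)%:E <= 1)%E.
Proof.
elim: N S g eta th => [|N IH] S g eta th gm th0 /andP[eta0 etae] H0 HD.
  by rewrite mulr0n adde0; apply: probability_le1; exact: avoiding_measurable.
have bS := gameS gm; have [_ [k Hk]] := gm.
have /andP[c0 c1] := c01.
have gball : gamma_ball g0 n e g.
  apply: (@close_gamma_ball _ _ _ _ _ _ (eta + e / 2)); first by lra.
  split=> [t|j t jn]; first by apply: le_trans (H0 t) _; lra.
  have [x Sx Hx] := HD j t jn.
  rewrite -(subrK (e0 *: x) (D j g t - D j g0 t)).
  apply: le_trans (ler_normD _ _) _; apply: lerD => //.
  rewrite normrZ gtr0_norm//; apply: le_trans e0C0.
  by rewrite ler_wpM2l ?bS// ltW.
(* A round increases [eta] by at most [2 * sl], half of the remaining slack, so the slack is never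
   exhausted. *)
pose sl := (e / 2 - eta) / 4.
have sl0 : 0 < sl by rewrite divr_gt0// subr_gt0.
pose d := Num.min sl (th / 8).
have d0 : 0 < d by rewrite lt_min sl0 divr_gt0.
have [dsl dth] : d <= sl /\ d <= th / 8 by rewrite /d !ge_min !lexx orbT.
have A0 : 0 < 8 / e0 by rewrite divr_gt0.
have dA : 0 < Num.min d (8 / e0)^-1 by rewrite lt_min d0 invr_gt0.
have [m] := exists_invn dA; rewrite lt_min; set em := m.+1%:R^-1 => /andP[emd emA].
have em0 : 0 < em by rewrite invr_gt0.
have [h [M [s [K [nM hM s0 [mK qK] [gh holes]]]]]] :=
  cylinder_selection cC n q0 d0 (fun n' e' => @dens k m g n' e' gball).
have hL j t : (j < n)%N -> `|D j h t| <= L.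
  move=> jn; apply: le_trans (g0L t jn).
  rewrite -(subrK (D j g0 t) (D j h t)); apply: le_trans (ler_normD _ _) _.
  rewrite addrC lerD2l.
  have [e1 e1e [_ /(_ j t jn) h1]] := gamma_ball_close gball.
  have h2 := gh.2 j t jn.
  have [x Sx Hx] := HD j t jn.
  rewrite -(subrK (D j g t) (D j h t)) -addrA; apply: le_trans (ler_normD _ _) _.
  rewrite -(subrK (e0 *: x) (D j g t - D j g0 t)).
  apply: (@le_trans _ _ (d + (eta + e / 2))).
    apply: lerD => //; apply: le_trans (ler_normD _ _) _; apply: lerD => //.
    rewrite normrZ gtr0_norm//; apply: le_trans e0C0.
    by rewrite ler_wpM2l ?bS// ltW.
  by rewrite /sl in dsl; lra.
have emA1 : 8 / e0 * em <= 1.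
  by rewrite mulrC -ler_pdivlMr// mul1r ltW.
have [|f [U [UE fh fD fgain]]] := bump_step (C := C) (E := E k)
  mu_lebesgue c01 e0_gt0 L0 s0 nM hM mK hL emA1.
  by move=> p /holes[_ [u H]]; exists u.
have fh0 t : `|f t - h t| <= em.
  by have [->|//] := fh t; rewrite subrr normr0 ltW.
pose th' := Num.min (th / 2) (c * s / 2).
have th'0 : 0 < th' by rewrite lt_min !divr_gt0// mulr_gt0.
have [th'1 th'2] : th' <= th / 2 /\ th' <= c * s / 2 by rewrite /th' !ge_min !lexx orbT.
have step : (mu (avoiding C g th) +
    ((bump_ratio c n L e0 / 6) ^+ n / 2)%:E * mu K <= mu (avoiding C f th'))%E.
  apply: fgain.
  - exact: avoiding_measurable.
  - exact: avoiding_measurable.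
  - move=> t Ht; apply: hole_le (@hole_near _ _ _ _ (f t) _ Ht).
    have h1 := gh.1 t; have h2 := fh0 t.
    have : `|g t - f t| <= d + em.
      rewrite distrC -(subrK (h t) (f t)) -addrA addrC.
      by apply: le_trans (ler_normD _ _) _; exact: lerD.
    lra.
  - by move=> t; exact: hole_le.
  (* [h p] is within [d] of a point of [C], so the value of [g] at an avoided parameter cannot be
     close to it. *)
  move=> t p Gt /holes[[x Cx xp] _]; rewrite leNgt; apply/negP => htp.
  apply: (Gt x) => //.
  have h1 := gh.1 t.
  rewrite -(subrK (h p) x) -addrA; apply: le_lt_trans (ler_normD _ _) _.
  have : `|h p - g t| <= `|h t - h p| + `|h t - g t|.
    by rewrite (distrC (h t)); exact: ler_distD.
  have : c * em <= em by rewrite ler_piMl// ltW.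
  lra.
have : (mu (avoiding C f th') + (gain *+ N)%:E <= 1)%E.
  apply: (IH _ f (eta + 2 * sl) _ (Hk U UE)) => //.
  - by apply/andP; split; [lra|rewrite /sl; lra].
  - move=> t; have h1 := gh.1 t; have h2 := fh0 t; have h3 := H0 t.
    have h4 := ler_distD (h t) (f t) (g0 t); have h5 := ler_distD (g t) (h t) (g0 t).
    by lra.
  move=> j t jn; have [x Sx Hx] := HD j t jn; have h1 := gh.2 j t jn.
  have [->|[u [a [uU au ->]]]] := fD j t jn.
    exists x; first by left.
    rewrite (_ : _ - _ = (D j h t - D j g t) + (D j g t - D j g0 t - e0 *: x)).
      by apply: le_trans (ler_normD _ _) _; lra.
    by rewrite !addrA subrK.
  exists (x + (a / e0) *: u).
    right; exists x, u, (a / e0); split=> //.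
    rewrite [a / e0]mulrC -scalerA normrZ normfV (gtr0_norm e0_gt0).
    by rewrite mulrC ler_pdivrMr// mul1r.
  rewrite scalerDr scalerA [e0 * _]mulrC divfK ?gt_eqF//.
  rewrite (_ : _ - _ = (D j h t - D j g t) + (D j g t - D j g0 t - e0 *: x)).
    by apply: le_trans (ler_normD _ _) _; lra.
  move: (D j h t) (D j g t) (D j g0 t) (e0 *: x) (a *: u) => A G B v w.
  rewrite (addrAC A w) opprD addrACA subrr addr0.
  by rewrite -[G - B - v]addrA [A - G + (G + _)]addrA subrK addrA.
apply: le_trans; rewrite mulrS EFinD addeA; apply: leeD => //.
apply: le_trans step; apply: leeD => //.
rewrite /gain EFinM; apply: lee_wpmul2l => //.
rewrite lee_fin divr_ge0// exprn_ge0// divr_ge0// ltW//.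
exact: bump_ratio_gt0.
Qed.

End bound.

Lemma closure_hole (A : set X) x r : (forall w, `|w - x| < r -> ~ A w) ->
  hole (closure A) x r.
Proof.
move=> H w wx cw.
have : nbhs w [set v | `|v - x| < r].
  apply/nbhs_ballP; exists (r - `|w - x|); rewrite /= ?subr_gt0// => v.
  rewrite -ball_normE/= => wv; rewrite -(subrK w v) -addrA.
  by apply: le_lt_trans (ler_normD _ _) _; rewrite distrC -ltrBrDr.
by move=> /cw[v [Av /H]].
Qed.

(** An open ball that misses [A] misses its closure; halving [c] provides the strict inequality in
    [porosity_set]. *)
Lemma dporous_closure (P : set X) (c : R) (A : set X) : 0 < c -> dporous P c A ->
  forall e, 0 < e -> A `<=` porosity_set (closure A) (c / 2) P e 0.
Proof.
move=> c0 pA e e0 x Ax; have [u [Pu /andP[u0 ue] H]] := pA x Ax e e0.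
exists u; split=> //; first by rewrite u0.
exists (c * `|u|).
  by rewrite addr0 ltr_pM2r//; lra.
by apply: closure_hole => w /ltW; exact: H.
Qed.

Lemma game_null (c C0 : R) (E : nat -> set X) (A : set X) : 0 < c < 1 ->
  (forall k, dporous (E k) c A) ->
  (forall N, game C0 E N [set 0]) -> Gamma_null mu A.
Proof.
move=> /andP[c0 c1] pA win.
have c201 : 0 < c / 2 < 1 by apply/andP; split; lra.
have cA := @closed_closure _ A.
pose O k m := porosity_set (closure A) (c / 2) (E k) m.+1%:R^-1 0.
exists (closure A `&` \bigcap_k \bigcap_m O k m); split; last first.
  move=> x Ax; split; first exact: subset_closure.
  by move=> k _ m _; apply: dporous_closure Ax => //; exact: pA.
apply: null_criterion => //; first by move=> k m; exact: open_porosity_set.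
move=> g0 n e q e0 q0 dens.
have C00 : 0 <= C0 by rewrite -(normr0 X); exact: (gameS (win 0%N)).
have [Lb Lb0 HLb] := gamma_partial_bound g0.
pose L := \sum_(i < n) Lb i + e.
have L0 : 0 <= L by rewrite addr_ge0 ?sumr_ge0// ltW.
have HL k t : (k < n)%N -> `|D k g0 t| + e <= L.
  move=> kn; rewrite lerD2r; apply: le_trans (HLb k t) _.
  by rewrite (bigD1 (Ordinal kn))//= lerDl sumr_ge0.
set G := (bump_ratio (c / 2) n L (e / (2 * (C0 + 1))) / 6) ^+ n / 2 * (q / 2).
have G0 : 0 < G.
  rewrite !(mulr_gt0, exprn_gt0, divr_gt0)// bump_ratio_gt0//.
  by rewrite divr_gt0// mulr_gt0// ltr_wpDl.
have [N HN] := natr_large G^-1.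
have bound := @game_bound (closure A) (c / 2) C0 E cA c201 C00 g0 n e q L e0 q0 L0 HL
  dens N [set 0] g0 0 1 (win N) ltr01.
have : (mu (avoiding (closure A) g0 1) + (G *+ N)%:E <= 1)%E.
  apply: bound.
  - by rewrite lexx divr_gt0.
  - by move=> t; rewrite subrr normr0.
  - by move=> k t _; exists 0; rewrite // subrr scaler0 subr0 normr0.
apply/negP; rewrite -ltNge; apply: (@lt_le_trans _ _ (G *+ N)%:E).
  by rewrite lte_fin -mulr_natl -ltr_pdivrMr// mul1r.
by rewrite leeDr.
Qed.

End game.

(** * Rays *)

Section ray.
Context {R : realType} (mu : probability (borel_cube R) R).
Hypothesis mu_lebesgue : is_product_lebesgue mu.
Context {X : normedModType R}.
Local Notation D := partial_derivative.

Definition ray (v : X) : set X := [set a *: v | a in [set a : R | 0 < a]].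

Lemma linear_surface (j : nat) (eta : R) (v : X) : exists f : cube R -> X,
  [/\ is_C1 f, forall t, f t = (eta * coord (t j)) *: v &
      forall k t, D k f t = if k == j then eta *: v else 0].
Proof.
pose f i := if i == j then fun x : R => eta * x + 0 else fun=> 1.
pose df i := if i == j then fun _ : R => eta else fun=> 0.
have [] := @is_C1_tensor R X j.+1 f df v.
- by move=> i _; rewrite /f /df; case: ifP => _; [exact: derives_affine|exact: derives_cst].
- by move=> i _; rewrite /df; case: ifP => _ x; exact: cvg_cst.
move=> C1 E; exists (fun t => tensor j.+1 f t *: v); split=> // [t|k t].
  rewrite /tensor big_ord_recr/= {2}/f eqxx addr0 big1 ?mul1r// => i _.
  by rewrite /f ltn_eqF.
rewrite E; case: ifPn => [kj|]; last by rewrite -leqNgt => jk; rewrite gtn_eqF.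
move: kj; rewrite ltnS leq_eqVlt => /predU1P[->|kj].
  rewrite eqxx /tensor big_ord_recr/= eqxx {2}/df eqxx big1 ?mul1r// => i _.
  by rewrite ltn_eqF// /f ltn_eqF.
rewrite ltn_eqF// /tensor (bigD1 (Ordinal (ltnW kj : (k < j.+1)%N)))//= eqxx.
by rewrite {1}/df ltn_eqF// mul0r scale0r.
Qed.

Let low j (q : R) : set (cube R) := [set t | coord (t j) <= 1 - q].

(** The shift of coordinate [j] in [ray_step] must not leave the cube: parameters too close to the
    upper face are discarded, at the cost of [q]. *)
Lemma measure_slab (j : nat) (q : R) (K : set (cube R)) : 0 < q ->
  measurable (K : set (borel_cube R)) ->
  measurable (K `&` low j q : set (borel_cube R)) /\
  (mu K <= mu (K `&` low j q) + q%:E)%E.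
Proof.
move=> q0 mK.
pose slab := box j.+1 (fun i => if i == j then 1 - q else 0) (fun=> 1).
have mS : measurable (slab : set (borel_cube R)).
  by apply: closed_measurable_cube; exact: closed_box.
have cS : closed (low j q).
  rewrite (_ : low j q = (fun t => coord (t j)) @^-1` [set x | x <= 1 - q])//.
  by apply: closed_comp; [move=> t _; exact: coord_proj_continuous|exact: closed_le].
have mI : measurable (K `&` low j q : set (borel_cube R)).
  by apply: measurableI => //; exact: closed_measurable_cube.
split=> //.
apply: (@le_trans _ _ (mu ((K `&` low j q) `|` slab))).
  apply: le_measure; rewrite ?inE//; first exact: measurableU.
  move=> t Kt; have [h|h] := leP (coord (t j)) (1 - q); first by left.
  right=> i _; have /andP[t0 ->] := coord_itv (t i); rewrite andbT.
  by case: eqP => [->|//]; exact: ltW.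
apply: le_trans (measureU2 _ mI mS) _; apply: leeD => //.
suff : (mu (box j.+1 (fun i => if i == j then (1 - q)%R else 0%R) (fun=> 1%R)) <=
  q%:E)%E by [].
rewrite measure_box// lee_fin big_ord_recr/= eqxx.
have l1 : len (1 - q) 1 <= q.
  rewrite /len ge_max (ltW q0)/= minxx.
  have : 1 - q <= Num.max (1 - q) 0 by rewrite le_max lexx.
  lra.
rewrite big1 ?mul1r// => i _.
by rewrite ltn_eqF// /len minxx maxxx subr0 max_r.
Qed.

Section bound.
Variables (C : set X) (c : R) (v : X).
Hypotheses (cC : closed C) (c01 : 0 < c < 1) (v0 : v != 0).
Variables (g0 : Gamma X) (n : nat) (e q : R).
Hypothesis q0 : 0 < q.
Hypothesis dens : forall m g n' (e' : R), gamma_ball g0 n e g -> 0 < e' ->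
  exists2 h, gamma_ball g n' e' h &
    (q%:E <= mu (h @^-1` (C `&` porosity_set C c (ray v) m.+1%:R^-1 0)))%E.

(** The shifts from [b p * (1 - c / 4)] to [b p] reach the hole; their range is the fraction [tau]
    of [rho p = 2 * b p]. A single coordinate is treated this way, so [tau / 6] occurs once in
    [gain]. *)
Let tau : R := c / 8.
Let gain : R := tau / 6 / 2 * (q / 4).

(* As [h] has slope close to [dd / |v|] along [v] in the coordinate [j], the hole in
   the direction of the ray is reached by moving in this coordinate; no bump is
   needed. *)
Lemma ray_step (g : Gamma X) (j M : nat) (h : Gamma X) (s em d dd : R) (K : set (cube R)) :
  (j < M)%N -> (forall t, h (truncate M t) = h t) -> 0 < s ->
  measurable (K : set (borel_cube R)) -> ((q / 2)%:E <= mu K)%E ->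
  0 < dd -> d <= c * dd / 16 -> 0 < em -> em <= dd * (q / 8) ->
  (forall t, `|D j h t - (dd / `|v|) *: v| <= d) ->
  (forall p, K p -> exists u, [/\ ray v u, s < `|u| < em & hole C (h p + u) (c * `|u|)]) ->
  forall G G' : set (cube R),
    measurable (G : set (borel_cube R)) -> measurable (G' : set (borel_cube R)) ->
    G `<=` G' -> (forall t, hole C (h t) (c * s / 2) -> G' t) ->
    (forall t p, G t -> K p -> 2 * em <= `|h t - h p|) ->
    (mu G + gain%:E <= mu G')%E.
Proof.
move=> jM hM s0 mK qK dd0 dle em0 emle hD holes G G' mG mG' GG' hG' GK.
have /andP[c0 c1] := c01.
have nv : 0 < `|v| by rewrite normr_gt0.
pose eta := dd / `|v|.
have eta0 : 0 < eta by rewrite divr_gt0.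
have etav : eta * `|v| = dd by rewrite divfK ?gt_eqF.
(* Without its linear part, [h] has slope at most [d] in the coordinate [j], so the remainder hardly
   changes during the shift. *)
have [lin [C1lin linE Dlin]] := linear_surface j eta v.
have [C1r Dr] := is_C1B (gamma_C1 h) C1lin.
pose r := MkGamma C1r.
have [Lb Lb0 HLb] := gamma_partial_bound r.
have q80 : 0 < q / 8 by rewrite divr_gt0.
have [mK' leK'] := measure_slab j q80 mK.
set K' := K `&` _ in mK' leK'.
have /choice[a Ha] : forall p, exists a : R, K p ->
    [/\ 0 < a, s < a * `|v| < em & hole C (h p + a *: v) (c * (a * `|v|))].
  move=> p; have [Kp|nKp] := pselect (K p); last by exists 0.
  have [_ [[a a0 <-]]] := holes p Kp.
  by rewrite normrZ gtr0_norm// => ? ?; exists a.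
(* The shift of coordinate [j] that moves the linear part by exactly [a p *: v]. *)
pose b p := a p * `|v| / dd.
have bE p : b p * dd = a p * `|v| by rewrite divfK ?gt_eqF.
pose rho p := 2 * b p.
pose SL := \sum_(i < M) Lb i.
have SL0 : 0 <= SL by apply: sumr_ge0.
have cs0 : 0 < c * s / 8 by rewrite divr_gt0// mulr_gt0.
have sd0 : 0 < 2 * (s / dd) by rewrite mulr_gt0// divr_gt0.
have [m] := natr_large (Num.max (SL / (c * s / 8)) (2 * (s / dd))^-1).
rewrite gt_max => /andP[m1 m2].
have mR : 0 < m%:R :> R by apply: lt_trans m2; rewrite invr_gt0.
have m0 : (0 < m)%N by rewrite -(ltr0n R).
have mSL : SL / m%:R <= c * s / 8 by rewrite ler_pdivrMr// mulrC -ler_pdivrMr// ltW.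
have msd : m%:R^-1 <= 2 * (s / dd) by rewrite invf_ple ?posrE// ltW.
pose dM : R := (4 * M.+1%:R)^-1.
have dM0 : 0 < dM by rewrite invr_gt0 mulr_gt0.
have dM1 : dM < 2^-1.
  rewrite ltf_pV2 ?posrE ?mulr_gt0//.
  have : 1 <= M.+1%:R :> R by rewrite ler1n.
  lra.
pose alpha p (_ : nat) := coord (p j) + b p * (1 - c / 4).
pose beta p (_ : nat) := coord (p j) + b p.
have bK p : K p -> [/\ 0 < b p, s / dd <= b p & b p <= q / 8].
  move=> /Ha[a0 /andP[sa ae] _]; rewrite /b; split.
  - by rewrite divr_gt0// mulr_gt0.
  - by rewrite ler_pM2r ?invr_gt0// ltW.
  - by rewrite ler_pdivrMr// [q / 8 * dd]mulrC; apply: le_trans emle; exact: ltW.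
have tau0 : 0 <= tau by rewrite divr_ge0// ltW.
have tau6 : 0 <= tau / 6 by rewrite divr_ge0.
have f00 : 0 <= tau / 6 / 2 by rewrite divr_ge0.
have [P [uP PK sepP gainP]] : exists P : seq (cube R),
  [/\ uniq P, forall p, p \in P -> K' p,
    forall p q, p \in P -> q \in P -> p != q -> separated M m (pred1 j) rho p q &
    forall G G' : set (cube R),
      measurable (G : set (borel_cube R)) -> measurable (G' : set (borel_cube R)) ->
      G `<=` G' -> (forall p, p \in P -> inner M m (pred1 j) alpha beta dM p `<=` G' /\
         inner M m (pred1 j) alpha beta dM p `&` G = set0) ->
      (mu G + (tau / 6 / 2)%:E * mu K' <= mu G')%E].
  apply: (covering_gain mu_lebesgue m0 mK' _ tau0) => //.
  - by rewrite dM0.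
  - move=> p [/bK[_ h1 _] _]; apply: le_trans msd _.
    by rewrite /rho ler_pM2l.
  - move=> p i [/bK[b0 _ bq] /= pj] iM /eqP ->.
    have /andP[p0 _] := coord_itv (p j).
    have {}pj : coord (p j) <= 1 - q / 8 := pj.
    have h1 : b p * (1 - c / 4) <= b p by rewrite ger_pMr//; lra.
    have h2 : 0 < b p * (1 - c / 4) by rewrite mulr_gt0//; lra.
    have h3 : tau * rho p = b p - b p * (1 - c / 4) by rewrite /tau /rho; field.
    by rewrite /alpha /beta h3 /rho; split; lra.
  apply: (@le_trans _ _ ((tau / 6) ^+ count (pred1 j) (iota 0 M) / 2)).
    rewrite ler_wpM2r ?invr_ge0// -[leLHS]expr1.
    apply: ler_wiXn2l; [exact: tau6|rewrite /tau; lra|].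
    by rewrite count_uniq_mem ?iota_uniq//; case: (j \in _).
  exact: prod_weights.
have near p t : K p -> inner M m (pred1 j) alpha beta dM p t ->
    `|h p + a p *: v - h t| <= c * (a p * `|v|) / 2.
  move=> Kp tp; have [a0 /andP[sa ae] _] := Ha p Kp; have [b0 _ bq] := bK p Kp.
  have := tp j jM; rewrite /= eqxx /alpha /beta => /andP[t1 t2].
  have -> : h p + a p *: v - h t = (r p - r t) + (eta * (coord (p j) + b p - coord (t j))) *: v.
    rewrite /r /= !linE mulrBr mulrDr scalerBl scalerDl.
    have -> : (eta * b p) *: v = a p *: v.
      by rewrite /eta /b; congr (_ *: _); field; rewrite !gt_eqF.
    move: (h p) (h t) (a p *: v) ((eta * coord (p j)) *: v) ((eta * coord (t j)) *: v).
    move=> A B w y z; rewrite opprB addrACA [A - y + (y + w)]addrA subrK.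
    by rewrite [z - B - z]addrAC subrr add0r.
  apply: le_trans (ler_normD _ _) _.
  have h1 : `|(eta * (coord (p j) + b p - coord (t j))) *: v| <= c * (a p * `|v|) / 4.
    rewrite normrZ normrM gtr0_norm// mulrAC etav.
    have : `|coord (p j) + b p - coord (t j)| <= b p * (c / 4).
      by rewrite ler_norml; apply/andP; split; lra.
    move=> /(ler_wpM2l (ltW dd0)) h2; apply: le_trans h2 _.
    by rewrite -bE le_eqVlt; apply/orP; left; apply/eqP; ring.
  have h2 : `|r p - r t| <= c * (a p * `|v|) / 16 + c * s / 8.
    apply: (@le_trans _ _ (\sum_(i < M) (if (i == j :> nat) then d else Lb i) *
        `|coord (p i) - coord (t i)|)).
      apply: (@gamma_cylinder_lipschitz _ _ r M (fun i => if i == j then d else Lb i)) => //.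
      - by move=> w; rewrite /r /= hM !linE /truncate jM.
      - move=> k w kM; case: eqP => [->|_]; last exact: HLb.
        by rewrite /r /= Dr/= Dlin eqxx; exact: hD.
    rewrite (bigD1 (Ordinal jM))//= eqxx; apply: lerD.
      have d0 : 0 <= d by apply: le_trans (hD t).
      apply: (@le_trans _ _ (d * b p)).
        apply: ler_wpM2l => //; rewrite ler_norml; apply/andP; split; first by lra.
        have : 0 <= b p * (1 - c / 4) by rewrite mulr_ge0 ?(ltW b0)//; lra.
        lra.
      apply: (@le_trans _ _ (c * dd / 16 * b p)); first by rewrite ler_wpM2r// ltW.
      by rewrite -bE le_eqVlt; apply/orP; left; apply/eqP; ring.
    apply: le_trans mSL; rewrite /SL mulr_suml.
    rewrite [leRHS](bigD1 (Ordinal jM))//= -[leLHS]add0r; apply: lerD.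
      by rewrite divr_ge0.
    apply: ler_sum => i ij.
    have ij' : (i == j :> nat) = false.
      by apply/negbTE; apply: contraNneq ij => ij; apply/eqP/val_inj.
    rewrite ij'; apply: ler_wpM2l => //; have := tp i (ltn_ord i); rewrite /= ij'.
    have := cell_itv m0 p i; rewrite -addn1 natrD addrAC !mulrDl mulNr mul1r.
    have dm : 0 < dM / m%:R by rewrite divr_gt0.
    by move=> /andP[? ?] /andP[? ?]; rewrite ler_norml; apply/andP; split; lra.
  have h3 : c * s <= c * (a p * `|v|) by rewrite ler_wpM2l// ltW.
  have h4 : 0 < c * (a p * `|v|) by rewrite mulr_gt0// mulr_gt0.
  by lra.
have qK' : (gain%:E <= (tau / 6 / 2)%:E * mu K')%E.
  rewrite /gain EFinM; apply: lee_wpmul2l; first by rewrite lee_fin.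
  have := le_trans qK leK'; rewrite -leeBlDr// -EFinB; apply: le_trans.
  by rewrite lee_fin; lra.
apply: (@le_trans _ _ (mu G + (tau / 6 / 2)%:E * mu K')%E); first exact: leeD2l.
apply: gainP => // p /PK[Kp _]; have [a0 /andP[sa ae] Hh] := Ha p Kp.
have h3 : c * s <= c * (a p * `|v|) by rewrite ler_wpM2l// ltW.
have h4 : 0 < c * (a p * `|v|) by rewrite mulr_gt0// mulr_gt0.
split.
  move=> t tp; apply: hG'.
  apply: (hole_le _ (@hole_near _ _ _ _ (h t) _ Hh)).
  by have := near p t Kp tp; lra.
rewrite -subset0 => t [/(near p t Kp) tp Gt]; have h1 := GK t p Gt Kp.
have h2 : `|h t - h p| <= `|h p + a p *: v - h t| + a p * `|v|.
  rewrite (distrC (_ + _)); apply: le_trans (ler_distD (h p + a p *: v) _ _) _.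
  by rewrite lerD2l addrC addKr normrZ gtr0_norm.
have h5 : c * (a p * `|v|) < a p * `|v| by rewrite gtr_pMl// mulr_gt0.
by move: h1 h2; lra.
Qed.

(** Truncation at some [j >= n] frees the coordinate [j], which then receives the constant slope
    [(dd / |v|) *: v]. The ball does not see this derivative, and all that it sees is changed by as
    little as desired, so any number of steps fits without a game. *)
Lemma ray_bound (N : nat) (g : Gamma X) (th : R) :
  gamma_ball g0 n e g -> 0 < th -> (mu (avoiding C g th) + (gain *+ N)%:E <= 1)%E.
Proof.
elim: N g th => [|N IH] g th gb th0.
  by rewrite mulr0n adde0; apply: probability_le1; exact: avoiding_measurable.
have /andP[c0 c1] := c01.
have nv : 0 < `|v| by rewrite normr_gt0.
have [e1 e1e g0g] := gamma_ball_close gb.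
pose dd := Num.min ((e - e1) / 8) (th / 16).
have dd0 : 0 < dd by rewrite lt_min !divr_gt0// subr_gt0.
have [dd1 dd2] : dd <= (e - e1) / 8 /\ dd <= th / 16 by rewrite /dd !ge_min !lexx orbT.
have [M0 HM0] := truncate_gamma_close g n dd0.
pose j := maxn M0 n.
pose gt := truncate_gamma j g.
have ggt : close n dd g gt := HM0 j (leq_maxl _ _).
pose eta := dd / `|v|.
have etav : eta * `|v| = dd by rewrite divfK ?gt_eqF.
have eta0 : 0 < eta by rewrite divr_gt0.
have [lin [C1lin linE Dlin]] := linear_surface j eta v.
have [C1g' Dg'] := is_C1D (gamma_C1 gt) C1lin.
pose g' := MkGamma C1g'.
have gtg' : close n dd gt g'.
  split=> [t|k t kn].
    rewrite /g' /= addrC addKr linE normrZ normrM gtr0_norm// mulrAC etav.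
    have /andP[t0 t1] := coord_itv (t j).
    by rewrite ger0_norm// ler_piMr// ltW.
  rewrite /g' /= Dg'/= addrC addKr Dlin ltn_eqF ?normr0 ?(ltW dd0)//.
  by apply: leq_trans kn _; exact: leq_maxr.
have Dj t : D j g' t = eta *: v.
  rewrite /g' /= Dg'/= Dlin eqxx.
  by have [_ ->] := is_C1_truncate j (gamma_C1 g); rewrite ltnn add0r.
have gg' := close_trans ggt gtg'.
have gb' : gamma_ball g0 n e g'.
  by apply: close_gamma_ball (close_trans g0g gg'); lra.
pose d := c * dd / 16.
have d0 : 0 < d by rewrite divr_gt0// mulr_gt0.
have ddd : d <= dd.
  have : c * dd <= dd by rewrite ler_piMl// ltW.
  by rewrite /d; lra.
have dm0 : 0 < Num.min dd (dd * (q / 8)).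
  by rewrite lt_min dd0 mulr_gt0// divr_gt0.
have [m] := exists_invn dm0; rewrite lt_min.
have em0 : 0 < m.+1%:R^-1 :> R by rewrite invr_gt0.
have densm := @dens m; set em := m.+1%:R^-1 in em0 densm * => /andP[em1 em2].
have [h [M [s [K [jM hM s0 [mK qK] [gh holes]]]]]] :=
  cylinder_selection cC j.+1 q0 d0 (fun n' e' => @densm g' n' e' gb').
have hD t : `|D j h t - (dd / `|v|) *: v| <= d.
  by rewrite -/eta -(Dj t); exact: gh.2.
have gh' : close n (dd + dd + d) g h.
  apply: close_trans gg' _; apply: close_widen gh => //.
  by rewrite ltnW// ltnS leq_maxr.
pose th' := Num.min (th / 2) (c * s / 2).
have th'0 : 0 < th' by rewrite lt_min !divr_gt0// mulr_gt0.
have [th'1 th'2] : th' <= th / 2 /\ th' <= c * s / 2 by rewrite /th' !ge_min !lexx orbT.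
have step : (mu (avoiding C g th) + gain%:E <= mu (avoiding C h th'))%E.
  apply: (ray_step g jM hM s0 mK qK dd0 (lexx d) em0 (ltW em2) hD).
  - by move=> p /holes[_].
  - exact: avoiding_measurable.
  - exact: avoiding_measurable.
  - move=> t Ht; apply: hole_le (@hole_near _ _ _ _ (h t) _ Ht).
    by have := gh'.1 t; rewrite distrC; lra.
  - by move=> t; exact: hole_le.
  move=> t p Gt /holes[[x Cx xp] _]; rewrite leNgt; apply/negP => htp.
  apply: (Gt x) => //.
  have h1 := gh'.1 t; have h2 := ler_distD (h p) x (g t).
  have h3 := ler_distD (h t) (h p) (g t); rewrite (distrC (h p) (h t)) in h3.
  by lra.
have hb : gamma_ball g0 n e h.
  by apply: close_gamma_ball (close_trans g0g gh'); lra.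
have := IH h th' hb th'0; apply: le_trans.
by rewrite mulrS EFinD addeA; apply: leeD.
Qed.

End bound.

Lemma ray_null (c : R) (v : X) (A : set X) : 0 < c < 1 ->
  dporous (ray v) c A -> Gamma_null mu A.
Proof.
move=> /andP[c0 c1] pA.
have c201 : 0 < c / 2 < 1 by apply/andP; split; lra.
have cA := @closed_closure _ A.
pose O (k m : nat) := porosity_set (closure A) (c / 2) (ray v) m.+1%:R^-1 0.
exists (closure A `&` \bigcap_k \bigcap_m O k m); split; last first.
  move=> x Ax; split; first exact: subset_closure.
  by move=> k _ m _; apply: dporous_closure Ax.
apply: null_criterion => //; first by move=> k m; exact: open_porosity_set.
move=> g0 n e q e0 q0 dens.
have v0 : v != 0.
  apply/eqP => v0; have [h _] := dens 0%N 0%N g0 0%N 1 (@gamma_ball_refl _ _ g0 n e e0) ltr01.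
  apply/negP; rewrite -ltNge (_ : _ @^-1` _ = set0) ?measure0 ?lte_fin//.
  rewrite -subset0 => t [_ [u [[a _ <-]]]].
  by rewrite v0 scaler0 normr0 ltxx.
set G := c / 2 / 8 / 6 / 2 * (q / 4).
have G0 : 0 < G by rewrite !(mulr_gt0, divr_gt0).
have [N HN] := natr_large G^-1.
have := @ray_bound (closure A) (c / 2) v cA c201 v0 g0 n e q q0
  (fun m => dens 0%N m) N g0 1 (@gamma_ball_refl _ _ g0 n e e0) ltr01.
apply/negP; rewrite -ltNge; apply: (@lt_le_trans _ _ (G *+ N)%:E).
  by rewrite lte_fin -mulr_natl -ltr_pdivrMr// mul1r.
by rewrite leeDr.
Qed.

End ray.

(** * Good sets of directions *)

Section good.
Context {R : realType} (mu : probability (borel_cube R) R).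
Hypothesis mu_lebesgue : is_product_lebesgue mu.
Context {X : normedModType R}.
Implicit Types (A P Q V : set X) (c : R).

Lemma Gamma_null_sub A A' : A `<=` A' -> Gamma_null mu A' -> Gamma_null mu A.
Proof. by move=> AA' [N [nN A'N]]; exists N; split=> //; exact: subset_trans A'N. Qed.

Lemma borel_preimage_measurable (g : Gamma X) (N : set X) : borel N ->
  measurable (g @^-1` N : set (borel_cube R)).
Proof.
suff : <<s @open X >> `<=` [set N | measurable (g @^-1` N : set (borel_cube R))] by exact.
apply: smallest_sub; last by move=> O oO; exact: open_preimage_measurable.
split=> [|B mB|F mF] /=.
- by rewrite preimage_set0.
- by rewrite setTD preimage_setC; exact: measurableC.
- by rewrite preimage_bigcup; exact: bigcupT_measurable.
Qed.

Lemma Gamma_null_bigcup (F : nat -> set X) :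
  (forall i, Gamma_null mu (F i)) -> Gamma_null mu (\bigcup_i F i).
Proof.
move=> /choice[N HN]; exists (\bigcup_i N i); split; last first.
  by move=> x [i _ Fx]; exists i => //; exact: (HN i).2.
split.
  have H i : measurable (N i : set (g_sigma_algebraType (@open X))) := (HN i).1.1.
  exact: bigcupT_measurable H.
have /choice[U HU] i := (HN i).1.2.
exists (fun n => if (choice.unpickle n : option (nat * nat)) is Some p then U p.1 p.2 else setT).
split=> [n|g Ug].
  case: choice.unpickle => [[i j]|]; first exact: (HU i).1.
  by split=> [|O O0 _]; [exact: openT|rewrite setIT].
have null i : mu (g @^-1` N i) = 0%E.
  apply: (HU i).2 => j _; have := Ug (choice.pickle (i, j)) Logic.I.
  by rewrite choice.pickleK.
suff : mu (g @^-1` (\bigcup_i N i)) = 0%E by [].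
rewrite preimage_bigcup.
have mN i : measurable (g @^-1` N i : set (borel_cube R)).
  by apply: borel_preimage_measurable; exact: (HN i).1.1.
apply: (negligibleP mu (bigcupT_measurable _ mN)).1.
apply: negligible_bigcup => i; exact: (negligibleP mu (mN i)).2 (null i).
Qed.

Lemma Gamma_nullU A A' : Gamma_null mu A -> Gamma_null mu A' -> Gamma_null mu (A `|` A').
Proof.
move=> nA nA'; apply: (@Gamma_null_sub _ (\bigcup_i (if i == 0%N then A else A'))).
  by move=> x [Ax|Ax]; [exists 0%N|exists 1%N].
by apply: Gamma_null_bigcup => i; case: ifP.
Qed.

Definition good P : Prop := forall c A, 0 < c < 1 -> dporous P c A -> Gamma_null mu A.

Lemma good_sub P Q : P `<=` Q -> good Q -> good P.
Proof.
move=> PQ gQ c A c01 pA; apply: (gQ c A c01) => x Ax e e0.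
by have [u [/PQ Qu ue H]] := pA x Ax e e0; exists u.
Qed.

Lemma good_set0 : good set0.
Proof.
move=> c A c01 pA; apply: (@ray_null _ _ mu_lebesgue _ c 0 A c01) => x Ax e e0.
by have [u []] := pA x Ax e e0.
Qed.

Lemma good_ray v : good (ray v).
Proof. by move=> c A; exact: ray_null. Qed.

Lemma dporous_sub P c A A' : A' `<=` A -> dporous P c A -> dporous P c A'.
Proof.
move=> AA' pA x /AA' Ax e e0; have [u [Pu ue H]] := pA x Ax e e0.
by exists u; split=> // w wx /AA'; exact: H.
Qed.

Definition porous_part P c A : set X := [set x | A x /\ forall e : R, 0 < e -> exists u,
  [/\ P u, 0 < `|u| < e & forall w, `|w - (x + u)| <= c * `|u| -> ~ A w]].

Lemma dporous_part P c A : dporous P c (porous_part P c A).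
Proof.
move=> x [Ax H] e e0; have [u [Pu ue Hu]] := H e e0.
by exists u; split=> // w wx [Aw _]; exact: Hu wx Aw.
Qed.

Lemma good_setU P Q : good P -> good Q -> good (P `|` Q).
Proof.
move=> gP gQ c A c01 pA.
apply: (@Gamma_null_sub _ (porous_part P c A `|` porous_part Q c A)); last first.
  apply: Gamma_nullU.
  - exact: (gP c _ c01 (@dporous_part P c A)).
  - exact: (gQ c _ c01 (@dporous_part Q c A)).
move=> x Ax; apply: contrapT => /not_orP[nP nQ].
have [e1 [e10 H1]] : exists e1 : R, 0 < e1 /\ ~ exists u,
    [/\ P u, 0 < `|u| < e1 & forall w, `|w - (x + u)| <= c * `|u| -> ~ A w].
  apply: contrapT => /forallNP H; apply: nP; split=> // e e0.
  by apply: contrapT => nu; apply: (H e).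
have [e2 [e20 H2]] : exists e2 : R, 0 < e2 /\ ~ exists u,
    [/\ Q u, 0 < `|u| < e2 & forall w, `|w - (x + u)| <= c * `|u| -> ~ A w].
  apply: contrapT => /forallNP H; apply: nQ; split=> // e e0.
  by apply: contrapT => nu; apply: (H e).
have e120 : 0 < Num.min e1 e2 by rewrite lt_min e10.
have [u [PQu /andP[u0]]] := pA x Ax _ e120; rewrite lt_min => /andP[u1 u2] Hu.
by case: PQu => [Pu|Qu]; [apply: H1|apply: H2]; exists u; split=> //; rewrite u0.
Qed.

Lemma good_rays (s : seq X) : good [set u | exists2 v, v \in s & ray v u].
Proof.
elim: s => [|v s IH]; first by apply: (good_sub _ good_set0) => u [v].
apply: (@good_sub _ _ _ (good_setU (@good_ray v) IH)) => u [w].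
by rewrite inE => /predU1P[->|ws] uw; [left|right; exists w].
Qed.

(** [c / 2 * |h|] is small compared with a hole of radius [c * |h|]; [B] prevents cancellation of
    long summands. *)
Definition splits V P Q c (B : R) : Prop := forall h, V h -> exists y z,
  [/\ h = y + z, `|y| <= B * `|h|, `|z| <= B * `|h|, z = 0 \/ Q z &
      `|y| < c / 2 * `|h| \/ P y].

Lemma porous_split V P Q c (B : R) A : 0 < c < 1 -> 1 <= B ->
  splits V P Q c B -> good Q -> dporous V c A ->
  Gamma_null mu (A `\` porous_part P (c / (8 * B)) A).
Proof.
(* With this [c'] the errors [c' * |y|] and [c' * |z|] are at most [c / 8 * |h|] each; even with a
   negligible [y] added they stay inside the hole of radius [c * |h|]. *)
move=> /andP[c0 c1] B1 VPQ gQ pA; set c' := c / (8 * B).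
have B0 : 0 < B by apply: lt_le_trans B1.
have c'0 : 0 < c' by rewrite divr_gt0// mulr_gt0.
have c'B : c' * B = c / 8 by rewrite /c'; field; rewrite gt_eqF.
have c'1 : c' < 1.
  have : c' <= c' * B by rewrite ler_peMr// ltW.
  lra.
(* Sorting the points by the scale below which they have no hole along [P] makes this scale valid
   also at the nearby points [x']. *)
pose Bm (m : nat) : set X := [set x | A x /\ forall u, P u -> 0 < `|u| < m.+1%:R^-1 ->
  exists2 w, `|w - (x + u)| <= c' * `|u| & A w].
apply: (@Gamma_null_sub _ (\bigcup_m Bm m)).
  move=> x [Ax nx]; have [e [e0 He]] : exists e : R, 0 < e /\ ~ exists u,
      [/\ P u, 0 < `|u| < e & forall w, `|w - (x + u)| <= c' * `|u| -> ~ A w].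
    apply: contrapT => /forallNP H; apply: nx; split=> // e e0.
    by apply: contrapT => nu; apply: (H e).
  have [m me] := exists_invn e0; exists m => //; split=> // u Pu /andP[u0 um].
  apply: contrapT => nw; apply: He; exists u; split=> //.
    by rewrite u0; exact: lt_trans me.
  by move=> w wu Aw; apply: nw; exists w.
apply: Gamma_null_bigcup => m; apply: (gQ c'); first by rewrite c'0.
move=> x [Ax Hx] e e0.
have min0 : 0 < Num.min e m.+1%:R^-1 / B by rewrite divr_gt0// lt_min e0 invr_gt0 ltr0n.
have [h [Vh /andP[h0]]] := pA x Ax _ min0.
rewrite ltr_pdivlMr// lt_min mulrC => /andP[he hm] Hh.
have [y [z [hE yB zB Qz Py]]] := VPQ h Vh.
have claim x' : Bm m x' -> `|x' - (x + z)| <= c' * `|z| -> False.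
  move=> [Ax' Hx'] xx'.
  have z1 : c' * `|z| <= c / 8 * `|h|.
    by rewrite -c'B -mulrA ler_wpM2l// ltW.
  have ch0 : 0 < c * `|h| by rewrite mulr_gt0.
  have small : `|y| < c / 2 * `|h| -> False.
    move=> ysm; apply: (Hh x') => //.
    have -> : x' - (x + h) = (x' - (x + z)) - y.
      by rewrite hE [y + z]addrC addrA [in LHS]opprD addrA.
    by apply: le_trans (ler_normB _ _) _; lra.
  have [//|yP] := Py; have [y0|y0] := eqVneq y 0.
    by apply: small; rewrite y0 normr0; lra.
  have y1 : 0 < `|y| < m.+1%:R^-1.
    by rewrite normr_gt0 y0; apply: le_lt_trans yB hm.
  have [w wy Aw] := Hx' y yP y1; apply: (Hh w) => //.
  have -> : w - (x + h) = (w - (x' + y)) + (x' - (x + z)).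
    rewrite hE [y + z]addrC addrA !opprD !addrA.
    by rewrite [w - x' - y]addrAC subrK [LHS]addrAC [w - x - y]addrAC.
  have y2 : c' * `|y| <= c / 8 * `|h|.
    by rewrite -c'B -mulrA ler_wpM2l// ltW.
  by apply: le_trans (ler_normD _ _) _; lra.
have z0 : z != 0.
  apply/eqP => z0; apply: (claim x) => //.
  by rewrite z0 addr0 subrr normr0 mulr0.
exists z; split.
- by case: Qz => // ze; rewrite ze eqxx in z0.
- by rewrite normr_gt0 z0; exact: le_lt_trans zB he.
- by move=> w wz Bw; exact: claim Bw wz.
Qed.

(** [Q] may depend on [c], but [E] may not, as the game is played before [c] is known. A common [B]
    gives the points of [A'] the same porosity constant along all [E k]. *)
Lemma good_of_game V (E : nat -> set X) (Q : R -> nat -> set X) (B C0 : R) : 1 <= B ->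
  (forall c k, 0 < c < 1 -> good (Q c k) /\ splits V (E k) (Q c k) c B) ->
  (forall N, game C0 E N [set 0]) -> good V.
Proof.
move=> B1 H win c A c01 pA; have /andP[c0 c1] := c01.
have B0 : 0 < B by apply: lt_le_trans B1.
pose c' := c / (8 * B).
pose A' := \bigcap_k porous_part (E k) c' A.
apply: (@Gamma_null_sub _ (A' `|` \bigcup_k (A `\` porous_part (E k) c' A))).
  move=> x Ax; have [h|/existsNP[k /not_implyP[_ nk]]] := pselect (A' x); first by left.
  by right; exists k.
apply: Gamma_nullU; last first.
  apply: Gamma_null_bigcup => k; have [gQ sp] := H c k c01.
  exact: porous_split gQ pA.
apply: (@game_null _ _ mu_lebesgue _ c' C0 E A') => //.
  rewrite divr_gt0 ?mulr_gt0//= ltr_pdivrMr ?mulr_gt0// mul1r; lra.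
by move=> k; apply: (dporous_sub _ (@dporous_part (E k) c' A)) => x; exact.
Qed.

Lemma porous_dporous A : porous A -> exists2 c : R, 0 < c < 1 & dporous setT c A.
Proof.
move=> [c [c01 H]]; exists c => // x Ax e e0; have [y [yx Hy]] := H x Ax.
have /andP[c0 c1] := c01.
move/cvgrPdist_lt: yx => /(_ e e0)[n _ /(_ n (leqnn n))] /= xyn.
have hole w : `|y n - w| <= c * `|y n - x| -> ~ A w.
  move=> wy Aw; have : (closed_ball_ Num.norm (y n) (c * `|y n - x|) `&` A) w by [].
  by rewrite Hy.
exists (y n - x); split=> //; last by move=> w; rewrite [x + _]addrC subrK distrC; exact: hole.
rewrite distrC xyn andbT lt_def normr_ge0 andbT.
(* If [y n = x], the closed ball of radius 0 still contains the point [x] of [A]. *)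
apply/eqP => yx0; apply: (hole x) => //.
by rewrite distrC yx0 mulr0.
Qed.

Lemma good_sigma_porous A : good [set: X] -> sigma_porous A -> Gamma_null mu A.
Proof.
move=> gT [F [pF ->]]; apply: Gamma_null_bigcup => i.
by have [c c01 pc] := porous_dporous (pF i); exact: gT c01 pc.
Qed.

End good.

(** * Subspaces of c_0 *)

Section tails.
Context {R : realType} (mu : probability (borel_cube R) R).
Hypothesis mu_lebesgue : is_product_lebesgue mu.
Context {X : normedModType R}.

(** The square serves the dual of the Figiel-Johnson space: summed over [k] coordinates, these
    bounds still give less than [|u| / k.+1%:R]. *)
Definition tail_cone (l : nat -> X -> R) (k : nat) : set X :=
  [set u | forall j, (j < k)%N -> `|l j u| <= `|u| / k.+1%:R ^+ 2].

Lemma functional_net (l : nat -> X -> R) (k : nat) (d : R) :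
  (forall j x, `|l j x| <= `|x|) -> 0 < d ->
  exists s : seq X, (forall z, z \in s -> `|z| <= 1) /\
    forall h, `|h| <= 1 -> exists2 z, z \in s &
      forall j, (j < k)%N -> `|l j h - l j z| <= d.
Proof.
move=> ln d0.
have [N HN] := natr_large (2 / d).
pose q j x : nat := Num.trunc ((l j x + 1) / d).
have lb j x : `|x| <= 1 -> 0 <= (l j x + 1) / d.
  move=> x1; have := le_trans (ln j x) x1; rewrite ler_norml => /andP[h _].
  by rewrite divr_ge0 ?(ltW d0)//; lra.
have qN j x : `|x| <= 1 -> (q j x < N.+1)%N.
  move=> x1; have := le_trans (ln j x) x1; rewrite ler_norml => /andP[_ h].
  have /truncn_itv/andP[h1 _] := lb j x x1.
  rewrite ltnS -(ler_nat R); apply: le_trans h1 _; apply: le_trans (ltW HN).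
  by rewrite ler_pM2r ?invr_gt0//; lra.
pose kap x : {ffun 'I_k -> 'I_N.+1} := [ffun j : 'I_k => inord (q j x)].
have [s [s1 covs]] := finite_reps kap [set x : X | `|x| <= 1].
exists s; split=> // h h1; have [z zs e] := covs h h1; exists z => // j jk.
have z1 : `|z| <= 1 := s1 z zs.
have := congr1 (fun f : {ffun 'I_k -> 'I_N.+1} => val (f (Ordinal jk))) e.
rewrite /kap !ffunE/= !inordK ?qN// => qe.
have /truncn_itv := lb j h h1; have /truncn_itv := lb j z z1.
rewrite -/(q j h) -/(q j z) qe -addn1 natrD.
rewrite !ler_pdivlMr// !ltr_pdivrMr// mulrDl mul1r.
by move=> /andP[? ?] /andP[? ?]; rewrite ler_norml; apply/andP; split; lra.
Qed.

Lemma good_of_tail_game (l : nat -> X -> R) (C0 : R) :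
  (forall j a x y, l j (a *: x + y) = a * l j x + l j y) ->
  (forall j x, `|l j x| <= `|x|) ->
  (forall N, game C0 (tail_cone l) N [set 0]) -> good mu [set: X].
Proof.
move=> ll ln win.
have l0 j : l j 0 = 0.
  by have := ll j (-1) 0 0; rewrite scaler0 addr0 mulN1r addrC subrr.
have lZ j a x : l j (a *: x) = a * l j x.
  by have := ll j a x 0; rewrite addr0 l0 addr0.
have lB j x y : l j (x - y) = l j x - l j y.
  by rewrite addrC -scaleN1r ll mulN1r addrC.
have /choice[s Hs] : forall ck : R * nat, exists s : seq X, 0 < ck.1 ->
    (forall z, z \in s -> `|z| <= 1) /\
    forall h, `|h| <= 1 -> exists2 z, z \in s & forall j, (j < ck.2)%N ->
      `|l j h - l j z| <= ck.1 / 2 * (ck.2.+1%:R ^+ 2)^-1.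
  move=> [c k] /=; have [c0|_] := ltP 0 c; last by exists [::].
  have d0 : 0 < c / 2 * (k.+1%:R ^+ 2)^-1.
    by rewrite mulr_gt0 ?divr_gt0// invr_gt0 exprn_gt0// ltr0n.
  by have [s Hs] := functional_net k ln d0; exists s.
apply: (@good_of_game _ _ mu_lebesgue _ _ (tail_cone l)
  (fun c k => [set u | exists2 v, v \in s (c, k) & ray v u]) 2 C0) => //; first by lra.
move=> c k /andP[c0 c1]; split; first exact: good_rays.
move=> h _; have [->|h0] := eqVneq h 0.
  exists 0, 0; split; rewrite ?addr0 ?normr0 ?mulr0//; first by left.
  by right=> j _; rewrite l0 !normr0 mul0r.
have nh : 0 < `|h| by rewrite normr_gt0.
have [s1 net] := Hs (c, k) c0.
have nh1 : `| `|h|^-1 *: h| <= 1.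
  by rewrite normrZ normfV normr_id mulVf ?gt_eqF.
have [z zs lz] := net _ nh1.
pose y := h - `|h| *: z.
have nz : `| `|h| *: z| <= `|h|.
  by rewrite normrZ normr_id ler_piMr//; exact: s1.
exists y, (`|h| *: z); split.
- by rewrite subrK.
- by apply: le_trans (ler_normB _ _) _; lra.
- by apply: le_trans nz _; lra.
- by right; exists z => //; exists `|h|.
(* The net controls [y] on the first [k] functionals relative to [|h|]. The cone needs this relative
   to [|y|], and here [|y|] is at least [c / 2 * |h|]; hence the mesh of the net. *)
have [ysmall|ybig] := ltP `|y| (c / 2 * `|h|); [by left|right] => j jk.
have e : l j y = `|h| * (l j (`|h|^-1 *: h) - l j z).
  by rewrite lB !lZ mulrBr mulrA divff ?gt_eqF// mul1r.
rewrite e normrM normr_id; apply: le_trans (ler_wpM2l (ltW nh) (lz j jk)) _.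
rewrite mulrA; apply: ler_wpM2r; first by rewrite invr_ge0 exprn_ge0.
by rewrite mulrC.
Qed.

Lemma sup_norm_leb (I : Type) (f : I -> R) (b : R) : 0 <= b ->
  (forall i, `|f i| <= b) -> sup_norm f <= b.
Proof.
move=> b0 fb; have [[i _]|nI] := pselect ([set: I] !=set0).
  apply: ge_sup; first by exists `|f i|, i.
  by move=> _ [j _ <-].
rewrite /sup_norm (_ : [set `|f i| | i in setT] = set0) ?sup0//.
by rewrite -subset0 => y [i _ _]; apply: nI; exists i.
Qed.

Lemma sup_norm_geb (I : Type) (f : I -> R) (B : R) i :
  (forall i, `|f i| <= B) -> `|f i| <= sup_norm f.
Proof.
move=> fB; apply: ub_le_sup; last by exists i.
by exists B => _ [j _ <-].
Qed.

(* A vector of [E k] is negligible off [T k], where the previous ones are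
   already small, so the supremum norms of the sums do not add up. *)
Lemma game_sup (I : Type) (J : X -> I -> R) (T : nat -> set I) (E : nat -> set X) :
  (forall a x y i, J (a *: x + y) i = a * J x i + J y i) ->
  (forall x i, `|J x i| <= `|x|) ->
  (forall x b, 0 <= b -> (forall i, `|J x i| <= b) -> `|x| <= b) ->
  (forall k, T k.+1 `<=` T k) ->
  (forall k u, E k u -> (forall i, ~ T k i -> `|J u i| <= `|u| / k.+1%:R) /\
     forall d : R, 0 < d -> exists m, forall i, T m i -> `|J u i| <= d) ->
  forall N, game 2 E N [set 0].
Proof.
move=> JD Jn nJ Tdec HE.
have Tmon k m : (k <= m)%N -> T m `<=` T k.
  elim: m => [|m IH]; first by rewrite leqn0 => /eqP ->.
  rewrite leq_eqVlt => /predU1P[->//|km].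
  by apply: subset_trans (Tdec m) _; exact: IH.
have J0 i : J 0 i = 0.
  by have := JD (-1) 0 0 i; rewrite scaler0 addr0 mulN1r addrC subrr.
have JZ a x i : J (a *: x) i = a * J x i.
  by have := JD a x 0 i; rewrite addr0 J0 addr0.
have JA x y i : J (x + y) i = J x i + J y i.
  by have := JD 1 x y i; rewrite scale1r mul1r.
pose small (S : set X) := forall d : R, 0 < d -> exists k,
  forall s i, S s -> T k i -> `|J s i| <= d.
suff H N : forall S (b : R), 1 <= b < 2 -> (forall s, S s -> `|s| <= b) -> small S ->
    game 2 E N S.
  move=> N; apply: (H N _ 1); first by rewrite lexx ltr1n.
    by move=> _ ->; rewrite normr0.
  by move=> d d0; exists 0%N => _ i -> _; rewrite J0 normr0 ltW.
elim: N => [|N IH] S b /andP[b1 b2] Sb smS;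
  (split; first by move=> s /Sb sb; apply: le_trans sb _; exact: ltW) => //.
(* Half of the slack is used: on [T k] the new bound is [d + 1], off [T k] it is [b + d], and
   [b >= 1]. *)
pose d := (2 - b) / 2.
have d0 : 0 < d by rewrite divr_gt0// subr_gt0.
have [k1 Hk1] := smS d d0; have [k2 Hk2] := exists_invn d0.
pose k := maxn k1 k2; exists k => U UE.
have kd : k.+1%:R^-1 <= d.
  apply: le_trans (ltW Hk2).
  by rewrite lef_pV2 ?posrE ?ltr0n// ler_nat ltnS leq_maxr.
apply: (IH _ (b + d)).
- by apply/andP; split; rewrite /d; lra.
- move=> x [/Sb sb|[s [u [a [Ss uU au ->]]]]]; first by lra.
  apply: nJ => [|i]; first by lra.
  rewrite JA JZ; apply: le_trans (ler_normD _ _) _; rewrite normrM.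
  have [Ti|nTi] := pselect (T k i).
    have h1 : `|J s i| <= d by apply: Hk1 => //; exact: Tmon (leq_maxl _ _) _ Ti.
    have h2 : `|a| * `|J u i| <= 1.
      by apply: le_trans au; rewrite normrZ ler_wpM2l.
    lra.
  apply: lerD; first by apply: le_trans (Jn s i) _; exact: Sb.
  apply: le_trans kd; have [h _] := HE k u (UE u uU).
  apply: le_trans (ler_wpM2l (normr_ge0 a) (h i nTi)) _.
  by rewrite mulrA -normrZ ler_piMl.
move=> e e0; have e20 : 0 < e / 2 by rewrite divr_gt0.
have [m1 Hm1] := smS _ e20.
have [m2 Hm2] : exists m, forall u a i, u \in U -> `|a *: u| <= 1 -> T m i ->
    `|a| * `|J u i| <= e / 2.
  elim: U UE => [|u U IHU] UE; first by exists 0%N => u a i; rewrite in_nil.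
  have [m Hm] : exists m, forall u a i, u \in U -> `|a *: u| <= 1 -> T m i ->
      `|a| * `|J u i| <= e / 2.
    by apply: IHU => v vU; apply: UE; rewrite inE vU orbT.
  have [_ van] := HE k u (UE u (mem_head _ _)).
  have [u0|u0] := eqVneq u 0.
    exists m => v a i; rewrite inE => /predU1P[->|]; last exact: Hm.
    by rewrite u0 J0 normr0 mulr0 => _ _; exact: ltW.
  have nu : 0 < `|u| by rewrite normr_gt0.
  have eu : 0 < e / 2 * `|u| by rewrite mulr_gt0.
  have [m' Hm'] := van _ eu; exists (maxn m m') => v a i.
  rewrite inE => /predU1P[->|vU] av Ti; last first.
    by apply: Hm => //; exact: Tmon (leq_maxl _ _) _ Ti.
  have Ti' := Tmon _ _ (leq_maxr m m') _ Ti.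
  apply: le_trans (ler_wpM2l (normr_ge0 a) (Hm' i Ti')) _.
  by rewrite mulrCA ler_piMr ?(ltW e20)// -normrZ.
exists (maxn m1 m2) => x i [Sx|[s [u [a [Ss uU au ->]]]]] Ti.
  apply: (@le_trans _ _ (e / 2)); last by lra.
  by apply: Hm1 => //; exact: Tmon (leq_maxl _ _) _ Ti.
rewrite JA JZ; apply: le_trans (ler_normD _ _) _; rewrite normrM (splitr e).
apply: lerD; first by apply: Hm1 => //; exact: Tmon (leq_maxl _ _) _ Ti.
by apply: Hm2 => //; exact: Tmon (leq_maxr _ _) _ Ti.
Qed.

Lemma good_subset_c0 (V : set (nat -> R)) : V `<=` @c0_seq R ->
  isometric_to X V (@sup_norm R nat) -> good mu [set: X].
Proof.
move=> Vc0 [J [JD JV Jn]].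
have Jc0 x : J x n @[n --> \oo] --> (0 : R).
  by apply: Vc0; rewrite -JV; exists x.
have Jb x : exists B, forall i, `|J x i| <= B.
  have : bounded_fun (J x).
    by apply: cvg_seq_bounded; apply/cvg_ex; exists (0 : R).
  by move=> [B [_ HB]]; exists (B + 1) => i; apply: HB; rewrite ?ltrDl.
have Jle x i : `|J x i| <= `|x|.
  by have [B HB] := Jb x; rewrite Jn; exact: sup_norm_geb HB.
apply: (@good_of_tail_game (fun j x => J x j) 2) => //.
apply: (@game_sup nat J (fun k => [set i | (k <= i)%N])) => //.
- by move=> x b b0 xb; rewrite Jn; exact: sup_norm_leb.
- by move=> k i; exact: ltnW.
move=> k u Eu; split=> [i /negP|d d0].
  rewrite -ltnNge => ik; apply: le_trans (Eu i ik) _.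
  apply: ler_wpM2l => //; rewrite lef_pV2 ?posrE ?exprn_gt0 ?ltr0n//.
  by rewrite expr2 ler_peMr// ler1n.
have /cvgr0Pnorm_le/(_ d d0)[m _ Hm] := Jc0 u.
by exists m => i mi; exact: Hm.
Qed.

End tails.

(** * Continuous functions on a countable compact space *)

Section countable_compact.
Context {R : realType} {K : topologicalType}.
Hypotheses (countK : countable [set: K]) (compK : compact [set: K])
  (hausK : hausdorff_space K).

(** A Urysohn function for the two points has countably many values, so it omits some [r] between 0
    and 1; then [f > r] and [f >= r] define the same set. *)
Lemma clopen_separation (x y : K) : x != y ->
  exists W : set K, [/\ clopen W, W y & ~ W x].
Proof.
move=> xy.
have cl1 (z : K) : closed [set z].
  by apply: compact_closed => //; exact: compact_set1.
have nK : normal_space K by exact: compact_normal.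
have d0 : [set x] `&` [set y] = set0.
  by rewrite -subset0 => z [-> /= e]; rewrite e eqxx in xy.
have /(@uniform_separatorP K R)[f [cf _ fx fy]] :=
  (@normal_separatorP R K).1 nK [set x] [set y] (cl1 x) (cl1 y) d0.
have {}fx : f x = 0 by apply: fx; exists x.
have {}fy : f y = 1 by apply: fy; exists y.
have [r /andP[r0 r1] nr] : exists2 r : R, 0 < r < 1 & forall z, f z != r.
  apply: contrapT => nr.
  have sub : `]0%R, 1%R[%classic `<=` f @` setT.
    move=> r /=; rewrite in_itv/= => r01; apply: contrapT => nz; apply: nr.
    by exists r => // z; apply/eqP => fz; apply: nz; exists z.
  have cnt : countable (`]0%R, 1%R[%classic : set R).
    apply: card_le_trans (subset_card_le sub) _.
    exact: card_le_trans (card_image_le f setT) countK.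
  have := countable_lebesgue_measure0 cnt.
  rewrite lebesgue_measure_itv/= lte01 sube0 => /eqP.
  by rewrite onee_eq0.
exists [set z | r < f z]; split => /=.
- split.
    rewrite (_ : [set z | _] = f @^-1` [set s | r < s])//.
    by apply: open_comp; [move=> z _; exact: cf|exact: open_gt].
  rewrite (_ : [set z | _] = f @^-1` [set s | r <= s]).
    by apply: closed_comp; [move=> z _; exact: cf|exact: closed_ge].
  apply/seteqP; split=> z /=; first exact: ltW.
  by move=> rz; rewrite lt_def rz andbT; exact: nr.
- by rewrite fy.
- by rewrite fx; apply/negP; rewrite -leNgt ltW.
Qed.

Lemma decreasing_clopen (T : nat -> set K) : (forall n, clopen (T n)) ->
  (forall n, T n.+1 `<=` T n) -> (forall n, T n !=set0) -> exists y, forall n, T n y.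
Proof.
move=> cT dT nT; apply: contrapT => /forallNP noy.
have Tmon k m : (k <= m)%N -> T m `<=` T k.
  elim: m => [|m IH]; first by rewrite leqn0 => /eqP ->.
  rewrite leq_eqVlt => /predU1P[->//|km].
  by apply: subset_trans (dT m) _; exact: IH.
have /compact_near_coveringP/(_ nat \oo (fun n y => ~ T n y)) := compK.
case=> [y _|m _ H].
  have /existsNP[n nTy] := noy y.
  exists (~` T n, [set m | (n <= m)%N]).
    split=> /=; last by exists n.
    by apply: open_nbhs_nbhs; split=> //; apply: closed_openC; have [] := cT n.
  by move=> [z m] /= [nz nm] /(Tmon _ _ nm).
by have [y Ty] := nT m; exact: (H m (leqnn m) y).
Qed.

Lemma cut_continuous (T : set K) (f : K -> R) : clopen T -> continuous f ->
  continuous (fun i => if `[< T i >] then f i else 0).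
Proof.
move=> [oT cT] cf i; have [Ti|nTi] := pselect (T i).
  apply: (@cvg_trans _ (f @ i)); last first.
    by rewrite (_ : (if _ then _ else _) = f i); [exact: cf|rewrite asboolT].
  apply: near_eq_cvg; have : nbhs i T by exact: open_nbhs_nbhs.
  by apply: filterS => z Tz; rewrite asboolT.
apply: (@cvg_trans _ ((fun=> 0 : R) @ i)); last first.
  by rewrite (_ : (if _ then _ else _) = 0); [exact: cvg_cst|rewrite asboolF].
apply: near_eq_cvg; have : nbhs i (~` T).
  by apply: open_nbhs_nbhs; split=> //; exact: closed_openC.
by apply: filterS => z Tz; rewrite asboolF.
Qed.

End countable_compact.

Section continuous_functions.
Context {R : realType} (mu : probability (borel_cube R) R).
Hypothesis mu_lebesgue : is_product_lebesgue mu.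
Context {X : normedModType R} {K : topologicalType}.
Hypotheses (countK : countable [set: K]) (compK : compact [set: K])
  (hausK : hausdorff_space K).
Variable J : X -> K -> R.
Hypotheses (JD : forall a x y i, J (a *: x + y) i = a * J x i + J y i)
  (JV : range J = [set f : K -> R | continuous f])
  (Jn : forall x, `|x| = sup_norm (J x)).

Let Jc x : continuous (J x).
Proof. by have : range J (J x) by [exists x]; rewrite JV. Qed.

Let Jle x i : `|J x i| <= `|x|.
Proof.
have /compact_bounded[B [_ HB]] : compact (J x @` setT).
  by apply: continuous_compact compK; apply: continuous_subspaceT; exact: Jc.
rewrite Jn; apply: (@sup_norm_geb _ _ _ (B + 1)) => j.
by apply: HB; [rewrite ltrDl|exists j].
Qed.

Let Jge x b : 0 <= b -> (forall i, `|J x i| <= b) -> `|x| <= b.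
Proof. by move=> b0 xb; rewrite Jn; exact: sup_norm_leb. Qed.

Let J0 i : J 0 i = 0.
Proof. by have := JD (-1) 0 0 i; rewrite scaler0 addr0 mulN1r addrC subrr. Qed.

Let JZ a x i : J (a *: x) i = a * J x i.
Proof. by have := JD a x 0 i; rewrite addr0 J0 addr0. Qed.

Let JA x y i : J (x + y) i = J x i + J y i.
Proof. by have := JD 1 x y i; rewrite scale1r mul1r. Qed.

Let JB x y i : J (x - y) i = J x i - J y i.
Proof. by rewrite JA -scaleN1r JZ mulN1r. Qed.

Let Jinj x y : (forall i, J x i = J y i) -> x = y.
Proof.
move=> xy; apply/eqP; rewrite -subr_eq0 -normr_le0; apply: Jge => // i.
by rewrite JB xy subrr normr0.
Qed.

Let supported (U : set K) : set X := [set x | forall i, ~ U i -> J x i = 0].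

Let cut (T : set K) (x : X) : clopen T ->
  exists y, forall i, J y i = if `[< T i >] then J x i else 0.
Proof.
move=> cT; have : range J (fun i => if `[< T i >] then J x i else 0).
  by rewrite JV; apply: cut_continuous => //; exact: Jc.
by move=> [y _ yE]; exists y => i; rewrite yE.
Qed.

Let ind (T : set K) : clopen T ->
  exists y, forall i, J y i = if `[< T i >] then 1 else 0.
Proof.
move=> cT; have : range J (fun i => if `[< T i >] then 1 else 0).
  by rewrite JV; apply: (@cut_continuous _ _ T (fun=> 1)) => // i; exact: cvg_cst.
by move=> [y _ yE]; exists y => i; rewrite yE.
Qed.

(** Such a function is a multiple of the indicator of [T] plus a function supported in the rest of
    [L]. The indicator and its opposite span two rays. *)
Let good_constant (L T : set K) (x : K) : clopen T -> T x ->
  good mu (supported (L `\` T)) ->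
  good mu [set z | supported L z /\ forall i, T i -> J z i = J z x].
Proof.
move=> cT Tx gL; have [one oneE] := ind cT.
have n0 c : 0 < c -> @splits R X [set z | supported L z /\ forall i, T i -> J z i = J z x]
    (supported (L `\` T)) [set u | exists2 v, v \in [:: one; - one] & ray v u] c 1.
  move=> c0 h [Lh hT]; pose z := J h x *: one.
  have hzE i : J (h - z) i = if `[< T i >] then 0 else J h i.
    rewrite JB JZ oneE; case: asboolP => Ti; first by rewrite mulr1 hT// subrr.
    by rewrite mulr0 subr0.
  exists (h - z), z; rewrite subrK mul1r; split=> //.
  - apply: Jge => // i; rewrite hzE; case: ifP => _; last exact: Jle.
    by rewrite normr0.
  - apply: Jge => // i; rewrite JZ oneE; case: ifP => _; last by rewrite mulr0 normr0.
    by rewrite mulr1; exact: Jle.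
  - rewrite /z; case: (ltrgtP (J h x) 0) => hx.
    + right; exists (- one); first by rewrite !inE eqxx orbT.
      by exists (- J h x); rewrite /= ?oppr_gt0// scalerN scaleNr opprK.
    + right; exists one; first by rewrite inE eqxx.
      by exists (J h x).
    + by left; rewrite hx scale0r.
  - right => i nLT; rewrite hzE; case: asboolP => Ti //.
    by apply: Lh => Li; apply: nLT.
move=> c A c01 pA; have /andP[c0 c1] := c01.
apply: (@Gamma_null_sub _ _ _ _ (porous_part (supported (L `\` T)) (c / (8 * 1)) A `|`
   (A `\` porous_part (supported (L `\` T)) (c / (8 * 1)) A))).
  by move=> y Ay; have [h|h] := pselect (porous_part (supported (L `\` T)) (c / (8 * 1)) A y);
    [left|right].
apply: Gamma_nullU.
  apply: (gL (c / (8 * 1))); last exact: dporous_part.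
  by rewrite mulr1; apply/andP; split; lra.
have gQ := @good_rays _ _ mu_lebesgue X [:: one; - one].
have sp := n0 c c0.
exact: (porous_split c01 (lexx 1) sp gQ pA).
Qed.

Let good_clopen (L : set K) (x : K) : clopen L -> L x ->
  (forall U, clopen U -> U `<=` L -> ~ U x -> good mu (supported U)) ->
  good mu (supported L).
Proof.
move=> cL Lx gU.
have /countable_injP[f finj] := countK.
have /choice[W HW] : forall n : nat, exists W : set K, [/\ clopen W, ~ W x &
    forall y, y != x -> f y = n -> W y].
  move=> n; have [[y yx fy]|ny] := pselect (exists2 y, y != x & f y = n); last first.
    exists set0; split=> //; first exact: clopen0.
    by move=> y yx fy; exfalso; apply: ny; exists y.
  have xy : x != y by rewrite eq_sym.
  have [W [cW Wy nWx]] := @clopen_separation R K countK compK hausK x y xy.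
  exists W; split=> // z _ fz; suff -> : z = y by [].
  by apply: finj; rewrite ?inE// fz fy.
(* Stage [n] removes a clopen set without [x] that contains the point numbered [n], if this is not
   [x]; so the intersection is reduced to [x]. *)
pose T := fix T n := if n is n.+1 then T n `\` W n else L.
have cT n : clopen (T n).
  elim: n => [//|n IH] /=; have [cW _ _] := HW n.
  by rewrite setDE; apply: clopenI => //; exact: clopenC.
have Tx n : T n x by elim: n => [//|n IH] /=; split=> //; have [] := HW n.
have TS n : T n.+1 `<=` T n by move=> y [].
have Tmon k m : (k <= m)%N -> T m `<=` T k.
  elim: m => [|m IH]; first by rewrite leqn0 => /eqP ->.
  rewrite leq_eqVlt => /predU1P[->//|km].
  by apply: subset_trans (TS m) _; exact: IH.
have TL n : T n `<=` L by exact: (Tmon 0%N).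
have capT y : (forall n, T n y) -> y = x.
  move=> Ty; apply: contrapT => /eqP yx; have [_ _ H] := HW (f y).
  by have [_] := Ty (f y).+1; apply; exact: H.
apply: (@good_of_game _ _ mu_lebesgue _ _ (fun k => [set u | supported (T k) u /\ J u x = 0])
  (fun _ k => [set z | supported L z /\ forall i, T k i -> J z i = J z x]) 2 2).
- by lra.
- move=> c k _; split.
    apply: good_constant => //; apply: gU.
    + by rewrite setDE; apply: clopenI => //; exact: clopenC.
    + by move=> y [].
    + by move=> [_]; apply.
  move=> h Lh; have [one oneE] := ind (cT k); have [h1 h1E] := cut h (cT k).
  pose y := h1 - J h x *: one.
  have yE i : J y i = if `[< T k i >] then J h i - J h x else 0.
    rewrite JB JZ oneE h1E; case: ifP => _; first by rewrite mulr1.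
    by rewrite mulr0 subrr.
  have zE i : J (h - y) i = if `[< T k i >] then J h x else J h i.
    rewrite JB yE; case: ifP => _; first by rewrite subKr.
    by rewrite subr0.
  have h2 : `|h| <= 2 * `|h| by rewrite ler_peMl// ler1n.
  exists y, (h - y); split.
  + by rewrite [y + _]addrC subrK.
  + apply: Jge => [|i]; first by rewrite mulr_ge0.
    rewrite yE; case: ifP => _; last by rewrite normr0 mulr_ge0.
    apply: le_trans (ler_normB _ _) _; rewrite mulr_natl mulr2n.
    by apply: lerD; exact: Jle.
  + apply: le_trans h2; apply: Jge => // i; rewrite zE.
    by case: ifP => _; exact: Jle.
  + right; split=> [i nLi|i Ti].
      by rewrite zE asboolF; [exact: Lh|move=> /TL].
    by rewrite !zE !asboolT.
  + right; split=> [i nTi|]; first by rewrite yE asboolF.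
    by rewrite yE asboolT// subrr.
- apply: (@game_sup _ _ K J T) => // k u [Tu ux]; split=> [i nTi|d d0].
    by rewrite Tu// normr0 divr_ge0.
  (* Near [x] the function is small because it vanishes there; any other point has a neighbourhood
     disjoint from all late [T n]. *)
  have /compact_near_coveringP/(_ nat \oo (fun n y => T n y -> `|J u y| <= d)) := compK.
  case=> [y _|m _ H]; last by exists m => i Ti; apply: (H m) => //=.
  have [->|yx] := eqVneq y x.
    have : nbhs x [set z | `|J u z| <= d].
      move/cvgrPdist_le: (@Jc u x) => /(_ d d0); apply: filterS => z /=.
      by rewrite ux sub0r normrN.
    move=> nx; exists ([set z | `|J u z| <= d], setT); first by split=> //; exact: filterT.
    by move=> [z m] /= [].
  have [n nTy] : exists n, ~ T n y.
    by apply: contrapT => /forallNP H; move/eqP: yx; apply; apply: capT => n;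
       apply: contrapT; exact: H.
  exists (~` T n, [set m | (n <= m)%N]).
    split=> /=; last by exists n.
    by apply: open_nbhs_nbhs; split=> //; apply: closed_openC; have [] := cT n.
  by move=> [z m] /= [nz nm] /(Tmon _ _ nm).
Qed.

Lemma good_countable_compact : good mu [set: X].
Proof.
suff gT : good mu (supported setT) by apply: (good_sub _ gT) => x _ i; case.
apply: contrapT => bad; have /countable_injP[f finj] := countK.
have good0 : good mu (supported set0).
  have g0 := @good_rays _ _ mu_lebesgue X [:: 0 : X].
  apply: (good_sub _ g0) => u u0; exists 0; first exact: mem_head.
  exists 1; rewrite ?ltr01//= scaler0; apply: Jinj => i; rewrite J0; apply: esym; apply: u0; case.
have /choice[F HF] : forall p : nat * set K, exists U : set K,
    clopen p.2 -> ~ good mu (supported p.2) ->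
    [/\ clopen U, ~ good mu (supported U), U `<=` p.2 & forall y, f y = p.1 -> ~ U y].
  move=> [n L] /=.
  have [[y Ly fy]|ny] := pselect (exists2 y, L y & f y = n); last first.
    by exists L => cL bL; split=> // y fy Ly; apply: ny; exists y.
  have [[U [cU UL nUy bU]]|nU] := pselect (exists U, [/\ clopen U, U `<=` L, ~ U y &
      ~ good mu (supported U)]).
    exists U => cL bL; split=> // z fz; suff -> : z = y by [].
    by apply: finj; rewrite ?inE// fz fy.
  exists set0 => cL bL; exfalso; apply: bL; apply: (good_clopen cL Ly) => U cU UL nUy.
  by apply: contrapT => bU; apply: nU; exists U.
pose U := fix U n := if n is n.+1 then F (n, U n) else setT.
have HU n : clopen (U n) /\ ~ good mu (supported (U n)).
  elim: n => [|n [cU bU]] /=; first by split=> //; exact: clopenT.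
  by have [] := HF (n, U n) cU bU.
have US n : U n.+1 `<=` U n by have [cU bU] := HU n; have [] := HF (n, U n) cU bU.
have [||y Uy] := @decreasing_clopen K compK U _ US _.
- by move=> n; have [] := HU n.
- move=> n; apply/set0P/eqP => U0; have [_] := HU n; rewrite U0; exact.
have [cU bU] := HU (f y); have [_ _ _ /(_ y erefl)] := HF (f y, U (f y)) cU bU.
by apply; exact: (Uy (f y).+1).
Qed.

End continuous_functions.

(** * The Tsirelson space *)

Section tsirelson_norm.
Context {R : realType}.
Implicit Types (x y z : nat -> R) (F G : {fset nat}).

Let e (j n : nat) : R := (n == j)%:R.

Lemma c00P x : c00 x <-> x 0%N = 0 /\ exists M, forall n, (M <= n)%N -> x n = 0.
Proof.
split=> [[x0 /finite_seqP[s sE]]|[x0 [M xM]]]; split=> //.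
  exists (\max_(i <- s) i).+1 => n Mn; apply/eqP/negP => /negP xn.
  have : [set` s] n by rewrite -sE.
  move=> /= ns; have := @leq_bigmax_seq _ s xpredT id n ns isT.
  by rewrite leqNgt Mn.
apply: sub_finite_set (finite_II M) => n /= xn; rewrite ltnNge.
by apply/negP => /xM xn0; rewrite xn0 eqxx in xn.
Qed.

Lemma c00_lin a x y : c00 x -> c00 y -> c00 (fun n => a * x n + y n).
Proof.
move=> /c00P[x0 [M xM]] /c00P[y0 [M' yM]]; apply/c00P; split.
  by rewrite x0 y0 mulr0 addr0.
exists (maxn M M') => n; rewrite geq_max => /andP[Mn M'n].
by rewrite xM// yM// mulr0 addr0.
Qed.

Lemma c00_0 : c00 (fun=> 0 : R).
Proof. by apply/c00P; split=> //; exists 0%N. Qed.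

Lemma c00_scale a x : c00 x -> c00 (fun n => a * x n).
Proof.
move=> cx; have := c00_lin a cx c00_0; rewrite (_ : (fun n => _ + 0) = fun n => a * x n)//.
by apply/funext => n; rewrite addr0.
Qed.

Lemma c00_add x y : c00 x -> c00 y -> c00 (fun n => x n + y n).
Proof.
move=> cx cy; have := c00_lin 1 cx cy; rewrite (_ : (fun n => _) = fun n => x n + y n)//.
by apply/funext => n; rewrite mul1r.
Qed.

Lemma c00_restr F x : c00 x -> c00 (restr F x).
Proof.
move=> /c00P[x0 [M xM]]; apply/c00P; rewrite /restr; split; first by rewrite x0 if_same.
by exists M => n /xM ->; rewrite if_same.
Qed.

Lemma c00_sum (I : Type) (s : seq I) (w : I -> nat -> R) : (forall i, c00 (w i)) ->
  c00 (fun n => \sum_(i <- s) w i n).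
Proof.
move=> cw; elim: s => [|i s IH].
  by rewrite (_ : (fun n => _) = fun=> 0)//; [exact: c00_0|apply/funext => n; rewrite big_nil].
rewrite (_ : (fun n => _) = fun n => w i n + \sum_(i <- s) w i n).
  exact: c00_add.
by apply/funext => n; rewrite big_cons.
Qed.

Lemma c00_e j : c00 (e j.+1).
Proof.
apply/c00P; split; first by rewrite /e.
by exists j.+2 => n jn; rewrite /e gtn_eqF.
Qed.

Lemma restr_id F x : (forall n, x n != 0 -> n \in F) -> restr F x = x.
Proof.
move=> xE; apply/funext => n; rewrite /restr; case: ifPn => // nE.
by apply/eqP; rewrite eq_sym; apply: contraNT nE => /xE.
Qed.

Lemma restr_eq0 F x : (forall n, n \in F -> x n = 0) -> restr F x = fun=> 0.
Proof. by move=> xE; apply/funext => n; rewrite /restr; case: ifPn => // /xE. Qed.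

Lemma restrC F G x : restr F (restr G x) = restr G (restr F x).
Proof. by apply/funext => n; rewrite /restr; case: ifP; case: ifP. Qed.

Lemma admissible_ge k (E : nat -> {fset nat}) i m : admissible k E -> (i < k)%N ->
  m \in E i -> (k <= m)%N.
Proof.
move=> [k0 Ene Elt Emin] ik mi; case: i => [|i] in ik mi *; first exact: Emin.
have /fset0Pn[m0 m0E] := Ene 0%N k0.
by apply: leq_trans (Emin _ m0E) (ltnW _); apply: (Elt 0%N i.+1).
Qed.

Lemma admissible_disjoint k (E : nat -> {fset nat}) i j m : admissible k E ->
  (i < k)%N -> (j < k)%N -> m \in E i -> m \in E j -> i = j.
Proof.
move=> [k0 Ene Elt Emin] ik jk mi mj; case: (ltngtP i j) => // ij.
- by have := Elt i j m m; rewrite ij jk ltnn mi mj => /(_ isT isT isT).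
- by have := Elt j i m m; rewrite ij ik ltnn mi mj => /(_ isT isT isT).
Qed.

Variable N : (nat -> R) -> R.
Hypotheses (normN : is_norm_on_c00 N) (fjN : figiel_johnson_eqn N).

Let N0 x : c00 x -> 0 <= N x. Proof. by have [+ _ _ _] := normN; apply. Qed.

Let NZ a x : c00 x -> N (fun n => a * x n) = `|a| * N x.
Proof. by have [_ _ + _] := normN; apply. Qed.

Let ND x y : c00 x -> c00 y -> N (fun n => x n + y n) <= N x + N y.
Proof. by have [_ _ _ +] := normN; apply. Qed.

Let Nzero : N (fun=> 0) = 0.
Proof.
rewrite (_ : (fun=> 0) = (fun n : nat => 0 * (0 : R))); last by apply/funext => n; rewrite mul0r.
by rewrite (NZ 0 c00_0) normr0 mul0r.
Qed.

Lemma norm_sum (I : Type) (s : seq I) (w : I -> nat -> R) : (forall i, c00 (w i)) ->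
  N (fun n => \sum_(i <- s) w i n) <= \sum_(i <- s) N (w i).
Proof.
move=> cw; elim: s => [|i s IH].
  by rewrite big_nil (_ : (fun n => _) = fun=> 0) ?Nzero//; apply/funext => n; rewrite big_nil.
rewrite big_cons (_ : (fun n => _) = fun n => w i n + \sum_(i <- s) w i n); last first.
  by apply/funext => n; rewrite big_cons.
by apply: le_trans (ND _ _) _ => //; [exact: c00_sum|rewrite lerD2l].
Qed.

Let norm_l1 M x : c00 x -> (forall n, (M <= n)%N -> x n = 0) ->
  N x <= \sum_(n < M) `|x n| * `|N (e n)|.
Proof.
elim: M x => [|M IH] x cx xM.
  by rewrite big_ord0 (_ : x = fun=> 0) ?Nzero//; apply/funext => n; exact: xM.
rewrite big_ord_recr/=; have [xM0|xM0] := eqVneq (x M) 0.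
  rewrite xM0 normr0 mul0r addr0; apply: IH => // n.
  by rewrite leq_eqVlt => /predU1P[<-//|]; exact: xM.
have [j jM] : exists j, M = j.+1.
  by case: M {IH xM} xM0 => [|j _]; [rewrite (cx.1) eqxx|exists j].
have cx' : c00 (fun n => - x M * e M n + x n).
  by apply: c00_lin => //; rewrite jM; exact: c00_e.
have x'M n : (M <= n)%N -> - x M * e M n + x n = 0.
  move=> Mn; rewrite /e; have [->|nM] := eqVneq n M; first by rewrite mulr1 addNr.
  by rewrite mulr0 add0r xM// ltn_neqAle eq_sym nM.
have ce : c00 (e M) by rewrite jM; exact: c00_e.
have : N x <= `|x M| * N (e M) + N (fun n => - x M * e M n + x n).
  rewrite -(NZ (x M) ce); apply: le_trans (ND (c00_scale _ ce) cx').
  rewrite [leRHS](_ : _ = N x)//; congr N; apply/funext => n.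
  by rewrite mulNr addrA subrr add0r.
move/le_trans; apply; rewrite [leLHS]addrC; apply: lerD.
  apply: le_trans (IH _ cx' x'M) _; apply: ler_sum => i _; rewrite ler_wpM2r//.
  have iM : (i : nat) == M = false by rewrite ltn_eqF.
  by rewrite /e iM mulr0 add0r.
by rewrite ler_wpM2l// ler_norm.
Qed.

(** [sup] is meaningful only for bounded sets. With [k >= M] all sets lie beyond the support; with
    [k < M] there are fewer than [M] terms, each below a weighted l_1 norm. *)
Let admissible_bounded x : c00 x -> has_ubound [set s | exists k E, admissible k E /\
  s = \sum_(i < k) N (restr (E i) x)].
Proof.
move=> cx; have [x0 [M xM]] := (c00P x).1 cx.
exists (M%:R * \sum_(n < M) `|x n| * `|N (e n)|) => _ [k [E [adm ->]]].
have [Mk|kM] := leqP M k.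
  rewrite big1 ?mulr_ge0//; first by apply: sumr_ge0 => i _; exact: mulr_ge0.
  move=> i _; rewrite restr_eq0 ?Nzero// => n nE; apply: xM.
  exact: leq_trans Mk (admissible_ge adm (ltn_ord i) nE).
apply: (@le_trans _ _ (\sum_(i < k) \sum_(n < M) `|x n| * `|N (e n)|)).
  apply: ler_sum => i _; apply: le_trans (norm_l1 (M := M) (c00_restr (E i) cx) _) _.
    by move=> n /xM; rewrite /restr => ->; rewrite if_same.
  apply: ler_sum => n _; rewrite ler_wpM2r// /restr.
  by case: ifP => _ //; rewrite normr0.
rewrite sumr_const card_ord -[leLHS]mulr_natl ler_wpM2r ?ler_nat 1?ltnW//.
by apply: sumr_ge0 => i _; exact: mulr_ge0.
Qed.

Lemma admissible_le k E x : c00 x -> admissible k E ->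
  \sum_(i < k) N (restr (E i) x) <= 2 * N x.
Proof.
move=> cx adm; rewrite -ler_pdivrMl// (fjN cx) le_max; apply/orP; right.
rewrite ler_wpM2l ?invr_ge0//; apply: ub_le_sup; first exact: admissible_bounded.
by exists k, E.
Qed.

Lemma coord_le x n : c00 x -> `|x n| <= N x.
Proof.
move=> cx; rewrite (fjN cx) le_max; apply/orP; left.
have [_ [M xM]] := (c00P x).1 cx.
apply: (@sup_norm_geb _ _ _ (\sum_(i < M) `|x i|)) => i.
have [Mi|iM] := leqP M i; first by rewrite xM// normr0 sumr_ge0.
by rewrite (bigD1 (Ordinal iM))//= lerDl sumr_ge0.
Qed.

(* The alternative [N x] in the bound absorbs the trivial families, in which one
   set contains the support of [x]. *)
Lemma norm_le x b : c00 x -> 0 <= b -> (forall n, `|x n| <= b) ->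
  (forall k E, admissible k E -> \sum_(i < k) N (restr (E i) x) <= Num.max (2 * b) (N x)) ->
  N x <= b.
Proof.
move=> cx b0 xb H; have := N0 cx; set t := N x => t0.
have : t <= Num.max b (2^-1 * Num.max (2 * b) t).
  rewrite [leLHS](fjN cx) ge_max !le_max sup_norm_leb//=; apply/orP; right.
  rewrite ler_wpM2l ?invr_ge0//; apply: ge_sup; last by move=> _ [k [E [adm ->]]]; exact: H.
  exists (\sum_(i < 1) N (restr [fset 1%N]%fset x)), 1%N, (fun=> [fset 1%N]%fset).
  split=> //; split=> //; first by move=> i _; apply/fset0Pn; exists 1%N; rewrite inE.
    by move=> i [|j] // m n /andP[].
  by move=> m; rewrite inE => /eqP ->.
by rewrite le_max => /orP[//|]; case: (leP (2 * b) t) => *; lra.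
Qed.

Lemma sum_admissible_contained k E x i0 : c00 x -> admissible k E -> (i0 < k)%N ->
  (forall n, x n != 0 -> n \in E i0) -> \sum_(i < k) N (restr (E i) x) <= N x.
Proof.
move=> cx adm ik xE; rewrite (bigD1 (Ordinal ik))//= restr_id// big1 ?addr0// => i ii.
rewrite restr_eq0 ?Nzero// => n nE; apply/eqP/negP => /negP /xE nE0.
by case/eqP: ii; apply: val_inj => /=; exact: admissible_disjoint adm _ _ nE nE0.
Qed.

Lemma norm_e j : N (e j.+1) <= 1.
Proof.
have ce := c00_e j; apply: norm_le => // [n|k E adm].
  by rewrite /e; case: eqP => _; rewrite ?normr1// normr0.
rewrite le_max; have [[i ik jE]|nE] := pselect (exists2 i, (i < k)%N & j.+1 \in E i).
  rewrite (sum_admissible_contained ce adm ik) ?orbT// => n.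
  by rewrite /e; have [->//|_] := eqVneq n j.+1; rewrite eqxx.
rewrite big1 ?mulr1 ?ler0n// => i _; rewrite restr_eq0 ?Nzero// => n nE'.
rewrite /e; case: eqP => // nj; exfalso; apply: nE; exists i => //.
by rewrite -nj.
Qed.

(** The implicit equation is unfolded by induction on a list containing the support. A set that
    contains the support yields a trivial family; otherwise every [E i] misses a point of the list,
    and the induction hypothesis applies to [restr (E i) x]. *)
Lemma norm_restr F x : c00 x -> N (restr F x) <= N x.
Proof.
move=> cx; have [s xs] : exists s : seq nat, forall n, n \notin s -> x n = 0.
  have [_ [M xM]] := (c00P x).1 cx; exists (iota 0 M) => n.
  by rewrite mem_iota/= add0n -leqNgt; exact: xM.
have [p] := ubnP (size s); elim: p => // p IH in s x cx xs *; rewrite ltnS => sp.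
apply: norm_le => [||n|k E adm]; [exact: c00_restr|exact: N0| |].
  by rewrite /restr; case: ifP => _; [exact: coord_le|rewrite normr0; exact: N0].
rewrite le_max.
have [[i ik xE]|nE] := pselect (exists2 i, (i < k)%N & forall n, x n != 0 -> n \in E i).
  rewrite (sum_admissible_contained (c00_restr F cx) adm ik) ?orbT// => n.
  by rewrite /restr; case: ifP => [_|]; [exact: xE|rewrite eqxx].
rewrite (le_trans _ (admissible_le cx adm))//; apply: ler_sum => i _; rewrite restrC.
have [m /not_implyP[xm /negP mE]] : exists m, ~ (x m != 0 -> m \in E i).
  by apply/existsNP => H; apply: nE; exists i.
have ms : m \in s by apply: contraNT xm => /xs ->.
apply: (IH [seq n <- s | n != m]); first exact: c00_restr.
  move=> n; rewrite mem_filter negb_and negbK => /orP[/eqP ->|/xs xn].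
    by rewrite /restr (negbTE mE).
  by rewrite /restr xn if_same.
apply: leq_trans sp; rewrite size_filter ltn_neqAle count_size andbT -all_count.
by apply/allPn; exists m; rewrite ?negbK.
Qed.

End tsirelson_norm.

(** * Averages of blocks and functionals on tails *)

Section tsirelson_blocks.
Context {R : realType}.
Implicit Types (x y z : nat -> R) (F G : {fset nat}).
Variable N : (nat -> R) -> R.
Hypotheses (normN : is_norm_on_c00 N) (fjN : figiel_johnson_eqn N).

Let N0 x : c00 x -> 0 <= N x. Proof. by have [+ _ _ _] := normN; apply. Qed.

Let NZ a x : c00 x -> N (fun n => a * x n) = `|a| * N x.
Proof. by have [_ _ + _] := normN; apply. Qed.

Let ND x y : c00 x -> c00 y -> N (fun n => x n + y n) <= N x + N y.
Proof. by have [_ _ _ +] := normN; apply. Qed.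

Let Nzero : N (fun=> 0) = 0.
Proof.
rewrite (_ : (fun=> 0) = (fun n : nat => 0 * (0 : R))); last by apply/funext => n; rewrite mul0r.
by rewrite (NZ 0 c00_0) normr0 mul0r.
Qed.

(* If two of the sets meet [a, a'), then the minimum of the later one lies in it. *)
Lemma admissible_block k (E : nat -> {fset nat}) (c : nat -> nat) x (a a' : nat) :
  c00 x -> N x <= 1 -> admissible k E ->
  (forall i, (i < k)%N -> c i \in E i /\ forall m, m \in E i -> (c i <= m)%N) ->
  (forall n, x n != 0 -> (a <= n < a')%N) ->
  \sum_(i < k) N (restr (E i) x) <= 1 + \sum_(i < k) (a <= c i < a')%N%:R.
Proof.
move=> cx x1 adm Hc xa.
have [[i ik ci]|nc] := pselect (exists2 i, (i < k)%N & (a <= c i < a')%N).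
  have : 1 <= \sum_(i < k) (a <= c i < a')%N%:R :> R.
    by rewrite (bigD1 (Ordinal ik))//= ci lerDl sumr_ge0.
  by have := admissible_le normN fjN cx adm; lra.
apply: (@le_trans _ _ 1); last by rewrite lerDl sumr_ge0.
have [[i ik [m mi xm]]|nm] :=
    pselect (exists2 i, (i < k)%N & exists2 m, m \in E i & x m != 0); last first.
  rewrite big1 ?ler01// => i _; rewrite restr_eq0 ?Nzero// => m mE.
  by apply/eqP; apply: contrapT => /negP xm; apply: nm; exists i => //; exists m.
rewrite (bigD1 (Ordinal ik))//= big1 ?addr0.
  exact: le_trans (norm_restr normN fjN _ cx) x1.
move=> j /eqP ji; rewrite restr_eq0 ?Nzero// => n nj.
apply/eqP; apply: contrapT => /negP xn.
have [_ _ Elt _] := adm; have /andP[am ma'] := xa _ xm; have /andP[an na'] := xa _ xn.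
case: (ltngtP i j) => ij; last by apply: ji; apply: val_inj.
- apply: nc; exists j => //; have [cj cm] := Hc j (ltn_ord j).
  rewrite (leq_trans am (ltnW (Elt i j _ _ _ mi cj))) ?ij//=.
  exact: leq_ltn_trans (cm _ nj) na'.
- apply: nc; exists i => //; have [cj cm] := Hc i ik.
  rewrite (leq_trans an (ltnW (Elt j i _ _ _ nj cj))) ?ij//=.
  exact: leq_ltn_trans (cm _ mi) ma'.
Qed.

(** The bound is half of [2 + (1 + p / r)]. If no set starts before [p], [y] is not seen and the
    average contributes at most 2. Otherwise [k < p]: a block contributes 1 plus the number of sets
    starting in it, so the average gives at most [(r + k) / r], and [y] at most 2. *)
Lemma block_average (b : nat -> nat) (x : nat -> nat -> R) y p r : (0 < r)%N ->
  c00 y -> N y <= 1 -> (forall n, y n != 0 -> (n < p)%N) -> (p <= b 0%N)%N ->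
  (forall j, b j <= b j.+1)%N -> (forall j, c00 (x j)) -> (forall j, N (x j) <= 1) ->
  (forall j n, x j n != 0 -> (b j <= n < b j.+1)%N) ->
  N (fun n => y n + \sum_(j < r) r%:R^-1 * x j n) <= 3 / 2 + p%:R / (2 * r%:R).
Proof.
move=> r0 cy y1 yp pb bS cx x1 xb; set z := fun n => \sum_(j < r) r%:R^-1 * x j n.
have r0' : 0 < r%:R :> R by rewrite ltr0n.
have pbj j : (p <= b j)%N.
  by elim: j => // j IH; exact: leq_trans IH (bS j).
have cxr j : c00 (fun n => r%:R^-1 * x j n) by exact: c00_scale.
have cz : c00 z by exact: c00_sum.
have Nxr F j : N (restr F (fun n => r%:R^-1 * x j n)) = r%:R^-1 * N (restr F (x j)).
  rewrite -[in RHS](@ger0_norm _ r%:R^-1) ?invr_ge0// -NZ; last exact: c00_restr.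
  by congr N; apply/funext => n; rewrite /restr; case: ifP => _; rewrite ?mulr0.
have z1 : N z <= 1.
  apply: le_trans (norm_sum normN _ (fun j : 'I_r => cxr j)) _.
  apply: (@le_trans _ _ (\sum_(j < r) r%:R^-1)).
    apply: ler_sum => j _; rewrite NZ// ger0_norm ?invr_ge0//.
    by rewrite ler_piMr ?invr_ge0.
  by rewrite sumr_const card_ord -[leLHS]mulr_natl mulfV// gt_eqF.
have zp n : (n < p)%N -> z n = 0.
  move=> np; rewrite /z big1// => j _; have [->|/xb/andP[bn _]] := eqVneq (x j n) 0.
    by rewrite mulr0.
  by have := leq_trans (leq_trans np (pbj j)) bn; rewrite ltnn.
have yp0 n : (p <= n)%N -> y n = 0.
  by move=> pn; apply/eqP; apply: contraLR pn => /yp; rewrite -ltnNge.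
have pr0 : 0 <= p%:R / (2 * r%:R) :> R by rewrite divr_ge0// mulr_ge0.
have restrD F : N (restr F (fun n => y n + z n)) <= N (restr F y) + N (restr F z).
  rewrite (_ : restr F _ = fun n => restr F y n + restr F z n); last first.
    by apply/funext => n; rewrite /restr; case: ifP; rewrite ?addr0.
  by apply: ND; exact: c00_restr.
apply: (norm_le normN fjN); first exact: c00_add.
- by apply: addr_ge0.
- move=> n; rewrite -/(z n); have [np|pn] := ltnP n p.
    by rewrite zp// addr0; have := coord_le fjN n cy; lra.
  by rewrite yp0// add0r; have := coord_le fjN n cz; lra.
move=> k E adm; rewrite le_max; apply/orP; left.
have -> : 2 * (3 / 2 + p%:R / (2 * r%:R)) = 3 + p%:R / r%:R :> R.
  by field; rewrite gt_eqF.
apply: (@le_trans _ _ (\sum_(i < k) (N (restr (E i) y) + N (restr (E i) z)))).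
  by apply: ler_sum => i _; exact: restrD.
rewrite big_split/=.
have pr1 : 0 <= p%:R / r%:R :> R by rewrite divr_ge0.
have [k0 Ene Elt Emin] := adm.
have [[m mE mp]|nE] := pselect (exists2 m, m \in E 0%N & (m < p)%N); last first.
  rewrite big1 ?add0r.
    by have := admissible_le normN fjN cz adm; lra.
  move=> i _; rewrite restr_eq0 ?Nzero// => n ni; apply: yp0.
  have [m mE] := fset0Pn _ (Ene _ k0).
  have pm : (p <= m)%N by rewrite leqNgt; apply/negP => mp; apply: nE; exists m.
  case: i ni => -[|i] ik ni /=.
    by rewrite leqNgt; apply/negP => np; apply: nE; exists n.
  by apply: leq_trans pm (ltnW _); exact: (Elt 0%N i.+1 _ _ _ mE ni).
have /choice[c Hc] : forall i, exists c, (i < k)%N ->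
    c \in E i /\ forall m, m \in E i -> (c <= m)%N.
  move=> i; have [ik|_] := ltnP i k; last by exists 0%N.
  have ex : exists m, m \in E i by apply/fset0Pn; exact: Ene.
  by exists (ex_minn ex) => _; case: ex_minnP.
have H1 : \sum_(i < k) N (restr (E i) z) <=
    r%:R^-1 * \sum_(j < r) (1 + \sum_(i < k) (b j <= c i < b j.+1)%N%:R).
  apply: (@le_trans _ _ (\sum_(i < k) \sum_(j < r) r%:R^-1 * N (restr (E i) (x j)))).
    apply: ler_sum => i _; rewrite (_ : restr (E i) z =
        fun n => \sum_(j < r) restr (E i) (fun n => r%:R^-1 * x j n) n); last first.
      by apply/funext => n; rewrite /restr; case: ifP => // _; rewrite big1.
    apply: le_trans (norm_sum normN _ _) _; first by move=> j; exact: c00_restr.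
    by under eq_bigr do rewrite Nxr.
  rewrite exchange_big mulr_sumr /=; apply: ler_sum => j _.
  rewrite -mulr_sumr ler_wpM2l ?invr_ge0//.
  exact: admissible_block (cx j) (x1 j) adm Hc (xb j).
have H2 i : \sum_(j < r) (b j <= c i < b j.+1)%N%:R <= 1 :> R.
  apply: (@le_trans _ _ (c i < b r)%N%:R); last by case: (_ < _)%N.
  elim: (r) => [|q IH]; first by rewrite big_ord0.
  rewrite big_ord_recr/=; apply: le_trans (lerD IH (lexx _)) _.
  have := bS q; case: (ltnP (c i) (b q)) => [cb bb|_ _] /=; last by rewrite add0r.
  by rewrite addr0 (leq_trans cb bb).
have H3 : \sum_(j < r) (1 + \sum_(i < k) (b j <= c i < b j.+1)%N%:R) <= r%:R + p%:R :> R.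
  rewrite big_split/= sumr_const card_ord lerD2l exchange_big/=.
  apply: (@le_trans _ _ (\sum_(i < k) 1)); first by apply: ler_sum => i _; exact: H2.
  by rewrite sumr_const card_ord ler_nat (leq_trans (Emin m mE) (ltnW mp)).
have H4 : r%:R^-1 * \sum_(j < r) (1 + \sum_(i < k) (b j <= c i < b j.+1)%N%:R)
    <= 1 + p%:R / r%:R :> R.
  have -> : 1 + p%:R / r%:R = r%:R^-1 * (r%:R + p%:R) :> R by field; rewrite gt_eqF.
  by rewrite ler_wpM2l// invr_ge0.
have := admissible_le normN fjN cy adm; lra.
Qed.

Variables (psi : (nat -> R) -> R) (C : R).
Hypotheses (psiD : forall a x y, c00 x -> c00 y ->
    psi (fun n => a * x n + y n) = a * psi x + psi y)
  (psiC : forall x, c00 x -> `|psi x| <= C * N x).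

Lemma functional0 : psi (fun=> 0) = 0.
Proof.
have := psiD (-1) c00_0 c00_0.
by rewrite (_ : (fun=> _) = fun=> 0)/=;
   [rewrite mulN1r addNr|apply/funext => n; rewrite mulr0 addr0].
Qed.

Lemma functionalZ a x : c00 x -> psi (fun n => a * x n) = a * psi x.
Proof.
move=> cx; have := psiD a cx c00_0; rewrite functional0 addr0 => <-.
by congr psi; apply/funext => n; rewrite addr0.
Qed.

Lemma functional_sum k (a : nat -> R) (v : nat -> nat -> R) : (forall j, c00 (v j)) ->
  psi (fun n => \sum_(j < k) a j * v j n) = \sum_(j < k) a j * psi (v j).
Proof.
move=> cv; elim: k => [|k IH].
  rewrite big_ord0 (_ : (fun n => _) = fun=> 0) ?functional0//.
  by apply/funext => n; rewrite big_ord0.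
rewrite big_ord_recr/= -IH addrC -psiD//; last first.
  by apply: c00_sum => j; exact: c00_scale.
by congr psi; apply/funext => n; rewrite big_ord_recr/= addrC.
Qed.

(* If [e] bounds the functional on a tail, but [4/5 * e] does not on any tail, then a
   vector plus the average of very many later ones nearly doubles the value of the
   functional, while its norm is at most [8/5]. *)
Lemma functional_tail (e : R) : 0 < e -> exists m, forall x, c00 x ->
  (forall n, (n < m)%N -> x n = 0) -> `|psi x| <= e * N x.
Proof.
pose tail (e : R) := exists m, forall x, c00 x ->
  (forall n, (n < m)%N -> x n = 0) -> `|psi x| <= e * N x.
have step d : 0 < d -> tail d -> tail (4 / 5 * d).
  move=> d0 [n Hn]; apply: contrapT => /forallNP nt.
  have /choice[f Hf] : forall m, exists zM : (nat -> R) * nat,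
      [/\ c00 zM.1, N zM.1 <= 1, forall i, zM.1 i != 0 -> (m <= i < zM.2)%N,
          (m <= zM.2)%N & 4 / 5 * d < psi zM.1].
    move=> m; have /existsNP[x /not_implyP[cx /not_implyP[xm /negP]]] := nt m.
    rewrite -ltNge => psix.
    have Nx : 0 < N x.
      rewrite lt_def N0// andbT; apply/eqP => Nx0; move: psix; rewrite Nx0 mulr0.
      by have := psiC cx; rewrite Nx0 mulr0 leNgt => /negP.
    have [_ [M xM]] := (c00P x).1 cx.
    exists ((fun i => Num.sg (psi x) / N x * x i), maxn M m); split=> /=.
    - exact: c00_scale.
    - rewrite NZ// normrM normfV (gtr0_norm Nx) divfK ?gt_eqF// normr_sg.
      by case: (_ != 0).
    - move=> i; rewrite mulf_eq0 negb_or => /andP[_ xi].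
      have -> : (m <= i)%N by rewrite leqNgt; apply: contra xi => /xm ->.
      by rewrite leq_max ltnNge; apply/orP; left; apply: contra xi => /xM ->.
    - exact: leq_maxr.
    - rewrite functionalZ// [_ / N x * _]mulrAC -normrEsg ltr_pdivlMr//.
  pose p := (f n).2; pose b := fix b j := if j is j.+1 then (f (b j)).2 else p.
  (* This makes [p / (2 * r)] at most 1/10 and [N y] at most 8/5, whereas the functional exceeds
     [4 / 5 * d] twice, on the first vector and on the average. *)
  pose r := (5 * p).+1.
  have cx j : c00 (f j).1 by have [] := Hf j.
  have x1 j : N (f j).1 <= 1 by have [] := Hf j.
  have fn0 i : (f n).1 i != 0 -> (n <= i < p)%N by have [] := Hf n; move=> _ _ + _ _; apply.
  have np : (n <= p)%N by have [] := Hf n.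
  have bS j : (b j <= b j.+1)%N by have [] := Hf (b j).
  have nb j : (n <= b j)%N by elim: j => // j IH; exact: leq_trans IH (bS j).
  have xb j i : (f (b j)).1 i != 0 -> (b j <= i < b j.+1)%N.
    by have [] := Hf (b j); move=> _ _ + _ _; apply.
  pose x j := (f (b j)).1.
  have cxj j : c00 (x j) by exact: cx.
  have cs : c00 (fun i => \sum_(j < r) r%:R^-1 * x j i).
    by apply: c00_sum => j; exact: c00_scale.
  have r0 : 0 < r%:R :> R by rewrite ltr0n.
  have np' i : (f n).1 i != 0 -> (i < p)%N by move=> /fn0/andP[].
  have := @block_average b x (f n).1 p r isT (cx n) (x1 n) np' (leqnn _) bS
    (fun j => cx (b j)) (fun j => x1 (b j)) xb.
  set y := fun i => _ => Ny.
  have cy : c00 y by exact: c00_add.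
  have yn i : (i < n)%N -> y i = 0.
    move=> ni; rewrite /y big1 ?addr0.
      by apply/eqP; apply: contraT => /fn0/andP[h _]; rewrite ltnNge h in ni.
    move=> j _; apply/eqP; rewrite mulf_eq0; apply/orP; right.
    by apply: contraT => /xb/andP[/(leq_trans (nb j)) h _]; rewrite ltnNge h in ni.
  have yE : psi y = psi (f n).1 + \sum_(j < r) r%:R^-1 * psi (x j).
    rewrite -(functional_sum _ (fun=> r%:R^-1))//.
    have := psiD 1 (cx n) cs; rewrite mul1r => <-.
    by congr psi; apply/funext => i; rewrite mul1r.
  have : \sum_(j < r) r%:R^-1 * (4 / 5 * d) <= \sum_(j < r) r%:R^-1 * psi (x j).
    apply: ler_sum => j _; rewrite ler_wpM2l ?invr_ge0//.
    by have [_ _ _ _ /ltW] := Hf (b j).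
  rewrite sumr_const card_ord -[leLHS]mulr_natl mulrA mulfV ?gt_eqF// mul1r => xge.
  have [_ _ _ _ ngt] := Hf n.
  have pr : p%:R / (2 * r%:R) <= 1 / 10 :> R.
    have rE : r%:R = 5 * p%:R + 1 :> R by rewrite -natrM -natr1.
    by rewrite ler_pdivrMr ?mulr_gt0// rE; move: (ler0n R p) => *; lra.
  have yle : psi y <= d * N y by apply: le_trans (Hn y cy yn); exact: ler_norm.
  have : d * N y <= d * (8 / 5) by rewrite ler_wpM2l ?(ltW d0)//; apply: le_trans Ny _;
    move: (p%:R / _) pr => t pr; lra.
  by lra.
have iter k : tail ((`|C| + 1) * (4 / 5) ^+ k).
  elim: k => [|k IH].
    exists 0%N => x cx _; apply: le_trans (psiC cx) _.
    rewrite expr0 mulr1 ler_wpM2r ?N0//; apply: le_trans (ler_norm _) _.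
    by rewrite lerDl.
  rewrite exprS mulrCA; apply: step => //.
move=> e0; have : geometric (`|C| + 1) (4 / 5 : R) @ \oo --> (0 : R).
  by apply: cvg_geometric; rewrite ger0_norm; lra.
move/cvgrPdist_lt => /(_ e e0)[k _ /(_ k (leqnn k))] /=.
rewrite sub0r normrN => ke; have [m Hm] := iter k; exists m => x cx xm.
apply: le_trans (Hm x cx xm) _; rewrite ler_wpM2r ?N0//.
exact: le_trans (ler_norm _) (ltW ke).
Qed.

End tsirelson_blocks.

(** * The game in the dual of the Figiel-Johnson space *)

Section tsirelson_game.
Context {R : realType} {X : normedModType R}.
Variable N : (nat -> R) -> R.
Hypotheses (normN : is_norm_on_c00 N) (fjN : figiel_johnson_eqn N).
Variable phi : X -> (nat -> R) -> R.
Hypotheses (phiX : forall z a f g, phi (a *: f + g) z = a * phi f z + phi g z)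
  (phiD : forall f a x y, c00 x -> c00 y ->
     phi f (fun n => a * x n + y n) = a * phi f x + phi f y)
  (phi_le : forall f z, c00 z -> `|phi f z| <= `|f| * N z)
  (phi_ge : forall f b, 0 <= b -> (forall z, c00 z -> `|phi f z| <= b * N z) -> `|f| <= b).

Let e (j n : nat) : R := (n == j)%:R.

Let N0 x : c00 x -> 0 <= N x. Proof. by have [+ _ _ _] := normN; apply. Qed.

Let phi0 z : phi 0 z = 0.
Proof. by have := phiX z (-1) 0 0; rewrite scaler0 addr0 mulN1r addNr. Qed.

Let common_tail (U : seq X) (d : R) : 0 < d -> exists m, forall u, u \in U ->
  forall z, c00 z -> (forall n, (n < m)%N -> z n = 0) -> `|phi u z| <= d * `|u| * N z.
Proof.
move=> d0; elim: U => [|u U [m Hm]]; first by exists 0%N.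
have [m' Hm'] : exists m, forall z, c00 z -> (forall n, (n < m)%N -> z n = 0) ->
    `|phi u z| <= d * `|u| * N z.
  have [->|u0] := eqVneq u 0.
    by exists 0%N => z cz _; rewrite phi0 !normr0 mulr0 mul0r.
  have du : 0 < d * `|u| by rewrite mulr_gt0// normr_gt0.
  exact: (functional_tail normN fjN (@phiD u) (@phi_le u) du).
exists (maxn m m') => v; rewrite inE => /predU1P[->|vU] z cz zm.
  by apply: Hm' => // n nm; apply: zm; rewrite leq_max nm orbT.
by apply: Hm => // n nm; apply: zm; rewrite leq_max nm.
Qed.

Let phi_low u k z : tail_cone (fun j f => phi f (e j.+1)) k u -> c00 z ->
  (forall n, (k < n)%N -> z n = 0) -> forall B, (forall n, `|z n| <= B) ->
  `|phi u z| <= `|u| / k.+1%:R * B.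
Proof.
move=> uk cz zk B zB.
have zE : z = fun n => \sum_(j < k) z j.+1 * e j.+1 n.
  apply/funext => -[|n].
    by rewrite (cz.1) big1// => j _; rewrite /e mulr0.
  have [kn|nk] := leqP k n.
    rewrite zk ?ltnS// big1// => j _; rewrite /e eqSS gtn_eqF ?mulr0//.
    exact: leq_trans kn.
  rewrite (bigD1 (Ordinal nk))//= /e eqxx mulr1 big1 ?addr0// => j /eqP jn.
  rewrite eqSS (_ : n == j = false) ?mulr0//; apply/eqP => nj; apply: jn.
  exact: val_inj.
have B0 : 0 <= B by apply: le_trans (zB 0%N).
have -> : phi u z = \sum_(j < k) z j.+1 * phi u (e j.+1).
  rewrite {1}zE; apply: (functional_sum (@phiD u) k (fun j => z j.+1)
    (v := fun j => e j.+1)) => j; exact: c00_e.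
apply: le_trans (ler_norm_sum _ _ _) _.
apply: (@le_trans _ _ (\sum_(j < k) B * (`|u| / k.+1%:R ^+ 2))).
  by apply: ler_sum => j _; rewrite normrM ler_pM//; exact: uk.
rewrite sumr_const card_ord -[leLHS]mulr_natl.
have -> : `|u| / k.+1%:R * B = k.+1%:R * (B * (`|u| / k.+1%:R ^+ 2)).
  have k0 : k.+1%:R != 0 :> R by rewrite pnatr_eq0.
  by move: k.+1%:R k0 => t t0; field.
by rewrite ler_wpM2r ?ler_nat// mulr_ge0// divr_ge0// exprn_ge0.
Qed.

Let segment (a b : nat) : {fset nat} := [fset n in iota a (b - a)]%fset.

Let in_segment a b n : (n \in segment a b) = (a <= n < b)%N.
Proof.
rewrite !inE mem_iota; case: (leqP a n) => //= an; case: (leqP a b) => ab.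
  by rewrite subnKC.
by rewrite (eqP (ltnW ab)) addn0 !ltnNge an (leq_trans (ltnW ab) an).
Qed.

(** The cone makes [u] small up to [k], and [functional_tail] makes it small from [m] on. Only the
    segment in between counts fully, and the next rounds are played beyond it. *)
Let phi_split u k m z d : (k < m)%N -> 0 <= d ->
  tail_cone (fun j f => phi f (e j.+1)) k u ->
  (forall z, c00 z -> (forall n, (n < m)%N -> z n = 0) -> `|phi u z| <= d * `|u| * N z) ->
  c00 z -> `|phi u z| <= `|u| * (k.+1%:R^-1 * N z + N (restr (segment k.+1 m) z) + d * N z).
Proof.
move=> km d0 uk um cz; set I := segment k.+1 m.
pose low := restr (segment 0 k.+1) z.
pose high n := (- 1) * restr (segment 0 m) z n + z n.
have cl : c00 low by exact: c00_restr.
have cm : c00 (restr I z) by exact: c00_restr.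
have ch : c00 high by apply: c00_lin => //; exact: c00_restr.
have highE n : high n = if (n < m)%N then 0 else z n.
  rewrite /high /restr in_segment /=; case: ifP => _; first by rewrite mulN1r addNr.
  by rewrite mulr0 add0r.
have -> : phi u z = phi u low + (phi u (restr I z) + phi u high).
  have -> : phi u z = phi u (fun n => 1 * low n + (1 * restr I z n + high n)).
    congr phi; apply/funext => n; rewrite highE /low /restr !in_segment /= !mul1r.
    rewrite ltnS; case: (leqP n k) => nk /=.
      by rewrite (leq_ltn_trans nk km) !addr0.
    by case: (ltnP n m) => nm /=; rewrite ?add0r ?addr0.
  have c1 : c00 (fun n => 1 * restr I z n + high n) by apply: c00_lin cm ch.
  by rewrite (phiD _ 1 cl c1) (phiD _ 1 cm ch) !mul1r.
apply: le_trans (ler_normD _ _) _.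
apply: le_trans (lerD (lexx _) (ler_normD _ _)) _.
have h1 : `|phi u low| <= `|u| / k.+1%:R * N z.
  apply: phi_low => // n; first by move=> kn; rewrite /low /restr in_segment ltnNge kn.
  rewrite /low /restr; case: ifP => _; first exact: coord_le.
  by rewrite normr0 N0.
have h2 := phi_le u cm.
have h3 : `|phi u high| <= d * `|u| * N z.
  have /le_trans : `|phi u high| <= d * `|u| * N high.
    by apply: um => // n nm; rewrite highE nm.
  apply; rewrite ler_wpM2l ?mulr_ge0//.
  have -> : high = restr (segment m (projT1 (cid ((c00P z).1 cz).2))) z.
    apply/funext => n; rewrite highE /restr in_segment.
    case: cid => M /= zM; case: (ltnP n m) => //= _.
    by case: (ltnP n M) => // /zM.
  exact: norm_restr.
have -> : `|u| * (k.+1%:R^-1 * N z + N (restr I z) + d * N z) =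
    `|u| / k.+1%:R * N z + (`|u| * N (restr I z) + d * `|u| * N z) by ring.
by rewrite !lerD.
Qed.

(* Invariant: on [z], the vectors of [S] are bounded by the norms of the
   restrictions of [z] to one segment per round played, up to [b * N z]; the
   segments form an admissible family, as they lie beyond the total number of
   rounds. *)
Lemma game_dual n : game 3 (tail_cone (fun j f => phi f (e j.+1))) n [set 0].
Proof.
suff H r : forall i S (b : R) (E : nat -> {fset nat}) M, (r + i)%N = n -> 0 <= b < 1 ->
    (forall l, (l < i)%N -> E l != fset0) ->
    (forall l m, (l < i)%N -> m \in E l -> (n <= m < M)%N) ->
    (forall l l' m m', (l < l' < i)%N -> m \in E l -> m' \in E l' -> (m < m')%N) ->
    (forall s z, S s -> c00 z ->
       `|phi s z| <= \sum_(l < i) N (restr (E l) z) + b * N z) ->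
    game 3 (tail_cone (fun j f => phi f (e j.+1))) r S.
  apply: (H n 0%N [set 0] 0 (fun=> fset0) 0%N) => //; rewrite ?addn0 ?lexx ?ltr01//.
  by move=> s z -> cz; rewrite phi0 normr0 big_ord0 mul0r addr0.
have bound i S (b : R) (E : nat -> {fset nat}) M : (i <= n)%N -> 0 <= b < 1 ->
    (forall l, (l < i)%N -> E l != fset0) ->
    (forall l m, (l < i)%N -> m \in E l -> (n <= m < M)%N) ->
    (forall l l' m m', (l < l' < i)%N -> m \in E l -> m' \in E l' -> (m < m')%N) ->
    (forall s z, S s -> c00 z ->
       `|phi s z| <= \sum_(l < i) N (restr (E l) z) + b * N z) ->
    forall s, S s -> `|s| <= 3.
  move=> ni /andP[b0 b1] Ene En Elt HS s Ss; apply: phi_ge => // z cz.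
  apply: le_trans (HS s z Ss cz) _.
  have bz : b * N z <= N z by rewrite ler_piMl ?N0// ltW.
  suff : \sum_(l < i) N (restr (E l) z) <= 2 * N z by lra.
  case: i => [|i] in ni Ene En Elt HS *; first by rewrite big_ord0 mulr_ge0 ?N0.
  apply: (admissible_le normN fjN cz); split=> //.
  by move=> m /(En 0%N _ isT)/andP[+ _]; exact: leq_trans.
elim: r => [|r IH] i S b E M rin b01 Ene En Elt HS.
  by split=> //; apply: bound b01 Ene En Elt HS; rewrite -rin.
split; first by apply: bound b01 Ene En Elt HS; rewrite -rin leq_addl.
have /andP[b0 b1] := b01; pose d := (1 - b) / 4.
have d0 : 0 < d by rewrite divr_gt0// subr_gt0.
(* [k >= n] is for admissibility, [k >= M] places the new segment after the previous ones, and
   [k >= K] makes the low part cost at most [d]. With [d] for the high part, [b] grows by half of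
   its distance to 1. *)
have [K HK] := exists_invn d0; pose k := maxn K (maxn n M); exists k => U UE.
have kd : k.+1%:R^-1 <= d.
  apply: le_trans (ltW HK).
  by rewrite lef_pV2 ?posrE ?ltr0n// ler_nat ltnS leq_maxl.
have nk : (n <= k)%N by rewrite !leq_max leqnn orbT.
have Mk : (M <= k)%N by rewrite !leq_max leqnn !orbT.
have [m0 Hm0] := common_tail U d0; pose m := maxn m0 k.+2.
have km : (k.+1 < m)%N by rewrite leq_max leqnn orbT.
pose I := segment k.+1 m.
pose E' l := if (l < i)%N then E l else I.
have E'I : E' i = I by rewrite /E' ltnn.
have sumE' z : \sum_(l < i.+1) N (restr (E' l) z) =
    \sum_(l < i) N (restr (E l) z) + N (restr I z).
  rewrite big_ord_recr/= E'I; congr (_ + _); apply: eq_bigr => l _.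
  by rewrite /E' ltn_ord.
apply: (IH i.+1 _ (b + 2 * d) E' m).
- by rewrite addnS -addSn.
- by apply/andP; split; rewrite /d; lra.
- move=> l li; rewrite /E'; case: ifP => [|_]; first exact: Ene.
  by apply/fset0Pn; exists k.+1; rewrite in_segment leqnn.
- move=> l p li; rewrite /E'; case: ifP => [l_i pE|_].
    have /andP[-> pM] := En l p l_i pE.
    exact: leq_trans pM (leq_trans Mk (ltnW (ltnW km))).
  by rewrite in_segment => /andP[kp ->]; rewrite (leq_trans nk (ltnW kp)).
- move=> l l' p p' /andP[ll']; rewrite ltnS leq_eqVlt => /predU1P[l'i|l'i].
    rewrite /E' l'i ltnn -l'i ll' => pE; rewrite in_segment => /andP[kp' _].
    have /andP[_ pM] := En l p (leq_trans ll' (eq_leq l'i)) pE.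
    exact: leq_trans pM (leq_trans Mk (ltnW kp')).
  by rewrite /E' l'i (ltn_trans ll' l'i); apply: Elt; rewrite ll'.
move=> x z Sx cz; rewrite sumE'.
have NI : 0 <= N (restr I z) by apply: N0; exact: c00_restr.
have Nz := N0 cz; have dz : 0 <= d * N z by rewrite mulr_ge0// ltW.
case: Sx => [/HS/(_ cz)|[s [u [a [Ss uU au ->]]]]]; first by lra.
have um z' : c00 z' -> (forall n, (n < m)%N -> z' n = 0) -> `|phi u z'| <= d * `|u| * N z'.
  by move=> cz' zm; apply: Hm0 => // p pm; apply: zm; rewrite leq_max pm.
have := phi_split (ltnW km) (ltW d0) (UE u uU) um cz; rewrite -/I => h1.
rewrite addrC phiX; apply: le_trans (ler_normD _ _) _; rewrite normrM.
have := HS s z Ss cz.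
suff : `|a| * `|phi u z| <= N (restr I z) + 2 * d * N z by lra.
apply: le_trans (ler_wpM2l _ h1) _ => //.
rewrite normrZ in au; rewrite mulrA.
have kz : k.+1%:R^-1 * N z <= d * N z by rewrite ler_wpM2r.
have ki : 0 <= k.+1%:R^-1 * N z by rewrite mulr_ge0// invr_ge0.
apply: (@le_trans _ _ (k.+1%:R^-1 * N z + N (restr I z) + d * N z)).
  by rewrite ler_piMl// !addr_ge0.
rewrite [_^-1 * _ + _]addrC -addrA lerD2l.
by rewrite [_ * d]mulrC mulr2n mulrDr mulr1 mulrDl lerD2r.
Qed.

End tsirelson_game.

Section conclusion.
Context {R : realType} (mu : probability (borel_cube R) R).
Hypothesis mu_lebesgue : is_product_lebesgue mu.

Lemma good_tsirelson (X : normedModType R) : is_tsirelson X -> good mu [set: X].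
Proof.
move=> [N [Y [iota [normN fjN [iotaD iotaN dI] [J [JX JV Jn]]]]]].
have Js f : scalar (J f) /\ continuous (J f).
  by have : range J (J f) by [exists f]; rewrite JV.
have JD f a x y : J f (a *: x + y) = a * J f x + J f y by exact: (Js f).1.
have J0 f : J f 0 = 0 by have := JD f (-1) 0 0; rewrite scaler0 addr0 mulN1r addNr.
have JZ f a x : J f (a *: x) = a * J f x.
  by have := JD f a x 0; rewrite addr0 J0 addr0.
have bnd f : has_ubound [set `|J f y| | y in [set y : Y | `|y| <= 1]].
  have /cvgrPdist_lt/(_ 1 ltr01) := (Js f).2 0.
  rewrite J0 => /nbhs_normP[d /= d0 Hd].
  exists (2 / d) => _ [y /= y1 <-].
  have : `|J f ((d / 2) *: y)| < 1.
    have := Hd ((d / 2) *: y); rewrite /= !sub0r !normrN; apply.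
    rewrite normrZ gtr0_norm ?divr_gt0//.
    apply: (@le_lt_trans _ _ (d / 2)); last by lra.
    by rewrite ler_piMr// ltW// divr_gt0.
  rewrite JZ normrM gtr0_norm ?divr_gt0// => /ltW.
  by rewrite -ler_pdivlMl ?divr_gt0// mulr1 invf_div.
have Jle f y : `|J f y| <= `|f| * `|y|.
  have [->|y0] := eqVneq y 0; first by rewrite J0 !normr0 mulr0.
  have ny : 0 < `|y| by rewrite normr_gt0.
  have : `|J f (`|y|^-1 *: y)| <= `|f|.
    rewrite Jn; apply: ub_le_sup; first exact: bnd.
    exists (`|y|^-1 *: y) => //=.
    by rewrite normrZ normfV normr_id mulVf ?gt_eqF.
  by rewrite JZ normrM normfV normr_id ler_pdivrMl// mulrC.
have Jge f b : 0 <= b -> (forall z, c00 z -> `|J f (iota z)| <= b * N z) -> `|f| <= b.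
  move=> b0 H; rewrite Jn.
  have Hy y : `|J f y| <= b * `|y|.
    apply/ler_addgt0Pr => eps eps0.
    (* The functional is controlled on the image of [c00] only; replacing [y] by a vector of this
       dense set costs at most [(|f| + b) * d], which is below [eps]. *)
    have e0 : 0 < eps / (`|f| + b + 1) by rewrite divr_gt0// ltr_wpDl// addr_ge0.
    set d := eps / _ in e0.
    have [||x [yz [z cz zx]]] := dI (ball y d).
    - by exists y; exact: ballxx.
    - exact: ball_open.
    move: yz; rewrite -zx -ball_normE /= => yz.
    have -> : y = (y - iota z) + iota z by rewrite subrK.
    have := JD f 1 (y - iota z) (iota z); rewrite scale1r mul1r => ->.
    apply: le_trans (ler_normD _ _) _.
    have h1 := Jle f (y - iota z); have h2 := H z cz.
    have h3 : N z <= `|y| + `|y - iota z|.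
      rewrite -iotaN//; have := ler_normB y (y - iota z); rewrite opprB addrC subrK.
      by [].
    have h4 : b * N z <= b * (`|y| + `|y - iota z|) by rewrite ler_wpM2l.
    have h5 : (`|f| + b) * `|y - iota z| <= (`|f| + b + 1) * d.
      apply: ler_pM; rewrite ?addr_ge0//; last exact: ltW.
      by rewrite lerDl.
    have h6 : (`|f| + b + 1) * d = eps.
      by rewrite /d mulrC divfK// gt_eqF// ltr_wpDl// addr_ge0.
    rewrite subrK; rewrite h6 mulrDl in h5; rewrite mulrDr in h4.
    lra.
  apply: ge_sup; first by exists `|J f 0|, 0 => //=; rewrite normr0.
  move=> _ [y /= y1 <-]; apply: le_trans (Hy y) _.
  by rewrite ler_piMr.
pose l j f := J f (iota (fun n => (n == j.+1)%:R)).
apply: (@good_of_tail_game _ _ mu_lebesgue _ l 3).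
- by move=> j a x y; exact: JX.
- move=> j f; apply: le_trans (Jle _ _) _; rewrite iotaN; last exact: c00_e.
  by rewrite ler_piMr//; exact: norm_e.
apply: (@game_dual _ _ _ normN fjN (fun f z => J f (iota z))) => //.
- by move=> f a x y cx cy; rewrite iotaD// JD.
- by move=> f z cz; rewrite -iotaN.
Qed.

End conclusion.

Theorem theorem4p6 (R : realType) (mu : probability (borel_cube R) R)
    (mu_lebesgue : is_product_lebesgue mu) (X : completeNormedModType R) :
  [\/ is_c0 X, is_C_of_countable_compact X, is_tsirelson X |
      is_closed_subspace_of_c0 X] ->
  forall A : set X, sigma_porous A -> Gamma_null mu A.
Proof.
move=> HX A; apply: good_sigma_porous => //; case: HX.
- by move=> XJ; exact: (good_subset_c0 mu_lebesgue _ XJ).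
- by move=> [K [cK kK hK [J [JD JV Jn]]]]; exact: good_countable_compact JD JV Jn.
- exact: good_tsirelson.
- by move=> [V [[Vc0 _ _ _] XJ]]; exact: good_subset_c0 XJ.
Qed.
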